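(* Let $q\ge2$ and $H_q(x)=\max(x^2,|x|^q)$. Let $d\mu(x)=e^{-V(x)}dx$ be a probability measure on $\mathbb R$. Assume that $V:\mathbb R\to\mathbb R$ is locally bounded, and $C^2$ in neighborhoods of $+\infty$ and $-\infty$, with (i) $\displaystyle\liminf_{|x|\to\infty}\mathrm{sign}(x)V'(x)>0$; (ii) $\displaystyle\lim_{|x|\to\infty}\frac{V''(x)}{V'(x)^2}=0$. Then there exists $\kappa<+\infty$ such that for every locally Lipschitz $f:\mathbb R\to\mathbb R$, $$\mathbf{Ent}_\mu(f^2)\le\kappa\int H_q\left(\frac{f'}{f}\right)f^2\,d\mu$$ if and only if $$\limsup_{|x|\to\infty}\frac{V(x)}{|V'(x)|^q}<\infty.$$
   Context: $\mathbf{Ent}_\mu(g)=\int g\log g\,d\mu-\left(\int g\,d\mu\right)\log\left(\int g\,d\mu\right)$. For a locally Lipschitz $f$, $|f'|(x)=\lim_{r\to0^+}\sup_{|x-y|\le r}\frac{|f(x)-f(y)|}{|x-y|}$, equal almost everywhere to the absolute value of the usual derivative; only $|f'|$ matters since $H_q$ is even. The integrand $H_q(f'/f)f^2$ is read as $0$ at points where $f=0$ (where $f'=0$ almost everywhere). *)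

(* Defs.v *)
From HB Require Import structures.
From mathcomp Require Export all_boot all_order all_algebra.
From mathcomp Require Export all_classical all_reals all_analysis.

Set Implicit Arguments.
Unset Strict Implicit.
Unset Printing Implicit Defensive.

Import Order.TTheory GRing.Theory Num.Theory.
Import numFieldNormedType.Exports.

Local Open Scope classical_set_scope.
Local Open Scope ring_scope.

(* The filter |x| --> +oo on the real line (both ends at once). *)
Definition absinfty_nbhs (R : realType) : set_system R :=
  fun P => exists M : R, forall x, M < `|x| -> P x.
Arguments absinfty_nbhs R : clear implicits.

#[global] Instance absinfty_nbhs_filter (R : realType) :
  ProperFilter (absinfty_nbhs R).
Proof.
split; first (case=> M MP; apply: (MP (`|M| + 1)) => /=).
  rewrite (ger0_norm (addr_ge0 (normr_ge0 M) ler01)).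
  by rewrite (le_lt_trans (ler_norm M))// ltrDl.
split; first by exists 0.
- move=> P Q [M MP] [N NQ]; exists (Num.max M N) => x.
  by rewrite gt_max => /andP[/MP Px /NQ Qx].
- by move=> P Q PQ [M MP]; exists M => x /MP /PQ.
Qed.

Definition locally_lipschitz (R : realType) (f : R -> R) : Prop :=
  forall x : R, exists2 U : set R, nbhs x U & [lipschitz f y | y in U].

(* The length of the gradient |f'|(x).  When f is Lipschitz near x the suprema
   are finite for small r and nonincreasing as r decreases to 0, so the limit
   exists in R. *)
Definition local_slope (R : realType) (f : R -> R) (x : R) : R :=
  lim (sup [set `|f x - f y| / `|x - y| | y in [set y | 0 < `|x - y| <= r]]
       @[r --> 0^'+]).

Definition Hq (R : realType) (q x : R) : R := Num.max (x ^+ 2) (`|x| `^ q).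

(* Ent_mu(g) for g >= 0.  Since ln 0 = 0 here, g * ln g is 0 where g = 0; it is
   bounded below, so for mu finite its integral is well defined in ]-oo, +oo].
   If g is not integrable the usual formula reads +oo - +oo, which the library
   would evaluate to -oo; the entropy is then +oo. *)
Definition entropy d (T : measurableType d) (R : realType)
    (mu : {measure set T -> \bar R}) (g : T -> R) : \bar R :=
  let m : \bar R := (\int[mu]_x (g x)%:E)%E in
  if m == +oo%E then +oo%E
  else (\int[mu]_x (g x * ln (g x))%:E - (fine m * ln (fine m))%:E)%E.

(* The integral of H_q(f'/f) f^2.  The factor f^2 makes the integrand 0 where
   f = 0, the inverse being total. *)
Definition Hq_energy (R : realType)
    (mu : {measure set (measurableTypeR R) -> \bar R})
    (q : R) (f : R -> R) : \bar R :=
  (\int[mu]_x (Hq q (local_slope f x / f x) * f x ^+ 2)%:E)%E.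

(* Main.v *)
(** On both ends of the line, (i) and (ii) give [W >= c > 0] and
    [(q - 1) |W'| <= W^2 / 2], where [W] is the outward derivative of [V].

    Sufficiency.  Integrating by parts [k W^(p - 1) e^(-V)] bounds
    [\int k W^p dmu] by boundary terms and [\int |k'| W^(p - 1) dmu].  For
    [k = (f - a)^2] and [p = 1] this gives a Poincare inequality together with
    the pointwise bound [e^(-V) (f - f 0)^2 <= C * energy].  For [p = q] and [k]
    a truncation of [f^2] vanishing to high order at [f = 1], Young's inequality
    gives a bound of [\int k W^q dmu], hence of [\int k V dmu] as [V <= C W^q].
    When [\int f^2 dmu = 1], the pointwise bound yields [ln f^2 <= V + rho] with
    [rho] affine in the energy, and the entropy is at most
    [C \int ((f - 1)^2 + k (V + rho)) dmu].

    Necessity.  Let [f] be a power of a ramp increasing from 0 to 1 over an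
    interval of length [1 / W x0] that ends at [x0].  There [V] varies by at most
    2, so that [m = \int f^2 dmu] is at least a multiple of [e^(-V x0) / W x0],
    the energy is at most a multiple of [m (W x0)^q], and since the support of
    [f] has mass at most a multiple of [e^(-V x0)], the entropy is at least
    [m (V x0 - C)]. *)

From mathcomp Require Import ring lra measurable_realfun.
Require Import Defs.

Set Implicit Arguments.
Unset Strict Implicit.
Unset Printing Implicit Defensive.

Import Order.TTheory GRing.Theory Num.Theory.
Import numFieldNormedType.Exports.

Local Open Scope classical_set_scope.
Local Open Scope ring_scope.

(** * Locally Lipschitz functions and upper slopes *)

(** The function [f] enters only through upper bounds on its increments, which survive composition;
    integration by parts thereby becomes an inequality, obtained by Fatou's lemma from difference
    quotients. The final bound must be linear in the energy, with no additive constant, since the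
    entropy is small when [f] is close to a constant. This is why the potential is integrated
    against a truncation that vanishes for [f <= 1]: the integral of the truncation is at most that
    of [(f - 1)^2], hence at most a multiple of the energy, and it is also at most 1. The constant
    part of [rho] is paired with the first bound, its linear part with the second. The order of
    vanishing is dictated by Young's inequality with exponent [q]: the slope of the truncation, of
    order one less, must be dominated by the power [(q - 1) / q] of the truncation, which holds once
    the order is at least [q]. In the necessity part the length [1 / W x0] is the natural one
    because (ii) makes [1 / W] Lipschitz with constant [1 / 2] far out, so that [W] at most doubles
    within that distance of [x0]. *)

Lemma locally_lipschitzP (R : realType) (f : R -> R) :
  locally_lipschitz f <->
  forall x, exists r L, [/\ 0 < r, 0 <= L &
    forall y z, `|y - x| < r -> `|z - x| < r -> `|f y - f z| <= L * `|y - z|].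
Proof.
split=> [lf x|H x].
  have [U xU [L [_ LU]]] := lf x.
  have [r /= r0 rU] := (iffLR (nbhs_ballP _ _)) xU.
exists r, (`|L| + 1); split=> //.
  move=> y z xy xz; apply: (LU _ _ (y, z)) => /=.
    by rewrite (le_lt_trans (ler_norm L))// ltrDl.
  by split; apply: rU; rewrite /ball /= distrC.
have [r [L [r0 L0 H']]] := H x.
exists (ball x r); first exact: nbhsx_ballx.
exists L; split; first exact: ger0_real.
move=> M LM [y z] /= [xy xz].
have := H' y z; rewrite [`|y - x|]distrC [`|z - x|]distrC => /(_ xy xz) h.
by apply: (le_trans h); rewrite ler_wpM2r// ltW.
Qed.

Lemma locally_lipschitz_continuous (R : realType) (f : R -> R) :
  locally_lipschitz f -> continuous f.
Proof.
move=> /locally_lipschitzP lf x.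
have [r [L [r0 L0 H]]] := lf x.
apply/cvgrPdist_le => e e0.
near=> y.
apply: (@le_trans _ _ ((L + 1) * `|x - y|)).
  apply: (le_trans (H x y _ _)); first by rewrite subrr normr0.
    by rewrite distrC; near: y; exact: cvgr_dist_lt.
  by rewrite ler_wpM2r// lerDl.
rewrite mulrC -ler_pdivlMr ?ltr_wpDl//.
by near: y; apply: cvgr_dist_le; rewrite // divr_gt0// ltr_wpDl.
Unshelve. all: by end_near. Qed.

(** Compactness gives one [L] for which every point of the segment satisfies [P L]: a bound on [|f|]
    together with a Lipschitz bound at scale [L^-1]. Pairs farther apart than [L^-1] are handled by
    the bound on [|f|], since then [2 * L <= 2 * L * L * |x - y|]; hence the constant
    [L + 2 * L * L]. *)
Lemma locally_lipschitz_segment (R : realType) (f : R -> R) (a b : R) :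
  locally_lipschitz f -> exists2 L, 0 <= L &
    forall x y, a <= x <= b -> a <= y <= b -> `|f x - f y| <= L * `|x - y|.
Proof.
move=> lf; have cf := locally_lipschitz_continuous lf.
move/locally_lipschitzP : lf => lf.
pose P (L : R) (x : R) := `|f x| <= L /\
   forall y, `|y - x| <= L^-1 -> `|f y - f x| <= L * `|y - x|.
have /compact_near_coveringP/(_ R +oo P _) : compact `[a, b]%classic.
  exact: segment_compact.
case.
- move=> x _ /=.
  have [r [K [r0 K0 H]]] := lf x.
  exists (ball x (Num.min (r / 2) (1 / (K + 1))),
          [set L | Num.max (`|f x| + 1) (Num.max K (2 / r)) < L]) => /=.
    split; first by apply: nbhsx_ballx; rewrite lt_min !divr_gt0// ltr_wpDl.
    by apply: nbhs_pinfty_gt; rewrite num_real.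
  move=> [y L] /= []; rewrite /ball /= lt_min !gt_max => /andP[xy xy1].
  move=> /and3P[fxL KL rL].
  have L0 : 0 < L by rewrite (le_lt_trans _ KL).
  split.
    have fxy : `|f y - f x| <= 1.
      apply: (le_trans (H _ _ _ _)); rewrite ?subrr ?normr0//.
        by rewrite distrC (lt_trans xy)// ltr_pdivrMr// ltr_pMr// ltr1n.
      rewrite distrC; move: xy1; rewrite ltr_pdivlMr ?ltr_wpDl//.
      by have := normr_ge0 (x - y); nra.
    have := ler_distD 0 (f y) (f x).
    have := lerB_normD (f y - f x) (f x); rewrite subrK => _ _.
    have : `|f y| <= `|f y - f x| + `|f x|.
      by rewrite -{1}(subrK (f x) (f y)) ler_normD.
    lra.
  move=> z zy.
  have rL' : L^-1 < r / 2.
    by rewrite -[ltRHS]invrK ltf_pV2 ?posrE ?invr_gt0 ?divr_gt0// invf_div.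
  apply: (le_trans (H _ _ _ _)).
  - have : `|z - x| <= `|z - y| + `|y - x| by rewrite ler_distD.
    rewrite [`|y - x|]distrC; lra.
  - rewrite distrC; lra.
  - by rewrite ler_wpM2r// ltW.
move=> L0 [L0r PL].
pose L := Num.max L0 0 + 1.
have L0L : L0 < L by rewrite /L ltr_pwDr// le_max lexx.
have Lp : 0 < L by rewrite /L ltr_pwDr// le_max lexx orbT.
have {}PL := PL L L0L.
exists (L + 2 * L * L).
  by rewrite addr_ge0// ?mulr_ge0// ltW.
move=> x y xab yab.
have [fx _] : P L x by apply: PL; rewrite /= in_itv.
have [fy Py] : P L y by apply: PL; rewrite /= in_itv.
have [xy|xy] := leP `|x - y| L^-1.
  apply: (le_trans (Py _ xy)); rewrite ler_wpM2r// lerDl.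
  by rewrite !mulr_ge0// ltW.
have : 1 < L * `|x - y|.
  by move: xy; rewrite -div1r ltr_pdivrMr// mulrC.
have := ler_normB (f x) (f y).
move=> h1 h2; apply: (le_trans h1).
have := mulr_ge0 (ltW Lp) (normr_ge0 (x - y)).
nra.
Qed.

(** The bound [g] is kept free because compositions, maxima and reflections come with an explicit
    [g], while the exact local slope of a composition is in general only bounded by the product of
    slopes. *)
Definition upper_slope (R : realType) (f g : R -> R) :=
  forall x e, 0 < e ->
    \forall y \near x, `|f y - f x| <= (g x + e) * `|y - x|.

Section local_slope.
Context (R : realType) (f : R -> R).
Hypothesis lf : locally_lipschitz f.

Let quot (r x : R) :=
  [set `|f x - f y| / `|x - y| | y in [set y | 0 < `|x - y| <= r]].

Let quot_n0 r x : 0 < r -> quot r x !=set0.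
Proof.
move=> r0; exists (`|f x - f (x - r)| / `|x - (x - r)|) => /=.
by exists (x - r) => //=; rewrite opprB addrC subrK gtr0_norm// r0 lexx.
Qed.

Let quot_ub r x : has_ubound (quot r x).
Proof.
have [L L0 H] := locally_lipschitz_segment (x - r) (x + r) lf.
exists L => _ [y /= /andP[xy0 xyr] <-].
rewrite ler_pdivrMr//.
have [] : x - r <= y <= x + r /\ 0 <= r.
  split; last exact: (le_trans (ltW xy0)).
  by move: xyr; rewrite ler_norml => ?; apply/andP; split; lra.
by move=> yr r0; apply: H => //; apply/andP; split; lra.
Qed.

Let squot (x r : R) := sup (quot r x).

Let squot_ge0 x r : 0 < r -> 0 <= squot x r.
Proof.
move=> r0; have [z zq] := quot_n0 x r0.
apply: (le_trans _ (ub_le_sup (quot_ub r x) zq)).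
by case: zq => y _ <-.
Qed.

Let squot_nd x : {in `]0, +oo[ &, {homo squot x : r s / r <= s}}.
Proof.
move=> r s; rewrite !in_itv/= !andbT => r0 s0 rs.
apply: ge_sup; first exact: quot_n0.
move=> z [y /= /andP[y0 yr] <-]; apply: (ub_le_sup (quot_ub s x)).
by exists y => //=; rewrite y0 (le_trans yr).
Qed.

Let squot_cvg x : squot x r @[r --> 0^'+] --> local_slope f x.
Proof.
have h : squot x r @[r --> 0^'+] -->
    inf (squot x @` [set` Interval (BRight 0) +oo%O]).
  apply: (@nondecreasing_at_right_cvgr _ _ _ +oo%O) => //.
  exists 0 => z [r ri <-]; move: ri; rewrite /= in_itv/= andbT => r0.
  exact: squot_ge0.
apply: cvgP h.
Qed.

Lemma local_slope_ge0 x : 0 <= local_slope f x.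
Proof.
apply: limr_ge; first exact: (cvgP _ (@squot_cvg x)).
by near=> r; apply: squot_ge0.
Unshelve. all: by end_near. Qed.

Lemma upper_slope_local_slope : upper_slope f (local_slope f).
Proof.
move=> x e e0.
have : \forall r \near 0^'+, squot x r < local_slope f x + e.
  by apply: (cvgr_lt _ (@squot_cvg x)); rewrite ltrDl.
move=> h.
have [r [r0 hr]] : exists r, 0 < r /\ squot x r < local_slope f x + e.
  near (0:R)^'+ => r; exists r; split => //.
  by near: r.
near=> y.
have [->|yx] := eqVneq y x; first by rewrite !subrr !normr0 mulr0.
have y0 : 0 < `|x - y| by rewrite normr_gt0 subr_eq0 eq_sym.
rewrite distrC [`|y - x|]distrC -ler_pdivrMr//.
apply/ltW/(le_lt_trans _ hr)/(ub_le_sup (quot_ub r x)).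
exists y => //=; rewrite y0/=.
by near: y; apply: cvgr_dist_le.
Unshelve. all: by end_near. Qed.

Lemma local_slope_le x c :
  (\forall y \near x, `|f y - f x| <= c * `|y - x|) -> local_slope f x <= c.
Proof.
move=> /nbhs_ballP[r /= r0 H].
apply: limr_le; first exact: (cvgP _ (@squot_cvg x)).
near=> s; apply: ge_sup; first exact: quot_n0.
move=> _ [y /= /andP[y0 ys] <-].
rewrite ler_pdivrMr// distrC [`|x - y|]distrC; apply: H.
rewrite /ball/=; apply: (le_lt_trans ys).
by near: s; exact: nbhs_right_lt.
Unshelve. all: by end_near. Qed.

(** With the offset [x - y] frozen, the quotient is a continuous function [u] of its base point, and
    a supremum of such functions is lower semicontinuous. *)
Let measurable_squot r : 0 < r -> measurable_fun setT (squot ^~ r).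
Proof.
move=> r0; apply/measurable_EFinP; apply: lower_semicontinuous_measurable.
move=> x a; rewrite lte_fin => /(sup_gt (quot_n0 x r0))[_ [y /= /andP[y0 yr] <-]].
move=> ay.
pose u z := `|f z - f (z - (x - y))| / `|x - y|.
have cf := locally_lipschitz_continuous lf.
have cu : {for x, continuous u}.
  apply: cvgM; last exact: cvg_cst.
  apply: cvg_norm; apply: cvgB; first exact: cf.
  apply: continuous_comp; last exact: cf.
  by apply: cvgB; [exact: cvg_id|exact: cvg_cst].
have ux : a < u x by rewrite /u opprB addrCA subrr addr0.
exists (u @^-1` `]a, +oo[).
  have /cu : nbhs (u x) `]a, +oo[%classic.
    by apply: open_nbhs_nbhs; split; [exact: interval_open|rewrite /= in_itv/= ux].
  by [].
move=> z; rewrite /= in_itv/= andbT lte_fin => az.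
apply: (lt_le_trans az); apply: (ub_le_sup (quot_ub r z)).
by exists (z - (x - y)); rewrite /= (_ : z - (z - (x - y)) = x - y) ?y0//; ring.
Qed.

Lemma measurable_local_slope : measurable_fun setT (local_slope f).
Proof.
apply: (@measurable_fun_cvg _ _ _ _ (fun n x => squot x n.+1%:R^-1)).
  by move=> n; apply: measurable_squot; rewrite invr_gt0.
move=> x _.
have /cvg_at_rightP := @squot_cvg x.
by apply; split => [n|]; [rewrite invr_gt0|exact: cvg_harmonic].
Qed.

End local_slope.

(** * Chain rule for upper slopes *)

Section composition.
Context (R : realType) (f g h p : R -> R).
Hypothesis lf : locally_lipschitz f.
Hypothesis hp : forall s t, exists2 xi,
  `|xi - s| <= `|t - s| & `|h t - h s| <= p xi * `|t - s|.
Hypothesis cp : continuous p.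
Hypothesis p0 : forall t, 0 <= p t.

(** The hypothesis [hp] is a mean value inequality: [p xi] stands for the derivative of [h] at an
    intermediate point, of which only the distance to [s] is controlled. Squares, truncations,
    absolute values and ramps all satisfy it. *)
Lemma locally_lipschitz_comp : locally_lipschitz (h \o f).
Proof.
apply/locally_lipschitzP => x.
have [r [L [r0 L0 H]]] := (iffLR (locally_lipschitzP f)) lf x.
have : \forall z \near f x, p z <= p (f x) + 1.
  by apply: (@cvgr_le _ _ (nbhs (f x)) _ p _ (cp (x:=f x))); rewrite ltrDl.
move=> /nbhs_ballP[d /= d0 dp].
(* The factor 3 comes from [|xi - f x| <= |f y - f z| + |f z - f x|], at most [3 * L * r'], so that
   [xi] stays in the ball where [p] is controlled. *)
pose r' := Num.min r (d / (3 * (L + 1))).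
have L1 : 0 < 3 * (L + 1) by rewrite mulr_gt0// ltr_wpDl.
exists r', ((`|p (f x)| + 1) * L); split.
- by rewrite lt_min r0 divr_gt0.
- by rewrite mulr_ge0// addr_ge0.
move=> y z; rewrite !lt_min => /andP[yr yd] /andP[zr zd].
have [xi xi1 xi2] := hp (f z) (f y).
have fyz := H y z yr zr.
rewrite -mulrA; apply: (le_trans xi2); apply: ler_pM => //.
apply: (@le_trans _ _ (p (f x) + 1)); last by rewrite lerD2r ler_norm.
apply: dp; rewrite /ball/= distrC.
have fzx : `|f z - f x| <= L * `|z - x|.
  by apply: H => //; rewrite subrr normr0.
have yz : `|y - z| <= `|y - x| + `|z - x|.
  by rewrite [`|z - x|]distrC ler_distD.
have : `|xi - f x| <= `|xi - f z| + `|f z - f x| by rewrite ler_distD.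
move: yd zd; rewrite !ltr_pdivlMr//.
have := normr_ge0 (y - x); have := normr_ge0 (z - x).
by nra.
Qed.

Lemma upper_slope_comp : (forall x, 0 <= g x) -> upper_slope f g ->
  upper_slope (h \o f) (fun x => p (f x) * g x).
Proof.
move=> g0 fg x e e0.
(* Chosen so that [(p (f x) + d) * (g x + d)] exceeds [p (f x) * g x] by at most [e]. *)
pose d := Num.min 1 (e / (p (f x) + g x + 1)).
have D0 : 0 < p (f x) + g x + 1 by rewrite ltr_wpDl// addr_ge0.
have d0 : 0 < d by rewrite lt_min ltr01 divr_gt0.
have dle : (p (f x) + d) * (g x + d) <= p (f x) * g x + e.
  have d1 : d <= 1 by rewrite ge_min lexx.
  have : d * (p (f x) + g x + 1) <= e.
    by rewrite -ler_pdivlMr// ge_min lexx orbT.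
  by have := p0 (f x); have := g0 x; nra.
have cf := locally_lipschitz_continuous lf.
have : \forall z \near f x, p z <= p (f x) + d.
  by apply: (@cvgr_le _ _ (nbhs (f x)) _ p _ (cp (x:=f x))); rewrite ltrDl.
move=> /nbhs_ballP[r /= r0 rp].
near=> y.
have [xi xi1 xi2] := hp (f x) (f y).
apply: (le_trans xi2).
apply: (@le_trans _ _ ((p (f x) + d) * ((g x + d) * `|y - x|))).
  apply: ler_pM => //; last by near: y; exact: fg.
  apply: rp; rewrite /ball/= distrC (le_lt_trans xi1)// distrC.
  by near: y; apply: cvgr_dist_lt => //; exact: cf.
by rewrite mulrA ler_wpM2r.
Unshelve. all: by end_near. Qed.

End composition.

(** * Integrating a bound on the upper right derivative *)

Section fatou_bound.
Context (R : realType).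
Local Notation mu := (@lebesgue_measure R).

Lemma limn_einf_ge (u : (\bar R)^nat) (l : R) :
  (forall e, 0 < e -> \forall n \near \oo, ((l - e)%:E <= u n)%E) ->
  (l%:E <= limn_einf u)%E.
Proof.
move=> H; apply/lee_addgt0Pr => e e0.
rewrite -leeBlDr// -[limn_einf u]/(limf_einf u \oo) limf_einfE.
apply: le_ereal_sup_tmp; exists (ereal_inf (u @` [set n | ((l - e)%:E <= u n)%E])).
  by exists [set n | ((l - e)%:E <= u n)%E] => //; exact: H.
by apply: le_ereal_inf_tmp => _ [n /= h <-]; rewrite -EFinB.
Qed.

Lemma continuous_antiderivative (f : R -> R) (a b : R) : continuous f ->
  exists F : R -> R, forall x, a < x < b -> is_derive x 1 F (f x).
Proof.
move=> cf.
exists (fun x => \int[mu]_(t in [set` `[a, x]]) f t)%R => x /andP[ax xb].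
have [] := @continuous_FTC1_closed _ f a x b xb _ ax (cf x).
  apply: continuous_compact_integrable; first exact: segment_compact.
  exact: continuous_subspaceT.
by move=> d <-; rewrite derive1E; apply/derivableP.
Qed.

Lemma cvg_difference_quotient (F : R -> R) (x l : R) : is_derive x 1 F l ->
  n.+1%:R * (F (x + n.+1%:R^-1) - F x) @[n --> \oo] --> l.
Proof.
move=> [dF <-].
have /cvgr_dnbhsP/(_ (fun n => n.+1%:R^-1)) := dF.
have u0 : (forall n : nat, n.+1%:R^-1 != 0 :> R) /\
    (n.+1%:R^-1 : R) @[n --> \oo] --> 0.
  by split=> [n|]; [rewrite invr_eq0|exact: cvg_harmonic].
move=> /(_ u0); apply: cvg_trans; apply: near_eq_cvg; apply: nearW => n /=.
by rewrite invrK /GRing.scale /= mulr1 [_ + x]addrC.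
Qed.

(** An antiderivative [F] of [f] reduces the integral to difference quotients of [F] at the two
    ends, which tend to [f b] and [f a]. The margins around [[a, b]] leave room for the shift, which
    is at most 1. *)
Lemma integral_difference_quotient (f : R -> R) (a b : R) (n : nat) L F :
  a < b -> continuous f ->
  (forall x, a - 1 < x < b + 2 -> is_derive x 1 F (f x)) ->
  (\int[mu]_(x in `[a, b])
     (L - n.+1%:R * (f (x + n.+1%:R^-1) - f x))%:E =
   (L * (b - a) - (n.+1%:R * (F (b + n.+1%:R^-1) - F b)
                   - n.+1%:R * (F (a + n.+1%:R^-1) - F a)))%:E)%E.
Proof.
move=> ab cf dF; set N := n.+1%:R; set h := N^-1.
have h0 : 0 < h by rewrite invr_gt0.
have h1 : h <= 1 by rewrite invf_le1// ler1n.
pose H x := L * x - N * (F (x + h) - F x).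
have dH x : a <= x <= b -> is_derive x 1 H (L - N * (f (x + h) - f x)).
  move=> /andP[ax xb].
  have dF1 : is_derive x 1 F (f x) by apply: dF; apply/andP; split; lra.
  have dF2 : is_derive (x + h) 1 F (f (x + h)).
    by apply: dF; apply/andP; split; lra.
  have dF3 : is_derive x 1 (F \o shift h) (f (x + h)).
    by rewrite -[f _]mulr1;
      exact: (@is_derive1_comp _ F (shift h) x (f (x + h)) 1 dF2 (@is_derive_shift _ _ _ _)).
  have dH := is_deriveB (is_deriveZ L (is_derive_id x 1))
    (is_deriveZ N (is_deriveB dF3 dF1)).
  by apply: (is_derive_eq dH); rewrite /GRing.scale /= mulr1.
have cH x : a <= x <= b -> {for x, continuous H}.
  by move=> /dH [d _]; exact/differentiable_continuous/derivable1_diffP.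
rewrite (@continuous_FTC2 _ _ H)//.
- by rewrite -EFinB /H; congr EFin; ring.
- apply: continuous_subspaceT => x.
  apply: cvgB; first exact: cvg_cst.
  apply: cvgM; first exact: cvg_cst.
  apply: cvgB; last exact: cf.
  apply: continuous_comp; last exact: cf.
  by apply: cvgD; [exact: cvg_id|exact: cvg_cst].
- split.
  + move=> x; rewrite in_itv/= => /andP[ax xb].
    by have [] := dH x _; rewrite ?(ltW ax) ?(ltW xb).
  + by apply: cvg_at_right_filter; apply: cH; rewrite lexx ltW.
  + by apply: cvg_at_left_filter; apply: cH; rewrite lexx ltW.
- move=> x; rewrite in_itv/= => /andP[ax xb].
  by rewrite derive1E; have [] := dH x _; rewrite ?(ltW ax) ?(ltW xb).
Qed.

(* Fatou's lemma applied to [Q + L - (psi (x + h) - psi x) / h]. *)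
Lemma integral_upper_derivative (psi P Q : R -> R) (a b L : R) : a <= b -> 0 <= L ->
  continuous psi -> measurable_fun `[a, b] P -> measurable_fun `[a, b] Q ->
  (forall x, a <= x <= b -> 0 <= P x) -> (forall x, a <= x <= b -> 0 <= Q x) ->
  (forall x h, a <= x <= b -> 0 < h -> h <= 1 -> psi (x + h) - psi x <= L * h) ->
  (forall x e, a <= x <= b -> 0 < e ->
     \forall h \near 0^'+, psi (x + h) - psi x <= (Q x - P x + e) * h) ->
  ((psi b)%:E + \int[mu]_(x in `[a, b]) (P x)%:E <=
   (psi a)%:E + \int[mu]_(x in `[a, b]) (Q x)%:E)%E.
Proof.
move=> ab L0 cpsi mP mQ P0 Q0 HL Hd.
move: ab; rewrite le_eqVlt => /predU1P[<-|ab].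
  by rewrite set_itv1 !integral_set1.
have EP : measurable_fun `[a, b] (EFin \o P) by exact/measurable_EFinP.
have EQ : measurable_fun `[a, b] (EFin \o Q) by exact/measurable_EFinP.
have P0' x : `[a, b]%classic x -> (0 <= (EFin \o P) x)%E.
  by rewrite /= in_itv/= => xab; rewrite lee_fin P0.
have Q0' x : `[a, b]%classic x -> (0 <= (EFin \o Q) x)%E.
  by rewrite /= in_itv/= => xab; rewrite lee_fin Q0.
have [F dF] := @continuous_antiderivative psi (a - 1) (b + 2) cpsi.
pose D (n : nat) x := n.+1%:R * (psi (x + n.+1%:R^-1) - psi x).
have cD n : continuous (D n).
  move=> x; apply: cvgM; first exact: cvg_cst.
  apply: cvgB; last exact: cpsi.
  apply: continuous_comp; last exact: cpsi.
  by apply: cvgD; [exact: cvg_id|exact: cvg_cst].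
have DL n x : `[a, b]%classic x -> D n x <= L.
  rewrite /= in_itv/= => xab.
  rewrite /D mulrC -ler_pdivlMr//; apply: HL => //.
  by rewrite invf_le1// ler1n.
have [Qy|Qfin] := eqVneq (\int[mu]_(x in `[a, b]) (Q x)%:E)%E +oo%E.
  by rewrite Qy addey// leey.
have {}Qfin : (\int[mu]_(x in `[a, b]) (Q x)%:E)%E \is a fin_num.
  by rewrite ge0_fin_numE ?integral_ge0// ltey.
pose R_ n x := ((Q x)%:E + (L - D n x)%:E)%E.
have mR n : measurable_fun `[a, b] (R_ n).
  apply: emeasurable_funD => //; apply/measurable_EFinP.
  apply: measurable_funB; first exact: measurable_cst.
  by apply: measurable_funTS; exact: continuous_measurable_fun.
have mLD n : measurable_fun `[a, b] (fun x => (L - D n x)%:E).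
  apply/measurable_EFinP; apply: measurable_funB; first exact: measurable_cst.
  by apply: measurable_funTS; exact: continuous_measurable_fun.
have LD0 n x : `[a, b]%classic x -> (0 <= (L - D n x)%:E)%E.
  by move=> /(DL n) ?; rewrite lee_fin subr_ge0.
have intR n : (\int[mu]_(x in `[a, b]) R_ n x =
    (\int[mu]_(x in `[a, b]) (Q x)%:E) + (L * (b - a) -
     (n.+1%:R * (F (b + n.+1%:R^-1) - F b)
                   - n.+1%:R * (F (a + n.+1%:R^-1) - F a)))%:E)%E.
  rewrite ge0_integralD//; [|by move=> x xab; exact: LD0|exact: mLD].
  by rewrite -(integral_difference_quotient n L ab cpsi dF).
have : (\int[mu]_(x in `[a, b]) limn_einf (R_ ^~ x) <=
        limn_einf (fun n => \int[mu]_(x in `[a, b]) R_ n x))%E.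
  apply: fatou; first exact: measurable_itv.
    by move=> k; exact: mR.
  by move=> k x xab; rewrite adde_ge0 ?LD0//; exact: Q0'.
have Fa := cvg_difference_quotient (dF a _).
have Fb := cvg_difference_quotient (dF b _).
have -> : limn_einf (fun n => \int[mu]_(x in `[a, b]) R_ n x)%E =
    ((\int[mu]_(x in `[a, b]) (Q x)%:E) + (L * (b - a) - (psi b - psi a))%:E)%E.
  have -> : (fun n => \int[mu]_(x in `[a, b]) R_ n x)%E = (fun n =>
    (\int[mu]_(x in `[a, b]) (Q x)%:E) + (L * (b - a) -
     (n.+1%:R * (F (b + n.+1%:R^-1) - F b)
                   - n.+1%:R * (F (a + n.+1%:R^-1) - F a)))%:E)%E.
    by apply/funext => n; rewrite intR.
  apply: (cvg_limn_einf_sup _).1.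
  apply: cvgeD; first by rewrite fin_num_adde_defl.
    exact: cvg_cst.
  apply: cvg_EFin; first exact: nearW.
  apply: cvgB; first exact: cvg_cst.
  by apply: cvgB; [apply: Fb|apply: Fa]; apply/andP; split; lra.
move=> fat.
(* Pointwise, [Hd] makes the lower limit of [R_] at least [L + P]. The contribution of [L] then
   cancels against [L * (b - a)] on the right. *)
have : (\int[mu]_(x in `[a, b]) (L%:E + (P x)%:E) <=
   (\int[mu]_(x in `[a, b]) (Q x)%:E) + (L * (b - a) - (psi b - psi a))%:E)%E.
  apply: le_trans fat; apply: ge0_le_integral => //.
  - by move=> x xab; rewrite adde_ge0 ?lee_fin//; exact: P0'.
  - by apply: emeasurable_funD => //; exact: measurable_cst.
  - apply: (@measurableT_comp _ _ _ _ _ _ -%E) => //.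
    apply: measurable_fun_limn_esup => n.
    by apply: measurableT_comp => //; exact: mR.
  - move=> x; rewrite /= in_itv/= => xab.
    rewrite -EFinD; apply: limn_einf_ge => e e0.
    have [d /= d0 Hdx] := Hd x e xab e0.
    near=> n; rewrite /R_ -EFinD lee_fin.
    have : D n x <= Q x - P x + e.
      rewrite /D mulrC -ler_pdivlMr//.
      apply: Hdx => /=; last by rewrite invr_gt0.
      rewrite /ball_/= sub0r normrN gtr0_norm ?invr_gt0//.
      by near: n; exact: near_infty_natSinv_lt (PosNum d0).
    lra.
rewrite ge0_integralD//.
have -> : (\int[mu]_(x in `[a, b]) L%:E = (L * (b - a))%:E)%E.
  by rewrite integral_cst//= lebesgue_measure_itv/= lte_fin ab -EFinB -EFinM.
have : (0 <= \int[mu]_(x in `[a, b]) (P x)%:E)%E by apply: integral_ge0 => x /P0'.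
rewrite -(fineK Qfin).
case: (\int[mu]_(x in `[a, b]) (P x)%:E)%E => [p _| _|];
  [|by rewrite addey// -EFinD leye_eq|by rewrite leeNy_eq].
by rewrite -!EFinD !lee_fin; lra.
Unshelve. all: by end_near. Qed.

End fatou_bound.

Section real_lemmas.
Context (R : realType).

Lemma is_derive_continuous (f : R -> R) (x d : R) :
  is_derive x 1 f d -> {for x, continuous f}.
Proof. by move=> [d' _]; exact/differentiable_continuous/derivable1_diffP. Qed.

Lemma MVT_is_derive (f df : R -> R) (a b : R) : a <= b ->
  (forall x, a <= x <= b -> is_derive x 1 f (df x)) ->
  exists2 c, a <= c <= b & f b - f a = df c * (b - a).
Proof.
move=> ab dff.
have [||c] := @MVT_segment _ f df a b ab.
- move=> x; rewrite in_itv/= => /andP[ax xb].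
  by apply: dff; rewrite !ltW.
- apply: derivable_within_continuous => x; rewrite in_itv/= => xab.
  by have [] := dff x xab.
- by rewrite in_itv/= => cab E; exists c.
Qed.

Lemma near_at_right0 (x : R) (P : set R) :
  (\forall y \near x, P y) -> \forall h \near 0^'+, P (x + h).
Proof.
move=> /nbhs_ballP[d /= d0 H]; exists d => //= h.
rewrite /ball_/= sub0r normrN => hd h0.
by apply: H; rewrite /ball/= opprD addrA subrr sub0r normrN.
Qed.

Lemma is_derive_at_right_le (f : R -> R) (x d e : R) : is_derive x 1 f d ->
  0 < e -> \forall h \near 0^'+, f (x + h) - f x <= (d + e) * h.
Proof.
move=> [df <-] e0.
have : \forall h \near 0^', h^-1 *: ((f \o shift x) (h *: 1) - f x) <= 'D_1 f x + e.
  by apply: (@cvgr_le _ _ _ _ _ _ df); rewrite ltrDl.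
move=> [d' /= d'0 H]; exists d' => //= h hd h0.
have := H h hd; rewrite gt_eqF// => /(_ isT).
rewrite /GRing.scale /= mulr1 [h + x]addrC mulrC ler_pdivrMr//.
Qed.

Lemma upper_slope_at_right (k s : R -> R) (x e : R) : upper_slope k s -> 0 < e ->
  \forall h \near 0^'+, k (x + h) - k x <= (s x + e) * h.
Proof.
move=> ks e0; have := near_at_right0 (ks x e e0).
move=> H; near=> h; have h0 : 0 < h by [].
have : `|k (x + h) - k x| <= (s x + e) * `|x + h - x|.
  by near: h.
rewrite addrAC subrr add0r (gtr0_norm h0); apply: le_trans.
exact: ler_norm.
Unshelve. all: by end_near. Qed.

End real_lemmas.

(** * Integration by parts as an inequality *)

Section lyapunov.
Context (R : realType) (U dU : R -> R) (M : R).
Local Notation mu := (@lebesgue_measure R).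
Hypothesis HU : forall x, M <= x -> is_derive x 1 U (dU x).
Hypothesis dU0 : forall x, M <= x -> 0 <= dU x.

Let U_nd x y : M <= x -> x <= y -> U x <= U y.
Proof.
move=> Mx xy; have [|c /andP[xc cy] E] := @MVT_is_derive _ U dU _ _ xy.
  by move=> z /andP[xz _]; apply: HU; exact: le_trans xz.
rewrite -subr_ge0 E mulr_ge0// ?subr_ge0// dU0//; exact: le_trans xc.
Qed.

(* Integration by parts, as an inequality, of [expR (- U)] against the slope of [k]. *)
Lemma lyapunov_inequality (k s P Q : R -> R) b : M <= b ->
  locally_lipschitz k -> (forall x, 0 <= k x) -> upper_slope k s ->
  measurable_fun `[M, b] P -> measurable_fun `[M, b] Q ->
  (forall x, M <= x <= b -> 0 <= P x) -> (forall x, M <= x <= b -> 0 <= Q x) ->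
  (forall x, M <= x <= b -> expR (- U x) * (s x - dU x * k x) <= Q x - P x) ->
  ((expR (- U b) * k b)%:E + \int[mu]_(x in `[M, b]) (P x)%:E <=
   (expR (- U M) * k M)%:E + \int[mu]_(x in `[M, b]) (Q x)%:E)%E.
Proof.
move=> Mb lk k0 ks mP mQ P0 Q0 HPQ.
have [L L0 HL] := locally_lipschitz_segment M (b + 1) lk.
have ck := locally_lipschitz_continuous lk.
pose phi x := expR (- U x).
have dphi x : M <= x -> is_derive x 1 phi (phi x * (- dU x)).
  move=> Mx; have dN := is_deriveN (HU Mx).
  exact: (@is_derive1_comp _ expR (- U) x _ _ (is_derive_expR _) dN).
have phi_ni x y : M <= x -> x <= y -> phi y <= phi x.
  by move=> Mx xy; rewrite ler_expR lerN2 U_nd.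
(* Nothing is known of [U] to the left of [M]; freezing [phi] there makes [psi] continuous on the
   whole line. *)
pose psi x := phi (Num.max x M) * k x.
have psiE x : M <= x -> psi x = phi x * k x.
  by move=> Mx; rewrite /psi max_l.
have -> : expR (- U b) * k b = psi b by rewrite psiE.
have -> : expR (- U M) * k M = psi M by rewrite psiE.
(* As [phi] is nonincreasing and [k] nonnegative, only the increase of [k] contributes to an
   increase of [psi], and [phi] is at most [phi M]. *)
apply: (@integral_upper_derivative _ _ _ _ _ _ (phi M * L)) => //.
- by rewrite mulr_ge0// expR_ge0.
- move=> x; apply: cvgM; last exact: ck.
  apply: (@continuous_comp _ _ _ (fun x => Num.max x M) phi).
    by apply: continuous_max; [exact: cvg_id|exact: cvg_cst].
  by apply: (is_derive_continuous (dphi _ _)); rewrite le_max lexx orbT.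
- move=> x h /andP[Mx xb] h0 h1.
  have Mxh : M <= x + h by lra.
  rewrite !psiE//.
  have k1 : k (x + h) - k x <= L * h.
    apply: (le_trans (ler_norm _)).
    have -> : L * h = L * `|x + h - x|.
      by rewrite addrAC subrr add0r gtr0_norm.
    by apply: HL; apply/andP; split; lra.
  have p1 : phi (x + h) <= phi x by apply: phi_ni => //; lra.
  have p2 : phi x <= phi M by apply: phi_ni.
  have p3 : 0 <= phi x by exact: expR_ge0.
  have := k0 (x + h).
  have := mulr_ge0 L0 (ltW h0).
  nra.
- move=> x e /andP[Mx xb] e0.
  pose A := phi x * dU x.
  have A0 : 0 <= A by rewrite mulr_ge0 ?expR_ge0 ?dU0.
  have p0 : 0 <= phi x by exact: expR_ge0.
  (* The errors in the product rule below add up to at most [eta * D], and [eta] is taken so that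
     this is at most [e]. *)
  pose D := A + k x + 1 + phi x.
  have D0 : 0 < D by have := k0 x; rewrite /D; lra.
  pose eta := Num.min 1 (e / D).
  have eta0 : 0 < eta by rewrite lt_min ltr01 divr_gt0.
  have eta1 : eta <= 1 by rewrite ge_min lexx.
  have etaD : eta * D <= e by rewrite -ler_pdivlMr// ge_min lexx orbT.
  have HPQx : phi x * s x - A * k x <= Q x - P x.
    have -> : phi x * s x - A * k x = expR (- U x) * (s x - dU x * k x).
      by rewrite /A /phi; ring.
    by apply: HPQ; rewrite Mx.
  have near1 := is_derive_at_right_le (dphi x Mx) eta0.
  have near2 := upper_slope_at_right x ks eta0.
  have near3 : \forall h \near 0^'+, `|k (x + h) - k x| <= eta.
    apply: (@near_at_right0 _ x (fun y => `|k y - k x| <= eta)).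
    exact: (@cvgr_distC_le _ _ _ (nbhs x) _ k (k x) (ck x) _ eta0).
  near=> h.
  have h0 : 0 < h by [].
  rewrite !psiE//; last by lra.
  have n1 : phi (x + h) - phi x <= (- A + eta) * h.
    by rewrite /A -mulrN; near: h.
  have n2 : k (x + h) - k x <= (s x + eta) * h by near: h.
  have : `|k (x + h) - k x| <= eta by near: h.
  rewrite ler_norml => /andP[n3 n4].
  have kx := k0 (x + h).
  have e1 : (phi (x + h) - phi x) * k (x + h) <= (- A + eta) * h * k (x + h).
    by rewrite ler_wpM2r.
  have e2 : phi x * (k (x + h) - k x) <= phi x * ((s x + eta) * h).
    by rewrite ler_wpM2l.
  have e3 : (- A + eta) * k (x + h) <= - A * k x + A * eta + eta * (k x + 1).
    by have := k0 x; nra.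
  have e4 : (- A + eta) * k (x + h) + phi x * (s x + eta) <= Q x - P x + e.
    by move: etaD; rewrite /D; lra.
  have : ((- A + eta) * k (x + h) + phi x * (s x + eta)) * h <= (Q x - P x + e) * h.
    by rewrite ler_wpM2r// ltW.
  lra.
Unshelve. all: by end_near. Qed.

End lyapunov.

(** * A truncation of the square *)

Section powers.
Context (R : realType).

Lemma subrX_le (x y : R) n : 0 <= y -> y <= x ->
  x ^+ n.+1 - y ^+ n.+1 <= n.+1%:R * x ^+ n * (x - y).
Proof.
move=> y0 yx; have x0 := le_trans y0 yx.
elim: n => [|n IH]; first by rewrite !expr1 expr0 !mul1r.
have -> : x ^+ n.+2 - y ^+ n.+2 = (x ^+ n.+1 - y ^+ n.+1) * x + y ^+ n.+1 * (x - y).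
  by rewrite !exprS; ring.
have : (x ^+ n.+1 - y ^+ n.+1) * x <= n.+1%:R * x ^+ n * (x - y) * x.
  by rewrite ler_wpM2r.
have : y ^+ n.+1 * (x - y) <= x ^+ n.+1 * (x - y).
  by rewrite ler_wpM2r ?subr_ge0// lerXn2r.
have -> : n.+1%:R * x ^+ n * (x - y) * x = n.+1%:R * x ^+ n.+1 * (x - y).
  by rewrite exprS; ring.
rewrite -[n.+2%:R]natr1; lra.
Qed.

(** Equal to [(s - 1) / s] for [s >= 1] and to 0 below. For [s > 1] its derivative [s ^- 2] is
    cancelled by the factor [s ^+ 2] of [trunc]. *)
Definition chi (s : R) := 1 - (Num.max s 1)^-1.

(* [trunc n s] is comparable to [s ^+ 2] for [s > 2] and vanishes to order [n] at [s = 1]. *)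
Definition trunc n s := Num.max s 1 ^+ 2 * chi s ^+ n.

(** For [s > 1] and [n > 0] the derivative of [trunc n] is [2 * s * chi s ^+ n + n * chi s ^+ n.-1],
    which lies below this because [chi s <= 1 <= s]. *)
Definition trunc_slope n s := n.+2%:R * (Num.max s 1 * chi s ^+ n.-1).

Lemma max1_ge1 (s : R) : 1 <= Num.max s 1. Proof. by rewrite le_max lexx orbT. Qed.

Lemma max1_gt0 (s : R) : 0 < Num.max s 1.
Proof. exact: lt_le_trans ltr01 (max1_ge1 s). Qed.

Lemma chi_ge0 s : 0 <= chi s.
Proof. by rewrite subr_ge0 invf_le1 ?max1_ge1 ?max1_gt0. Qed.

Lemma chi_le1 s : chi s <= 1.
Proof. by rewrite lerBlDr lerDl invr_ge0 ?ltW ?max1_gt0. Qed.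

Lemma chi_le s t : s <= t -> chi s <= chi t.
Proof.
move=> st; rewrite lerD2l lerN2 lef_pV2 ?posrE ?max1_gt0//.
by rewrite ge_max !le_max st lexx orbT.
Qed.

Lemma trunc_ge0 n s : 0 <= trunc n s.
Proof. by rewrite mulr_ge0 ?sqr_ge0// exprn_ge0// chi_ge0. Qed.

Lemma trunc_slope_ge0 n s : 0 <= trunc_slope n s.
Proof.
by rewrite !mulr_ge0// ?exprn_ge0// ?chi_ge0// ?ltW ?max1_gt0.
Qed.

Lemma chi_eq0 s : s <= 1 -> chi s = 0.
Proof. by move=> s1; rewrite /chi max_r// invr1 subrr. Qed.

Lemma trunc_eq0 n s : s <= 1 -> trunc n.+1 s = 0.
Proof. by move=> s1; rewrite /trunc chi_eq0// expr0n mulr0. Qed.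

Lemma trunc_slope_eq0 n s : s <= 1 -> trunc_slope n.+2 s = 0.
Proof. by move=> s1; rewrite /trunc_slope chi_eq0// expr0n !mulr0. Qed.

Lemma trunc_le n s : 1 <= s -> trunc n.+2 s <= (s - 1) ^+ 2.
Proof.
move=> s1; have s0 : s != 0 by rewrite gt_eqF// (lt_le_trans ltr01).
have -> : (s - 1) ^+ 2 = s ^+ 2 * chi s ^+ 2.
  by rewrite -exprMn /chi max_l// mulrBr mulr1 divff.
rewrite /trunc max_l// ler_wpM2l ?sqr_ge0//.
by rewrite -addn2 exprD ler_piMl ?sqr_ge0// exprn_ile1 ?chi_ge0 ?chi_le1.
Qed.

(** From [s = 2] on, [chi s] is at least [1 / 2]. *)
Lemma trunc_lower n s : 2 <= s -> s ^+ 2 <= 2 ^+ n * trunc n s.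
Proof.
move=> s2; have s0 : 0 < s by exact: lt_le_trans s2.
have s1 : 1 <= s by apply: le_trans s2; rewrite ler1n.
rewrite /trunc max_l// mulrCA ler_peMr ?sqr_ge0// -exprMn exprn_ege1//.
rewrite /chi max_l// mulrBr mulr1 lerBrDr -lerBrDl.
by rewrite ler_pdivrMr//; lra.
Qed.

Lemma continuous_chi : continuous chi.
Proof.
move=> s; apply: cvgB; first exact: cvg_cst.
apply: cvgV; first by rewrite gt_eqF ?max1_gt0.
by apply: continuous_max; [exact: cvg_id|exact: cvg_cst].
Qed.

Lemma continuous_trunc_slope n : continuous (trunc_slope n).
Proof.
move=> s; apply: cvgM; first exact: cvg_cst.
apply: cvgM; first by apply: continuous_max; [exact: cvg_id|exact: cvg_cst].
exact: continuous_comp (@continuous_chi s) (@exprn_continuous _ _ _).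
Qed.

(** Both [trunc] and its slope bound are nondecreasing, so the larger of the two points can serve as
    [xi]. *)
Lemma trunc_two_point n (s t : R) : exists2 xi,
  `|xi - s| <= `|t - s| & `|trunc n.+1 t - trunc n.+1 s| <= trunc_slope n.+1 xi * `|t - s|.
Proof.
have main x y : x <= y ->
    0 <= trunc n.+1 y - trunc n.+1 x <= trunc_slope n.+1 y * (y - x).
  move=> xy.
  set a := Num.max x 1; set b := Num.max y 1.
  have a1 : 1 <= a by exact: max1_ge1.
  have b1 : 1 <= b by exact: max1_ge1.
  have ab : a <= b by rewrite ge_max !le_max xy lexx orbT.
  have bayx : b - a <= y - x.
    by rewrite /a /b; case: (leP y 1) => ?; case: (leP x 1) => ?; lra.
  rewrite /trunc /trunc_slope -/a -/b /=.
  have cx := chi_ge0 x; have cy := chi_ge0 y; have cxy := chi_le xy.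
  have cy1 := chi_le1 y.
  have cN : 0 <= chi y ^+ n by rewrite exprn_ge0.
  have cX : 0 <= chi x ^+ n.+1 by rewrite exprn_ge0.
  have cXY : chi x ^+ n.+1 <= chi y ^+ n.+1 by rewrite lerXn2r.
  apply/andP; split.
    by rewrite subr_ge0; apply: ler_pM => //; rewrite ?sqr_ge0// ler_sqr ?nnegrE; lra.
  (* Discrete counterpart of the derivative [s ^- 2] of [chi]: it converts the increment of [chi]
     into [b - a]. *)
  have cd : (chi y - chi x) * a * b = b - a.
    rewrite /chi -/a -/b.
    have a0 : a != 0 by rewrite gt_eqF// (lt_le_trans ltr01).
    have b0 : b != 0 by rewrite gt_eqF// (lt_le_trans ltr01).
    by field; rewrite a0 b0.
  have h1 := subrX_le n cx cxy.
  have -> : b ^+ 2 * chi y ^+ n.+1 - a ^+ 2 * chi x ^+ n.+1 =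
     (b ^+ 2 - a ^+ 2) * chi y ^+ n.+1 + a ^+ 2 * (chi y ^+ n.+1 - chi x ^+ n.+1) by ring.
  have h2 : (b ^+ 2 - a ^+ 2) * chi y ^+ n.+1 <= 2 * b * chi y ^+ n * (b - a).
    rewrite [chi y ^+ n.+1]exprS.
    have : (b ^+ 2 - a ^+ 2) * (chi y * chi y ^+ n) <= (b ^+ 2 - a ^+ 2) * chi y ^+ n.
      by rewrite ler_wpM2l ?ler_piMl// subr_ge0 ler_sqr ?nnegrE; lra.
    move=> h; apply: (le_trans h).
    have -> : (b ^+ 2 - a ^+ 2) = (b + a) * (b - a) by ring.
    have := mulr_ge0 cN (_ : 0 <= b - a); rewrite subr_ge0 => /(_ ab).
    nra.
  have h3 : a ^+ 2 * (chi y ^+ n.+1 - chi x ^+ n.+1) <= n.+1%:R * chi y ^+ n * (b - a).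
    have -> : n.+1%:R * chi y ^+ n * (b - a) =
      n.+1%:R * chi y ^+ n * (chi y - chi x) * (a * b) by rewrite -cd; ring.
    rewrite mulrC.
    apply: (@le_trans _ _ (n.+1%:R * chi y ^+ n * (chi y - chi x) * a ^+ 2)).
      by rewrite ler_wpM2r ?sqr_ge0.
    rewrite ler_wpM2l ?mulr_ge0// ?subr_ge0// expr2.
    by rewrite ler_wpM2l//; lra.
  have h4 : n.+1%:R * chi y ^+ n * (b - a) <= n.+1%:R * (b * chi y ^+ n) * (b - a).
    rewrite ler_wpM2r ?subr_ge0// ler_wpM2l// ler_peMl//.
  apply: (@le_trans _ _ (n.+3%:R * (b * chi y ^+ n) * (b - a))).
    have -> : n.+3%:R = 2 + n.+1%:R :> R by rewrite -natrD.
    lra.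
  by rewrite ler_wpM2l// !mulr_ge0// (le_trans ler01).
have [st|/ltW ts] := leP s t.
  exists t => //; have /andP[e1 e2] := main _ _ st.
  by rewrite (ger0_norm e1) ger0_norm ?subr_ge0.
exists s; first by rewrite subrr normr0.
have /andP[e1 e2] := main _ _ ts.
by rewrite distrC [`|t - s|]distrC (ger0_norm e1) ger0_norm ?subr_ge0.
Qed.

End powers.

(** * Integral inequalities on a half-line *)

Section integral_real.
Context d (T : measurableType d) (R : realType).
Variables (mu : {measure set T -> \bar R}) (D : set T) (mD : measurable D).
Implicit Types f g : T -> R.

Lemma ge0_le_integral_EFin f g : measurable_fun D f -> measurable_fun D g ->
  (forall x, D x -> 0 <= f x) -> (forall x, D x -> f x <= g x) ->
  (\int[mu]_(x in D) (f x)%:E <= \int[mu]_(x in D) (g x)%:E)%E.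
Proof.
move=> mf mg f0 fg; apply: ge0_le_integral => //; exact/measurable_EFinP.
Qed.

Lemma ge0_integralD_EFin f g : measurable_fun D f -> measurable_fun D g ->
  (forall x, D x -> 0 <= f x) -> (forall x, D x -> 0 <= g x) ->
  (\int[mu]_(x in D) (f x + g x)%:E =
   \int[mu]_(x in D) (f x)%:E + \int[mu]_(x in D) (g x)%:E)%E.
Proof.
move=> mf mg f0 g0; rewrite -ge0_integralD//; exact/measurable_EFinP.
Qed.

Lemma ge0_integralZl_real f k : measurable_fun D f ->
  (forall x, D x -> 0 <= f x) -> 0 <= k ->
  (\int[mu]_(x in D) (k * f x)%:E = k%:E * \int[mu]_(x in D) (f x)%:E)%E.
Proof.
move=> mf f0 k0; rewrite -ge0_integralZl_EFin//; exact/measurable_EFinP.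
Qed.

End integral_real.

Section halfline.
Context (R : realType).
Local Notation mu := (@lebesgue_measure R).

Lemma integral_halfline_le (f : R -> R) (M : R) (C : \bar R) :
  measurable_fun `[M, +oo[ f -> (forall x, M <= x -> 0 <= f x) ->
  (forall b, M <= b -> (\int[mu]_(x in `[M, b]) (f x)%:E <= C)%E) ->
  (\int[mu]_(x in `[M, +oo[) (f x)%:E <= C)%E.
Proof.
move=> mf f0 H; rewrite itv_bndy_bigcup_BRight.
have cv : (\int[mu]_(x in `[M, (M + i%:R)%R]) (f x)%:E)%E @[i --> \oo] -->
    (\int[mu]_(x in \bigcup_i `[M, (M + i%:R)%R]%classic) (f x)%:E)%E.
  apply: ge0_nondecreasing_set_cvg_integral.
  - move=> i j ij; apply/subsetPset => x; rewrite /= !in_itv/= => /andP[-> h].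
    by apply: (le_trans h); rewrite lerD2l ler_nat.
  - by [].
  - move=> i; apply/measurable_EFinP; apply: measurable_funS mf => // x.
    by rewrite /= !in_itv/= => /andP[->].
  - by move=> i x; rewrite /= !in_itv/= lee_fin => /andP[/f0].
rewrite -(cvg_lim _ cv)//; apply: lime_le; first exact: cvgP cv.
by apply: nearW => i; apply: H; rewrite lerDl.
Qed.

(** The inequality on [[M, b]] has two nonnegative terms on its left. Dropping the integral gives
    the pointwise bound at [b]; dropping the boundary term and letting [b] grow gives the integral
    bound. *)
Lemma lyapunov_halfline (U dU : R -> R) (M : R) (k s P Q : R -> R) :
  (forall x, M <= x -> is_derive x 1 U (dU x)) ->
  (forall x, M <= x -> 0 <= dU x) ->
  locally_lipschitz k -> (forall x, 0 <= k x) -> upper_slope k s ->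
  measurable_fun `[M, +oo[ P -> measurable_fun `[M, +oo[ Q ->
  (forall x, M <= x -> 0 <= P x) -> (forall x, M <= x -> 0 <= Q x) ->
  (forall x, M <= x -> expR (- U x) * (s x - dU x * k x) <= Q x - P x) ->
  (forall b, M <= b ->
   ((expR (- U b) * k b)%:E <=
   (expR (- U M) * k M)%:E + \int[mu]_(x in `[M, +oo[) (Q x)%:E)%E) /\
  (\int[mu]_(x in `[M, +oo[) (P x)%:E <=
   (expR (- U M) * k M)%:E + \int[mu]_(x in `[M, +oo[) (Q x)%:E)%E.
Proof.
move=> HU dU0 lk k0 ks mP mQ P0 Q0 HPQ.
have sub b : (`[M, b]%classic : set R) `<=` `[M, +oo[%classic.
  by move=> x; rewrite /= !in_itv/= => /andP[->].
have key b : M <= b ->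
  ((expR (- U b) * k b)%:E + \int[mu]_(x in `[M, b]) (P x)%:E <=
   (expR (- U M) * k M)%:E + \int[mu]_(x in `[M, +oo[) (Q x)%:E)%E.
  move=> Mb; apply: (@le_trans _ _
    ((expR (- U M) * k M)%:E + \int[mu]_(x in `[M, b]) (Q x)%:E)%E).
    apply: (lyapunov_inequality HU dU0 Mb lk k0 ks).
    - exact: measurable_funS mP.
    - exact: measurable_funS mQ.
    - by move=> x /andP[/P0].
    - by move=> x /andP[/Q0].
    - by move=> x /andP[/HPQ].
  rewrite leeD2l//; apply: ge0_subset_integral => //.
  - exact/measurable_EFinP.
  - by move=> x; rewrite /= in_itv/= andbT lee_fin => /Q0.
split=> [b Mb|].
  apply: le_trans (key b Mb); rewrite leeDl//; apply: integral_ge0 => x.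
  by rewrite /= in_itv/= lee_fin => /andP[/P0].
apply: integral_halfline_le => // b Mb.
apply: le_trans (key b Mb); rewrite leeDr// lee_fin mulr_ge0// expR_ge0//.
Qed.

End halfline.

(** * Poincare inequality beyond [M] *)

Section tail.
Context (R : realType) (V W : R -> R) (M c : R).
Local Notation mu := (@lebesgue_measure R).
Hypothesis mV : measurable_fun setT V.
Hypothesis HV : forall x, M <= x -> is_derive x 1 V (W x).
Hypothesis c0 : 0 < c.
Hypothesis cW : forall x, M <= x -> c <= W x.

Lemma measurable_expRN D : measurable_fun D (fun x => expR (- V x)).
Proof.
apply: measurable_funTS; apply: (measurableT_comp (@measurable_expR R)).
exact: measurableT_comp.
Qed.

Lemma sqr_two_point (a s t : R) : exists2 xi, `|xi - s| <= `|t - s| &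
  `|(t - a) ^+ 2 - (s - a) ^+ 2| <= 2 * `|xi - a| * `|t - s|.
Proof.
have -> : (t - a) ^+ 2 - (s - a) ^+ 2 = ((t - a) + (s - a)) * (t - s) by ring.
rewrite normrM; have := ler_normD (t - a) (s - a) => h.
have [st|/ltW ts] := leP `|s - a| `|t - a|.
  exists t => //; rewrite ler_wpM2r//; lra.
exists s; first by rewrite subrr normr0.
rewrite ler_wpM2r//; lra.
Qed.

Section slope.
Variables (F g : R -> R).
Hypothesis lF : locally_lipschitz F.
Hypothesis g0 : forall x, 0 <= g x.
Hypothesis Fg : upper_slope F g.

Lemma continuous_dist (a : R) : continuous (fun t : R => 2 * `|t - a|).
Proof.
move=> t; apply: cvgM; first exact: cvg_cst.
by apply: cvg_norm; apply: cvgB; [exact: cvg_id|exact: cvg_cst].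
Qed.

Lemma dist_ge0 (a t : R) : 0 <= 2 * `|t - a|. Proof. by rewrite mulr_ge0. Qed.

Lemma locally_lipschitz_sqr (a : R) : locally_lipschitz (fun x => (F x - a) ^+ 2).
Proof.
exact: (locally_lipschitz_comp lF (sqr_two_point a) (@continuous_dist a) (dist_ge0 a)).
Qed.

Lemma upper_slope_sqr (a : R) :
  upper_slope (fun x => (F x - a) ^+ 2) (fun x => 2 * `|F x - a| * g x).
Proof.
exact: (upper_slope_comp lF (sqr_two_point a) (@continuous_dist a) (dist_ge0 a) g0 Fg).
Qed.

Lemma locally_lipschitz_trunc n : locally_lipschitz (fun x => trunc n.+1 (F x)).
Proof.
exact: (locally_lipschitz_comp lF (trunc_two_point n)
  (@continuous_trunc_slope _ n.+1) (@trunc_slope_ge0 _ n.+1)).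
Qed.

Lemma upper_slope_trunc n :
  upper_slope (fun x => trunc n.+1 (F x)) (fun x => trunc_slope n.+1 (F x) * g x).
Proof.
exact: (upper_slope_comp lF (trunc_two_point n)
  (@continuous_trunc_slope _ n.+1) (@trunc_slope_ge0 _ n.+1) g0 Fg).
Qed.

Let mF : measurable_fun setT F.
Proof.
by apply: continuous_measurable_fun; exact: locally_lipschitz_continuous.
Qed.

Hypothesis mg : measurable_fun setT g.

Lemma measurable_sqr_dist D a : measurable_fun D (fun x => (F x - a) ^+ 2 * expR (- V x)).
Proof.
apply: measurable_funM; last exact: measurable_expRN.
apply: measurable_funX; apply: measurable_funTS; apply: measurable_funB => //.
Qed.

Lemma measurable_sqr_slope D : measurable_fun D (fun x => g x ^+ 2 * expR (- V x)).
Proof.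
apply: measurable_funM; last exact: measurable_expRN.
by apply: measurable_funX; apply: measurable_funTS.
Qed.

(** With [z = |F - a|], the slope [2 * z * g] of [z ^+ 2] is at most
    [c / 2 * z ^+ 2 + 2 / c * g ^+ 2], and the damping term is at least [c * z ^+ 2]: half of it
    absorbs the slope and half remains on the left. *)
Lemma poincare_tail (a : R) :
  let I := (\int[mu]_(x in `[M, +oo[) (g x ^+ 2 * expR (- V x))%:E)%E in
  let A := (expR (- V M) * (F M - a) ^+ 2)%:E in
  (forall b, M <= b ->
    ((expR (- V b) * (F b - a) ^+ 2)%:E <= A + (2 / c)%:E * I)%E) /\
  ((c / 2)%:E * \int[mu]_(x in `[M, +oo[) ((F x - a) ^+ 2 * expR (- V x))%:E
     <= A + (2 / c)%:E * I)%E.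
Proof.
move=> I A.
have c2 : 0 <= c / 2 by rewrite divr_ge0// ltW.
have c3 : 0 <= 2 / c by rewrite divr_ge0// ltW.
have -> : ((2 / c)%:E * I = \int[mu]_(x in `[M, +oo[)
    (2 / c * (g x ^+ 2 * expR (- V x)))%:E)%E.
  rewrite ge0_integralZl_real//; first exact: measurable_sqr_slope.
  by move=> x _; rewrite mulr_ge0 ?sqr_ge0 ?expR_ge0.
rewrite -ge0_integralZl_real//; last 2 first.
- exact: measurable_sqr_dist.
- by move=> x _; rewrite mulr_ge0 ?sqr_ge0 ?expR_ge0.
apply: (@lyapunov_halfline _ V W M (fun x => (F x - a) ^+ 2)
   (fun x => 2 * `|F x - a| * g x)) => //.
- by move=> x /cW; apply: le_trans; exact: ltW.
- exact: locally_lipschitz_sqr.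
- by move=> x; exact: sqr_ge0.
- exact: upper_slope_sqr.
- by apply: measurable_funM => //; exact: measurable_sqr_dist.
- by apply: measurable_funM => //; exact: measurable_sqr_slope.
- by move=> x _; rewrite mulr_ge0// mulr_ge0 ?sqr_ge0 ?expR_ge0.
- by move=> x _; rewrite mulr_ge0// mulr_ge0 ?sqr_ge0 ?expR_ge0.
move=> x Mx.
have := cW Mx; set w := W x => cw.
rewrite -(real_normK (num_real (F x - a))).
set z := `|F x - a|; set E := expR _.
have -> : 2 / c * (g x ^+ 2 * E) - c / 2 * (z ^+ 2 * E) =
  E * (2 / c * g x ^+ 2 - c / 2 * z ^+ 2) by ring.
apply: ler_wpM2l; first exact: expR_ge0.
have e1 : c * z ^+ 2 <= w * z ^+ 2 by rewrite ler_wpM2r ?sqr_ge0.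
have : 0 <= 2 / c * (c * z / 2 - g x) ^+ 2 by rewrite mulr_ge0 ?sqr_ge0.
have -> : 2 / c * (c * z / 2 - g x) ^+ 2 =
  c / 2 * z ^+ 2 - 2 * z * g x + 2 / c * g x ^+ 2.
  by field; rewrite gt_eqF.
lra.
Qed.

End slope.
End tail.

Ltac pos := repeat first
  [ done | exact: powR_ge0 | exact: expR_ge0 | exact: sqr_ge0
  | exact: trunc_ge0 | exact: trunc_slope_ge0 | exact: ltW
  | rewrite invr_ge0 | apply: mulr_ge0 | apply: addr_ge0 | apply: exprn_ge0 ].

(** The total inverse is discontinuous at 0. Writing it as [x] times the square of a real power of
    [|x|] reduces the claim to the measurability of powers; at 0 the factor [x] gives the right
    value. *)
Lemma measurable_invr (R : realType) : measurable_fun setT (@GRing.inv R).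
Proof.
have -> : @GRing.inv R = fun x => x * (`|x| `^ (- 1)) ^+ 2.
  apply/funext => x; rewrite powR_inv1// -normfV real_normK ?num_real//.
  have [->|x0] := eqVneq x 0; first by rewrite invr0 mul0r.
  by rewrite expr2 mulrA divff// mul1r.
apply: measurable_funM => //; apply: measurable_funX.
by apply: (measurableT_comp (@measurable_powR R _)).
Qed.

(** Young's inequality by cases. Put [B = g / F], [x = chi F], [N = n.+3] and divide by [F ^+ 2]. If
    [4 * N * B <= w * x], the left side is at most the first term on the right. Otherwise the power
    [q - 1] of [w * x] is at most that of [4 * N * B]; this bounds the left side because [x ^+ n] is
    at most the power [q - 1] of [x], as [x <= 1] and [q - 1 <= n]. For [F <= 1] the slope
    vanishes. *)
Lemma trunc_young (R : realType) (q w F g : R) (n : nat) :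
  (0 < n)%N -> 1 <= q -> q <= n.+1%:R -> 0 <= w -> 0 <= g ->
  w `^ (q - 1) * (trunc_slope n.+1 F * g) <=
  w `^ q * trunc n.+1 F / 4 +
  n.+3%:R * (4 * n.+3%:R) `^ (q - 1) * (`|g / F| `^ q * F ^+ 2).
Proof.
move=> n0 q1 qn w0 g0.
set N := n.+3%:R; have N0 : 0 <= N by [].
have N4 : 0 <= 4 * N by rewrite mulr_ge0.
have rhs0 : 0 <= N * (4 * N) `^ (q - 1) * (`|g / F| `^ q * F ^+ 2).
  by pos.
have [F1|F1] := leP F 1.
  have -> : trunc_slope n.+1 F * g = 0.
    by case: n n0 {qn N N0 N4 rhs0} => // n _; rewrite trunc_slope_eq0 ?mul0r.
  by rewrite mulr0; pos.
have F0 : 0 < F by exact: lt_trans F1.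
set B := g / F; have B0 : 0 <= B by rewrite divr_ge0// ltW.
rewrite /trunc /trunc_slope (max_l (ltW F1))/= -/N (ger0_norm B0).
have chi0 : 0 < chi F.
  by rewrite /chi (max_l (ltW F1)) subr_gt0 invf_lt1.
have chi1 := chi_le1 F.
set x := chi F in chi0 chi1 *.
have -> : g = B * F by rewrite /B divfK// gt_eqF.
set w1 := w `^ (q - 1).
have w10 : 0 <= w1 by exact: powR_ge0.
have q0 : 0 < q by exact: lt_le_trans q1.
have wq : w `^ q = w * w1 by rewrite mulr_powRB1.
have xn0 : 0 <= x ^+ n by rewrite exprn_ge0// ltW.
suff main : w1 * N * x ^+ n * B <= w * w1 * x ^+ n.+1 / 4 + N * (4 * N) `^ (q - 1) * B `^ q.
  have := ler_wpM2r (sqr_ge0 F) main; rewrite wq.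
  set y := x ^+ n; set y' := x ^+ n.+1; set p := _ `^ (q - 1); set r := B `^ q.
  move=> h; rewrite [leLHS](_ : _ = w1 * N * y * B * F ^+ 2); last by ring.
  by rewrite [leRHS](_ : _ = (w * w1 * y' / 4 + N * p * r) * F ^+ 2)//; ring.
have [h|h] := leP (4 * N * B) (w * x).
  have : w1 * x ^+ n * (N * B) <= w1 * x ^+ n * (w * x / 4).
    by apply: ler_wpM2l; [pos|lra].
  rewrite exprS.
  have : 0 <= N * (4 * N) `^ (q - 1) * B `^ q.
    by pos.
  lra.
have h1 : w1 * x ^+ n <= (4 * N * B) `^ (q - 1).
  have e1 : x ^+ n <= x `^ (q - 1).
    rewrite -powR_mulrn; last exact: ltW.
    have x01 : 0 < x <= 1 by rewrite chi0.
    by apply: (ger_powR x01); rewrite lerBlDr natr1.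
  apply: (@le_trans _ _ ((w * x) `^ (q - 1))).
    by rewrite powRM//; [rewrite ler_wpM2l|exact: ltW].
  by apply: ge0_ler_powR; rewrite ?nnegrE ?subr_ge0//; pos.
have e2 : (4 * N * B) `^ (q - 1) * (N * B) = N * (4 * N) `^ (q - 1) * B `^ q.
  by rewrite powRM// -(@mulr_powRB1 _ B q)//; ring.
have : w1 * x ^+ n * (N * B) <= (4 * N * B) `^ (q - 1) * (N * B).
  by apply: ler_wpM2r; pos.
rewrite e2.
have : 0 <= w * w1 * x ^+ n.+1 / 4.
  by pos.
lra.
Qed.

(** * Weighted integral of the truncation beyond [M] *)

Section energy_tail.
Context (R : realType) (q : R) (n : nat) (V W dW : R -> R) (M c : R).
Local Notation mu := (@lebesgue_measure R).
Hypothesis q2 : 2 <= q.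
Hypothesis qn : q <= n.+2%:R.
Hypothesis mV : measurable_fun setT V.
Hypothesis HV : forall x, M <= x -> is_derive x 1 V (W x).
Hypothesis HW : forall x, M <= x -> is_derive x 1 W (dW x).
Hypothesis c0 : 0 < c.
Hypothesis cW : forall x, M <= x -> c <= W x.
Hypothesis HdW : forall x, M <= x -> (q - 1) * `|dW x| <= W x ^+ 2 / 2.

Variables (F g : R -> R).
Hypothesis lF : locally_lipschitz F.
Hypothesis g0 : forall x, 0 <= g x.
Hypothesis Fg : upper_slope F g.
Hypothesis mg : measurable_fun setT g.

Let mF : measurable_fun setT F.
Proof.
by apply: continuous_measurable_fun; exact: locally_lipschitz_continuous.
Qed.

Lemma measurable_derivative : measurable_fun `[M, +oo[ W.
Proof.
apply: subspace_continuous_measurable_fun => //.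
apply: derivable_within_continuous => x; rewrite in_itv/= andbT => /HW[d _].
exact: d.
Qed.

Lemma measurable_Hq_energy D :
  measurable_fun D (fun x => `|g x / F x| `^ q * F x ^+ 2 * expR (- V x)).
Proof.
apply: measurable_funM; last exact: measurable_expRN.
apply: measurable_funTS; apply: measurable_funM; last exact: measurable_funX.
apply: (measurableT_comp (@measurable_powR R q)).
by apply: measurableT_comp => //; apply: measurable_funM => //;
  exact: (measurableT_comp (@measurable_invr R)).
Qed.

(** The weight is [expR (- U)] for [U = V - (q - 1) * ln W], and [HdW] keeps the derivative of [U]
    above [W / 2]. Of this half, [trunc_young] spends one quarter on absorbing the slope; the other
    quarter is the left-hand side. *)
Lemma energy_tail :
  (\int[mu]_(x in `[M, +oo[) (W x `^ q * trunc n.+2 (F x) / 4 * expR (- V x))%:E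
  <= (W M `^ (q - 1) * expR (- V M) * trunc n.+2 (F M))%:E +
   (n.+4%:R * (4 * n.+4%:R) `^ (q - 1))%:E *
   \int[mu]_(x in `[M, +oo[) (`|g x / F x| `^ q * F x ^+ 2 * expR (- V x))%:E)%E.
Proof.
set C := n.+4%:R * _.
have C0 : 0 <= C by rewrite mulr_ge0 ?powR_ge0.
have W0 x : M <= x -> 0 < W x by move=> /cW; exact: lt_le_trans.
have q1 : 1 <= q by apply: le_trans q2; rewrite ler1n.
rewrite -ge0_integralZl_real//; last 2 first.
- exact: measurable_Hq_energy.
- by move=> x _; pos.
pose U x := V x - (q - 1) * ln (W x).
pose dU x := W x - (q - 1) * ((W x)^-1 * dW x).
have UE x : M <= x -> expR (- U x) = W x `^ (q - 1) * expR (- V x).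
  move=> Mx; rewrite /U opprB expRD /powR gt_eqF//; exact: W0.
rewrite -UE//.
have dUW x : M <= x -> W x / 2 <= dU x.
  move=> Mx; have w0 := W0 x Mx; have := HdW Mx; rewrite /dU.
  set w := W x in w0 *; set d := dW x => h.
  have : (q - 1) * (w^-1 * d) <= w / 2; last by lra.
  have -> : w / 2 = w^-1 * (w ^+ 2 / 2) by field; rewrite gt_eqF.
  rewrite mulrCA; apply: ler_wpM2l; first by rewrite invr_ge0 ltW.
  apply: le_trans h; by rewrite ler_wpM2l ?ler_norm// subr_ge0.
refine (proj2 (@lyapunov_halfline _ U dU M (fun x => trunc n.+2 (F x))
  (fun x => trunc_slope n.+2 (F x) * g x)
  (fun x => W x `^ q * trunc n.+2 (F x) / 4 * expR (- V x))
  (fun x => C * (`|g x / F x| `^ q * F x ^+ 2 * expR (- V x)))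
  _ _ _ _ _ _ _ _ _ _)).
- move=> x Mx; rewrite /dU -scaleN1r.
  have dl := @is_derive1_comp _ (@ln R) W x _ _ (is_derive1_ln (W0 x Mx)) (HW Mx).
  have d2 := is_deriveB (HV Mx) (is_deriveZ (q - 1) dl).
  apply: (is_derive_eq d2).
  by rewrite /GRing.scale /= mulN1r.
- by move=> x Mx; apply: le_trans (dUW x Mx); rewrite divr_ge0// ltW// W0.
- exact: locally_lipschitz_trunc.
- by move=> x; exact: trunc_ge0.
- exact: upper_slope_trunc.
- apply: measurable_funM; last exact: measurable_expRN.
  apply: measurable_funM => //; apply: measurable_funM.
    exact: (measurableT_comp (@measurable_powR R q) measurable_derivative).
  apply: measurable_funTS; apply: continuous_measurable_fun.
  exact/locally_lipschitz_continuous/locally_lipschitz_trunc.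
- by apply: measurable_funM => //; exact: measurable_Hq_energy.
- by move=> x _; pos.
- by move=> x _; pos.
move=> x Mx; rewrite UE//.
have w0 := W0 x Mx.
have := @trunc_young _ q (W x) (F x) (g x) n.+1 isT q1 qn (ltW w0) (g0 x).
rewrite -/C; set T := trunc _ _; set S := trunc_slope _ _; set w := W x in w0 *.
set Z := `|_| `^ q * _; set E := expR _ => Y.
have E0 : 0 <= E by exact: expR_ge0.
have T0 : 0 <= T by exact: trunc_ge0.
have : w `^ (q - 1) * (S * g x - dU x * T) <= C * Z - w `^ q * T / 4.
  have : w `^ (q - 1) * (w / 2 * T) <= w `^ (q - 1) * (dU x * T).
    by rewrite ler_wpM2l ?powR_ge0// ler_wpM2r// dUW.
  have -> : w `^ (q - 1) * (w / 2 * T) = w `^ q * T / 2.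
    by rewrite -(@mulr_powRB1 _ w q) ?(ltW w0)//; [ring|exact: lt_le_trans q1].
  move: Y; lra.
move=> /(ler_wpM2r E0); lra.
Qed.

End energy_tail.

Lemma trunc_le_sqr (R : realType) n (s : R) : trunc n.+2 s <= (s - 1) ^+ 2.
Proof.
have [s1|/ltW s1] := leP s 1; first by rewrite trunc_eq0// sqr_ge0.
exact: trunc_le.
Qed.

(** * From [[M, +oo[] to [[0, +oo[] *)

Section halfline_from0.
Context (R : realType).
Local Notation mu := (@lebesgue_measure R).

Lemma subset_integral_EFin (A D : set R) (f : R -> R) : measurable A -> measurable D ->
  measurable_fun D f -> (forall x, 0 <= f x) -> A `<=` D ->
  (\int[mu]_(x in A) (f x)%:E <= \int[mu]_(x in D) (f x)%:E)%E.
Proof.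
move=> mA mD mf f0 AD; apply: ge0_subset_integral => //; first exact/measurable_EFinP.
by move=> x _; rewrite lee_fin.
Qed.

Lemma integral_halfline_split (f : R -> R) (M : R) : 0 <= M ->
  measurable_fun setT f -> (forall x, 0 <= f x) ->
  (\int[mu]_(x in `[0%R, +oo[) (f x)%:E =
   \int[mu]_(x in `[0%R, M[) (f x)%:E + \int[mu]_(x in `[M, +oo[) (f x)%:E)%E.
Proof.
move=> M0 mf f0.
have -> : (`[0%R, +oo[%classic : set R) = `[0%R, M[%classic `|` `[M, +oo[%classic.
  apply/seteqP; split=> x; rewrite /= !in_itv/= !andbT.
    by move=> ->; case: (ltP x M) => _; [left|right].
  by move=> [/andP[]//|]; exact: le_trans.
rewrite ge0_integral_setU//.
- by apply: measurable_funTS; exact/measurable_EFinP.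
- by move=> x _; rewrite lee_fin.
- apply/disj_setPS => x [] /=; rewrite !in_itv/= andbT => /andP[_].
  by rewrite ltNge => /negP.
Qed.

Lemma integral_le_cst (f : R -> R) (K M : R) : 0 <= M ->
  measurable_fun setT f -> (forall x, 0 <= x <= M -> 0 <= f x <= K) ->
  (\int[mu]_(x in `[0%R, M[) (f x)%:E <= (K * M)%:E)%E.
Proof.
move=> M0 mf fK.
have sub x : `[0%R, M[%classic x -> 0 <= f x <= K.
  by rewrite /= in_itv/= => /andP[x0 xM]; apply: fK; rewrite x0 ltW.
apply: (@le_trans _ _ (\int[mu]_(x in `[0%R, M[) K%:E)%E).
  apply: ge0_le_integral_EFin => //; first exact: measurable_funTS.
  - by move=> x /sub /andP[].
  - by move=> x /sub /andP[].
rewrite integral_cst//= lebesgue_measure_itv/= lte_fin.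
move: M0; rewrite le_eqVlt => /predU1P[<-|->]; first by rewrite ltxx mulr0 mule0.
by rewrite sube0 -EFinM.
Qed.

Variables (V W dW : R -> R) (M c B : R).
Hypothesis mV : measurable_fun setT V.
Hypothesis HV : forall x, M <= x -> is_derive x 1 V (W x).
Hypothesis c0 : 0 < c.
Hypothesis cW : forall x, M <= x -> c <= W x.
Hypothesis M0 : 0 <= M.
Hypothesis B0 : 0 <= B.
Hypothesis HB : forall x, 0 <= x <= M -> `|V x| <= B.

(** Centring at [F 0] kills the boundary term at 0 and gives the two halves of the line a common
    centre. The bound at [M] obtained on [[0, M]] controls the boundary term of [poincare_tail]. *)
Lemma halfline_poincare : exists2 C : R, 0 < C & forall F g,
  locally_lipschitz F -> (forall x, 0 <= g x) -> upper_slope F g ->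
  measurable_fun setT g -> forall i : R,
  (\int[mu]_(x in `[0%R, +oo[) (g x ^+ 2 * expR (- V x))%:E <= i%:E)%E ->
  (forall b, 0 <= b -> expR (- V b) * (F b - F 0) ^+ 2 <= C * i) /\
  (\int[mu]_(x in `[0%R, +oo[) ((F x - F 0) ^+ 2 * expR (- V x))%:E <= (C * i)%:E)%E.
Proof.
(* [C1 * i] bounds [(F b - F 0) ^+ 2] for [b] in [[0, M]], and [C2 * i] bounds the right-hand side
   of [poincare_tail]. *)
pose C1 := expR M * expR B.
pose C2 := expR B * C1 + 2 / c.
have c20 : 0 < 2 / c by rewrite divr_gt0.
have C10 : 0 < C1 by rewrite mulr_gt0 ?expR_gt0.
have C20 : 0 < C2 by rewrite addr_gt0// mulr_gt0 ?expR_gt0.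
exists (C2 + (2 / c * C2 + C1 * expR B * M)).
  by apply: ltr_wpDr => //; pos.
move=> F g lF g0 Fg mg i Hi.
have mF : measurable_fun setT F.
  by apply: continuous_measurable_fun; exact: locally_lipschitz_continuous.
have mge D := @measurable_sqr_slope _ _ mV g mg D.
have ge0 x : 0 <= g x ^+ 2 * expR (- V x) by pos.
have i0 : 0 <= i.
  by rewrite -lee_fin; apply: le_trans Hi; apply: integral_ge0 => x _; rewrite lee_fin.
have VB x : 0 <= x <= M -> expR (- V x) <= expR B /\ 1 <= expR B * expR (- V x).
  move=> /HB; rewrite ler_norml => /andP[v1 v2].
  rewrite ler_expR -expRD; split; first lra.
  by rewrite -expR0 ler_expR; lra.
(* On [[0, M]] only a bound on [V] is available, so the weight [expR (- x)], with potential [id],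
   replaces [expR (- V x)]. With [z = |F x - F 0|] one has [2 * z * g x - z ^+ 2 <= g x ^+ 2], and
   [expR (- x) <= 1 <= expR B * expR (- V x)]. *)
have center b : 0 <= b <= M -> (F b - F 0) ^+ 2 <= C1 * i.
  move=> /andP[b0 bM].
  have H : ((expR (- b) * (F b - F 0) ^+ 2)%:E + \int[mu]_(x in `[0%R, b]) (0)%:E <=
     (expR (- 0) * (F 0 - F 0) ^+ 2)%:E +
      \int[mu]_(x in `[0%R, b]) (expR B * (g x ^+ 2 * expR (- V x)))%:E)%E.
    apply: (@lyapunov_inequality _ id (fun=> 1) 0 _ _ (fun x => (F x - F 0) ^+ 2)
      (fun x => 2 * `|F x - F 0| * g x) (fun=> 0)) => //.
    - exact: locally_lipschitz_sqr.
    - by move=> x; exact: sqr_ge0.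
    - exact: upper_slope_sqr.
    - exact: measurable_funM.
    - by move=> x _; pos.
    move=> x /andP[x0 xb]; rewrite subr0 mul1r.
    have [_ e1] := VB x (introT andP (conj x0 (le_trans xb bM))).
    rewrite -(real_normK (num_real (F x - F 0))); set z := `|_|.
    apply: (@le_trans _ _ (g x ^+ 2)).
      have ex1 : expR (- x) <= 1 by rewrite -expR0 ler_expR lerNl oppr0.
      have : expR (- x) * (2 * z * g x - z ^+ 2) <= expR (- x) * g x ^+ 2.
        by rewrite ler_wpM2l ?expR_ge0//; have := sqr_ge0 (z - g x); lra.
      have : expR (- x) * g x ^+ 2 <= 1 * g x ^+ 2 by rewrite ler_wpM2r ?sqr_ge0.
      lra.
    have : 1 * g x ^+ 2 <= expR B * expR (- V x) * g x ^+ 2.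
      by rewrite ler_wpM2r ?sqr_ge0.
    lra.
  have : ((expR (- b) * (F b - F 0) ^+ 2)%:E <= (expR B * i)%:E)%E.
    move: H; rewrite integral0 adde0 subrr expr0n mulr0 add0e => H.
    apply: (le_trans H); rewrite ge0_integralZl_real//; last exact: mge.
    rewrite EFinM.
    apply: lee_wpmul2l; first by rewrite lee_fin expR_ge0.
    apply: le_trans Hi; apply: subset_integral_EFin => //.
    by move=> x; rewrite /= !in_itv/= => /andP[->].
  rewrite lee_fin expRN ler_pdivrMl ?expR_gt0// => h; apply: (le_trans h).
  rewrite /C1 -!mulrA ler_wpM2r ?mulr_ge0 ?expR_ge0//.
  by rewrite ler_expR.
have [T1 T2] := @poincare_tail _ V W M c mV HV c0 cW F g lF g0 Fg mg (F 0).
have MM : 0 <= M <= M by rewrite M0 lexx.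
have RHS : ((expR (- V M) * (F M - F 0) ^+ 2)%:E + (2 / c)%:E *
    \int[mu]_(x in `[M, +oo[) (g x ^+ 2 * expR (- V x))%:E <= (C2 * i)%:E)%E.
  have -> : C2 * i = expR B * (C1 * i) + 2 / c * i by rewrite /C2; ring.
  rewrite EFinD; apply: leeD.
    rewrite lee_fin; apply: ler_pM; rewrite ?expR_ge0 ?sqr_ge0//.
      by have [] := VB M MM.
    exact: center.
  rewrite [(2 / c * i)%:E]EFinM; apply: lee_wpmul2l; first by rewrite lee_fin ltW.
  apply: le_trans Hi; apply: subset_integral_EFin => //.
  by move=> x; rewrite /= !in_itv/= !andbT; exact: le_trans.
have D0 : 0 <= 2 / c * C2 * i by pos.
have E0 : 0 <= C1 * expR B * M * i by pos.
have C2i : 0 <= C2 * i by pos.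
split=> [b b0|].
  have -> : (C2 + (2 / c * C2 + C1 * expR B * M)) * i =
    C2 * i + 2 / c * C2 * i + C1 * expR B * M * i by ring.
  have [bM|/ltW Mb] := leP b M.
    have bM' : 0 <= b <= M by rewrite b0.
    apply: (@le_trans _ _ (expR B * (C1 * i))).
      apply: ler_pM; rewrite ?expR_ge0 ?sqr_ge0//; last exact: center.
      by have [] := VB b bM'.
    have : 0 <= 2 / c * i by pos.
    by move: D0 E0; rewrite /C2; lra.
  have := le_trans (T1 b Mb) RHS; rewrite lee_fin; lra.
rewrite (integral_halfline_split M0)//; last 2 first.
- exact: measurable_sqr_dist.
- by move=> x; pos.
have -> : (C2 + (2 / c * C2 + C1 * expR B * M)) * i =
  (C1 * i * expR B) * M + (2 / c * C2 * i + C2 * i) by ring.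
rewrite EFinD; apply: leeD.
  apply: integral_le_cst => //; first exact: measurable_sqr_dist.
  move=> x xM; apply/andP; split; first by pos.
  apply: ler_pM; rewrite ?expR_ge0 ?sqr_ge0//; first exact: center.
  by have [] := VB x xM.
apply: (@le_trans _ _ (2 / c * C2 * i)%:E); last by rewrite lee_fin lerDl.
have c2 : 0 < c / 2 by rewrite divr_gt0.
rewrite -(@lee_pmul2l _ (c / 2)%:E) ?lte_fin//.
rewrite -EFinM (_ : c / 2 * (2 / c * C2 * i) = C2 * i); last first.
  by field; rewrite gt_eqF.
exact: le_trans T2 RHS.
Qed.

Variables (q C0 : R) (n : nat).
Hypothesis q2 : 2 <= q.
Hypothesis qn : q <= n.+2%:R.
Hypothesis HW : forall x, M <= x -> is_derive x 1 W (dW x).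
Hypothesis HdW : forall x, M <= x -> (q - 1) * `|dW x| <= W x ^+ 2 / 2.
Hypothesis C00 : 0 <= C0.
Hypothesis HVW : forall x, M <= x -> V x <= C0 * W x `^ q.

(** On [[0, M[] the potential is at most [B] and the truncation at most [(F - 1) ^+ 2]. Beyond [M],
    [HVW] reduces the claim to [energy_tail], whose boundary term accounts for [(F M - 1) ^+ 2]. *)
Lemma halfline_energy : exists2 C : R, 0 < C & forall F g,
  locally_lipschitz F -> (forall x, 0 <= g x) -> upper_slope F g ->
  measurable_fun setT g -> forall a b : R,
  (\int[mu]_(x in `[0%R, +oo[) ((F x - 1) ^+ 2 * expR (- V x))%:E <= a%:E)%E ->
  (\int[mu]_(x in `[0%R, +oo[) (`|g x / F x| `^ q * F x ^+ 2 * expR (- V x))%:E <= b%:E)%E ->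
  (\int[mu]_(x in `[0%R, +oo[) (trunc n.+2 (F x) * Num.max (V x) 0 * expR (- V x))%:E
    <= (C * (a + (F M - 1) ^+ 2 + b))%:E)%E.
Proof.
pose K := W M `^ (q - 1) * expR (- V M).
pose C := n.+4%:R * (4 * n.+4%:R) `^ (q - 1).
have K0 : 0 <= K by rewrite /K; pos.
have C0' : 0 <= C by rewrite /C; pos.
have C1 : 0 <= 4 * C0 * K by pos.
have C2 : 0 <= 4 * C0 * C by pos.
exists (B + 4 * C0 * K + 4 * C0 * C + 1); first by rewrite ltr_wpDl// !addr_ge0.
move=> F g lF g0 Fg mg a b Ha Hb.
have mF : measurable_fun setT F.
  by apply: continuous_measurable_fun; exact: locally_lipschitz_continuous.
have a0 : 0 <= a.
  rewrite -lee_fin; apply: le_trans Ha; apply: integral_ge0 => x _.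
  by rewrite lee_fin; pos.
have b0 : 0 <= b.
  rewrite -lee_fin; apply: le_trans Hb; apply: integral_ge0 => x _.
  by rewrite lee_fin; pos.
have mT : measurable_fun setT (fun x => trunc n.+2 (F x)).
  apply: continuous_measurable_fun.
  exact/locally_lipschitz_continuous/locally_lipschitz_trunc.
have mE D : measurable_fun D (fun x => expR (- V x)) by exact: measurable_expRN.
have mL : measurable_fun setT
    (fun x => trunc n.+2 (F x) * Num.max (V x) 0 * expR (- V x)).
  apply: measurable_funM => //; apply: measurable_funM => //.
  exact: measurable_maxr.
have V0 x : 0 <= Num.max (V x) 0 by rewrite le_max lexx orbT.
have L0 x : 0 <= trunc n.+2 (F x) * Num.max (V x) 0 * expR (- V x).
  by have Vx := V0 x; pos.
rewrite (integral_halfline_split M0)//.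
set y := (F M - 1) ^+ 2; have y0 : 0 <= y by exact: sqr_ge0.
apply: (@le_trans _ _ ((B * a)%:E + (4 * C0 * (K * y + C * b))%:E)%E); last first.
  rewrite -EFinD lee_fin.
  have e1 : 0 <= B * (y + b) by pos.
  have e2 : 0 <= (4 * C0 * K) * (a + b) by pos.
  have e3 : 0 <= (4 * C0 * C) * (a + y) by pos.
  lra.
apply: leeD.
  apply: (@le_trans _ _ (B%:E * \int[mu]_(x in `[0%R, M[) ((F x - 1) ^+ 2 * expR (- V x))%:E)%E).
    rewrite -ge0_integralZl_real//; last 2 first.
    - exact: measurable_sqr_dist.
    - by move=> x _; pos.
    apply: ge0_le_integral_EFin => //; first exact: measurable_funTS.
    - by apply: measurable_funM => //; exact: measurable_sqr_dist.
    - move=> x; rewrite /= in_itv/= => /andP[x0 xM].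
      rewrite mulrA ler_wpM2r ?expR_ge0// mulrC ler_pM ?trunc_ge0 ?trunc_le_sqr//.
      rewrite ge_max B0 andbT (le_trans (ler_norm _))// HB//.
      by rewrite x0 ltW.
  rewrite EFinM; apply: lee_wpmul2l; first by rewrite lee_fin.
  apply: le_trans Ha; apply: subset_integral_EFin => //.
  - exact: measurable_sqr_dist.
  - by move=> x; pos.
  - by move=> x; rewrite /= !in_itv/= => /andP[->].
have T := @energy_tail _ q n V W dW M c q2 qn mV HV HW c0 cW HdW F g lF g0 Fg mg.
apply: (@le_trans _ _ ((4 * C0)%:E *
   \int[mu]_(x in `[M, +oo[) (W x `^ q * trunc n.+2 (F x) / 4 * expR (- V x))%:E)%E).
  have mP : measurable_fun `[M, +oo[
      (fun x => W x `^ q * trunc n.+2 (F x) / 4 * expR (- V x)).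
    apply: measurable_funM => //; apply: measurable_funM => //.
    apply: measurable_funM; last exact: measurable_funTS.
    exact: (measurableT_comp (@measurable_powR R q) (@measurable_derivative _ W dW M HW)).
  rewrite -ge0_integralZl_real//; last 2 first.
  - by move=> x _; pos.
  - by pos.
  apply: ge0_le_integral_EFin => //; first exact: measurable_funTS.
  - exact: measurable_funM.
  - move=> x; rewrite /= in_itv/= andbT => Mx.
    have -> : 4 * C0 * (W x `^ q * trunc n.+2 (F x) / 4 * expR (- V x)) =
      trunc n.+2 (F x) * (C0 * W x `^ q) * expR (- V x) by field.
    apply: ler_wpM2r; first exact: expR_ge0.
    apply: ler_wpM2l; first exact: trunc_ge0.
    by rewrite ge_max HVW//=; pos.
rewrite [(4 * C0 * (_ + _))%:E]EFinM; apply: lee_wpmul2l; first by rewrite lee_fin; pos.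
apply: (le_trans T); rewrite EFinD; apply: leeD.
  by rewrite lee_fin; apply: ler_wpM2l => //; exact: trunc_le_sqr.
rewrite [(C * b)%:E]EFinM; apply: lee_wpmul2l; first by rewrite lee_fin.
apply: le_trans Hb; apply: subset_integral_EFin => //.
- exact: measurable_Hq_energy.
- by move=> x; pos.
- by move=> x; rewrite /= !in_itv/= !andbT; exact: le_trans.
Qed.

End halfline_from0.

(** * From the half-lines to the measure *)

Section density.
Context d (T : measurableType d) (R : realType).
Variables (mu nu : {measure set T -> \bar R}) (w : T -> R).
Hypothesis w0 : forall x, 0 <= w x.
Hypothesis mw : measurable_fun setT w.
Hypothesis nuE : forall A, measurable A ->
  nu A = (\int[mu]_(x in A) (w x)%:E)%E.
Local Open Scope ereal_scope.

Let mEw : measurable_fun setT (EFin \o w).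
Proof. exact/measurable_EFinP. Qed.

Let w0' x : 0 <= (w x)%:E. Proof. by rewrite lee_fin. Qed.

Let density_indic E : measurable E ->
  \int[nu]_x (\1_E x)%:E = \int[mu]_x ((\1_E x)%:E * (w x)%:E).
Proof.
move=> mE; rewrite integral_indic// setIT nuE// integral_mkcond.
apply: eq_integral => x _; rewrite patchE indicE.
by case: ifPn => xE; rewrite ?mul1e ?mul0e.
Qed.

Import HBNNSimple.

Let density_nnsfun (f : {nnsfun T >-> R}) :
  \int[nu]_x (f x)%:E = \int[mu]_x ((f x)%:E * (w x)%:E).
Proof.
under [LHS]eq_integral do rewrite fimfunE -fsumEFin//.
rewrite [LHS]ge0_integral_fsum//; last 2 first.
  - by move=> r; exact/measurable_EFinP/measurableT_comp.
  - by move=> n x _; rewrite EFinM nnfun_muleindic_ge0.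
under [RHS]eq_integral.
  move=> x xD; rewrite fimfunE -fsumEFin// ge0_mule_fsuml; last first.
    by move=> r; rewrite EFinM nnfun_muleindic_ge0.
  over.
rewrite [RHS]ge0_integral_fsum//; last 2 first.
  - move=> r; apply: emeasurable_funM => //.
    exact/measurable_EFinP/measurableT_comp.
  - by move=> n x _; rewrite mule_ge0// EFinM nnfun_muleindic_ge0.
apply: eq_fsbigr => r _; rewrite integralZl_indic_nnsfun//= density_indic//.
have [r0|r0] := leP 0%R r.
  rewrite -ge0_integralZl//.
  - by apply: eq_integral => x _; rewrite EFinM muleA.
  - by apply: emeasurable_funM => //; exact/measurable_EFinP/measurable_indic.
  - by move=> x _; rewrite mule_ge0// lee_fin.
rewrite preimage_nnfun0// indic0.
under eq_integral do rewrite mul0e.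
under [RHS]eq_integral do rewrite mulr0 mul0e.
by rewrite !integral0 mule0.
Qed.

(** Indicators, then simple functions, then monotone limits, starting from the values of [nu] on
    measurable sets. *)
Lemma ge0_integral_density (f : T -> \bar R) :
  measurable_fun setT f -> (forall x, 0 <= f x) ->
  \int[nu]_x f x = \int[mu]_x (f x * (w x)%:E).
Proof.
move=> mf f0.
pose f_ := nnsfun_approx measurableT mf.
transitivity (lim (\int[nu]_x (f_ n x)%:E @[n --> \oo])).
  rewrite -monotone_convergence//=.
  - apply: eq_integral => ? /[!inE] xD; apply/esym/cvg_lim => //=.
    exact: cvg_nnsfun_approx.
  - by move=> n; exact/measurable_EFinP/measurable_funTS.
  - by move=> n ? _; rewrite lee_fin.
  - by move=> ? _ ? ? mn; rewrite lee_fin; exact/lefP/nd_nnsfun_approx.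
under eq_fun do rewrite density_nnsfun.
rewrite -monotone_convergence//=.
- apply: eq_integral => x _; apply/cvg_lim => //.
  by apply: cvgeZr => //; exact: cvg_nnsfun_approx.
- by move=> n; apply: emeasurable_funM => //; exact/measurable_EFinP/measurable_funTS.
- by move=> n x _; rewrite mule_ge0// lee_fin.
- move=> x _ m n mn; apply: lee_wpmul2r => //.
  by rewrite lee_fin; exact/lefP/nd_nnsfun_approx.
Qed.

End density.

(** * Reflection of the left end onto the right one *)

Section reflection.
Context (R : realType).
Local Notation mu := (@lebesgue_measure R).

Lemma integral_reflect (f : R -> R) : measurable_fun setT f -> (forall x, 0 <= f x) ->
  (\int[mu]_x (f x)%:E = \int[mu]_(x in `[0%R, +oo[) (f x)%:E +
    \int[mu]_(x in `[0%R, +oo[) (f (- x))%:E)%E.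
Proof.
move=> mf f0.
have mEf D : measurable_fun D (EFin \o f) by apply/measurable_EFinP/measurable_funTS.
have mEfN : measurable_fun setT (EFin \o (f \o -%R)).
  by apply/measurable_EFinP; apply: measurableT_comp.
have -> : (setT : set R) = `]-oo, 0%R[%classic `|` `[0%R, +oo[%classic.
  apply/esym/seteqP; split=> // x _; rewrite /= !in_itv/= andbT.
  by case: (ltP x 0) => _; [left|right].
rewrite ge0_integral_setU//; last 2 first.
- by move=> x _; rewrite lee_fin.
- apply/disj_setPS => x [] /=; rewrite !in_itv/= andbT.
  by rewrite ltNge => /negP.
rewrite addeC; congr (_ + _)%E.
rewrite (@ge0_integration_by_substitution0 _ (fun x => (f (- x))%:E))//.
rewrite -integral_itv_bndo_bndc//.
- by apply: eq_integral => x _; rewrite opprK.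
- rewrite (_ : (fun _ => _) = EFin \o f)//; apply/funext => x /=.
  by rewrite opprK.
- by move=> r; rewrite lee_fin.
- exact: mEf.
Qed.

Lemma locally_lipschitz_opp (f : R -> R) :
  locally_lipschitz f -> locally_lipschitz (fun x => f (- x)).
Proof.
move=> /locally_lipschitzP lf; apply/locally_lipschitzP => x.
have [r [L [r0 L0 H]]] := lf (- x); exists r, L; split=> // y z yr zr.
have NE (u v : R) : `|- u - - v| = `|u - v| by rewrite -opprD normrN.
by rewrite -(NE y z); apply: H; rewrite NE.
Qed.

Lemma upper_slope_opp (f g : R -> R) :
  upper_slope f g -> upper_slope (fun x => f (- x)) (fun x => g (- x)).
Proof.
move=> fg x e e0; have := fg (- x) e e0.
rewrite nearN; apply: filterS => y.
by rewrite (_ : - y - - x = - (y - x)) ?normrN//; ring.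
Qed.

End reflection.

(** The derivatives are parameters so that the left end is covered by [V (- x)], [- V' (- x)] and
    [V'' (- x)]. The last clause serves twice: it keeps the derivative of [V - (q - 1) * ln W] above
    [W / 2], and, as [q >= 2], it bounds the derivative of [1 / W] by [1 / 2]. *)
Definition regular_tail (R : realType) (q : R) (V W dW : R -> R) (M c : R) :=
  forall x, M <= x -> [/\ is_derive x 1 V (W x), is_derive x 1 W (dW x),
    c <= W x & (q - 1) * `|dW x| <= W x ^+ 2 / 2].

Section extraction.
Context (R : realType) (q : R) (V : R -> R).
Hypothesis q2 : 2 <= q.
Local Notation W := (derive1 V).
Local Notation dW := (derive1n 2 V).

Lemma is_derive_opp (f : R -> R) (x d : R) :
  is_derive (- x) 1 f d -> is_derive x 1 (fun y => f (- y)) (- d).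
Proof.
move=> df.
have dN : is_derive x 1 (-%R : R -> R) (- 1) by exact: is_deriveNid.
have := @is_derive1_comp _ f -%R x _ _ df dN.
by rewrite mulrN1.
Qed.

(** The threshold [M] is left free above [M0], so that it can later be pushed past the point where
    the growth condition takes effect. *)
Lemma regular_tails :
  (\forall x \near absinfty_nbhs R,
    [/\ derivable V x 1, derivable W x 1 & {for x, continuous dW}]) ->
  (0 < limf_einf (fun x : R => (Num.sg x * W x)%:E) (absinfty_nbhs R))%E ->
  dW x / W x ^+ 2 @[x --> absinfty_nbhs R] --> (0 : R) ->
  exists c M0 : R, [/\ 0 < c, 0 <= M0 & forall M, M0 <= M ->
    regular_tail q V W dW M c /\
    regular_tail q (fun x => V (- x)) (fun x => - W (- x)) (fun x => dW (- x)) M c].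
Proof.
move=> [M1 H1] H2 H3.
have q10 : 0 < q - 1 by rewrite subr_gt0; apply: lt_le_trans q2; rewrite ltr1n.
have [c [M2 [c0 H2']]] : exists c M2 : R, 0 < c /\ forall x, M2 < `|x| -> c <= Num.sg x * W x.
  move: H2; rewrite limf_einfE => /ereal_sup_gt[_ [U [M2 UM] <-]] Ugt.
  move: Ugt; set m := ereal_inf _ => m0.
  have lem (x : R) : M2 < `|x| -> (m <= (Num.sg x * W x)%:E)%E.
    by move=> xM; apply: ereal_inf_lbound; exists x => //; exact: UM.
  (* The value at one point of the region shows that the infimum is not [+oo], so it can be taken as
     the real constant [c]. *)
  have : (m <= (Num.sg (`|M2| + 1) * W (`|M2| + 1))%:E)%E.
    apply: lem; rewrite ger0_norm ?addr_ge0//.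
    by rewrite (le_lt_trans (ler_norm _))// ltrDl.
  case: m m0 lem => [m m0 lem _|_ _|]; last by rewrite ltNge leNye.
    exists m, M2; split; first by rewrite -lte_fin.
    by move=> x xM; have := lem x xM; rewrite lee_fin.
  by rewrite leye_eq.
have [M3 H3'] : \forall x \near absinfty_nbhs R, `|dW x / W x ^+ 2| <= (2 * (q - 1))^-1.
  have e0 : 0 < (2 * (q - 1))^-1 by rewrite invr_gt0 mulr_gt0.
  have := @cvgr0_norm_le _ _ _ _ _ _ H3 _ e0.
  exact.
pose M0 := Num.max 0 (Num.max M1 (Num.max M2 M3)) + 1.
have main (x : R) : M0 <= `|x| -> [/\ is_derive x 1 V (W x), is_derive x 1 W (dW x),
    c <= Num.sg x * W x & (q - 1) * `|dW x| <= W x ^+ 2 / 2].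
  move=> Mx.
  have : Num.max 0 (Num.max M1 (Num.max M2 M3)) < `|x|.
    by apply: lt_le_trans Mx; rewrite ltrDl.
  rewrite !gt_max => /and4P[x0 x1 x2 x3].
  have [d1 d2 _] := H1 x x1.
  have cW := H2' x x2.
  have W0 : W x != 0.
    by apply: contraTneq cW => ->; rewrite mulr0 -ltNge.
  split.
  - by rewrite derive1E; exact/derivableP.
  - by rewrite -[dW x]/(derive1 W x) [derive1 W x]derive1E; exact/derivableP.
  - exact: cW.
  have := H3' x x3; rewrite normrM normfV normrX real_normK ?num_real//.
  have W2 : 0 < W x ^+ 2 by rewrite exprn_even_gt0.
  rewrite ler_pdivrMr// => h.
  have -> : W x ^+ 2 / 2 = (q - 1) * ((2 * (q - 1))^-1 * W x ^+ 2).
    by field; rewrite gt_eqF.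
  by apply: ler_wpM2l h; exact: ltW.
exists c, M0; split; [exact: c0|by rewrite addr_ge0// le_max lexx|].
move=> M MM0; split=> x Mx.
  have M0x : M0 <= x by exact: le_trans Mx.
  have x0 : 0 < x by apply: lt_le_trans M0x; rewrite ltr_wpDl// le_max lexx.
  have [] := main x; first by rewrite gtr0_norm.
  by rewrite gtr0_sg// mul1r.
have M0x : M0 <= x by exact: le_trans Mx.
have x0 : 0 < x by apply: lt_le_trans M0x; rewrite ltr_wpDl// le_max lexx.
have [] := main (- x); first by rewrite normrN gtr0_norm.
rewrite sgrN gtr0_sg// mulN1r sqrrN => d1 d2 cw hw.
split; [exact: is_derive_opp| |exact: cw|exact: hw].
rewrite -[dW (- x)]opprK; exact: (is_deriveN (is_derive_opp d2)).
Qed.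

Lemma bounded_near_segment (f : R -> R) (M : R) :
  (forall x : R, bounded_near f (nbhs x)) ->
  exists2 B, 0 <= B & forall x, `|x| <= M -> `|f x| <= B.
Proof.
move=> Hf.
have /compact_near_coveringP/(_ R +oo (fun B x => `|f x| <= B) _) :
  compact `[- M, M]%classic by exact: segment_compact.
case.
  move=> x _ /=.
  have [B [_ HB]] := Hf x.
  have HB1 := HB (B + 1) _.
  exists ([set y | `|f y| <= B + 1], [set L | B + 1 < L]) => /=.
    split; first by apply: HB1; rewrite ltrDl.
    by apply: nbhs_pinfty_gt; rewrite num_real.
  by move=> [y L] /= [h1 h2]; apply: (le_trans h1); exact: ltW.
move=> L [_ HL]; exists (`|L| + 1); first by rewrite addr_ge0.
move=> x xM; apply: (HL (`|L| + 1)).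
  by rewrite (le_lt_trans (ler_norm _))// ltrDl.
by rewrite /= in_itv/= -ler_norml.
Qed.

End extraction.

(** * Gluing the two half-lines *)

Section global.
Context (R : realType) (V : R -> R) (mu : probability (measurableTypeR R) R).
Local Notation leb := (@lebesgue_measure R).
Hypothesis mV : measurable_fun setT V.
Hypothesis muE : forall A : set (measurableTypeR R), measurable A ->
  mu A = (\int[lebesgue_measure]_(x in A) (expR (- V x))%:E)%E.

Lemma integral_density_reflect (G : R -> R) : measurable_fun setT G ->
  (forall x, 0 <= G x) ->
  (\int[mu]_x (G x)%:E = \int[leb]_(x in `[0%R, +oo[) (G x * expR (- V x))%:E +
    \int[leb]_(x in `[0%R, +oo[) (G (- x) * expR (- V (- x)))%:E)%E.
Proof.
move=> mG G0.
have mE : measurable_fun setT (fun x => expR (- V x)) by exact: measurable_expRN.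
rewrite (@ge0_integral_density _ _ _ leb mu (fun x => expR (- V x)))//; last exact/measurable_EFinP.
rewrite -(@integral_reflect _ (fun x => G x * expR (- V x))).
- by under eq_integral do rewrite -EFinM.
- exact: measurable_funM.
- by move=> x; pos.
Qed.

Variables (q : R) (W dW Wl dWl : R -> R) (M c B : R).
Hypothesis c0 : 0 < c.
Hypothesis M0 : 0 <= M.
Hypothesis B0 : 0 <= B.
Hypothesis HB : forall x, `|x| <= M -> `|V x| <= B.
Hypothesis tailr : regular_tail q V W dW M c.
Hypothesis taill : regular_tail q (fun x : R => V (- x)) Wl dWl M c.

Let mVl : measurable_fun setT (fun x : R => V (- x)).
Proof. exact: measurableT_comp. Qed.

Let HBr x : 0 <= x <= M -> `|V x| <= B.
Proof. by move=> /andP[x0 xM]; apply: HB; rewrite ger0_norm. Qed.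

Let HBl x : 0 <= x <= M -> `|V (- x)| <= B.
Proof. by move=> /andP[x0 xM]; apply: HB; rewrite normrN ger0_norm. Qed.

(** Beyond [M] the potential increases outward on both sides, so its lower bound is inherited from
    [[- M, M]]. *)
Lemma potential_ge x : - B <= V x.
Proof.
have MM : 0 <= M <= M by rewrite M0 lexx.
have key (U dU : R -> R) y : (forall z, M <= z -> is_derive z 1 U (dU z) /\ c <= dU z) ->
    `|U M| <= B -> M <= y -> - B <= U y.
  move=> HU UM My.
  have [|z /andP[Mz _] E] := @MVT_is_derive _ U dU _ _ My.
    by move=> z /andP[/HU[]].
  have [_ cd] := HU z Mz.
  have : 0 <= dU z * (y - M).
    by rewrite mulr_ge0 ?subr_ge0// (le_trans (ltW c0)).
  by rewrite -E; move: UM; rewrite ler_norml => /andP[]; lra.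
have [xM|Mx] := leP `|x| M.
  by have := HB xM; rewrite ler_norml => /andP[].
have [x0|x0] := leP 0 x.
  apply: (key V W) => //; first by move=> z /tailr[].
    exact: HBr.
  by move: Mx; rewrite ger0_norm// => /ltW.
have -> : V x = V (- - x) by rewrite opprK.
apply: (key (fun x : R => V (- x)) Wl (- x)) => //; first by move=> z /taill[].
  exact: HBl.
by move: Mx; rewrite ltr0_norm// => /ltW.
Qed.

Lemma poincare : exists2 C : R, 0 < C & forall F g,
  locally_lipschitz F -> (forall x, 0 <= g x) -> upper_slope F g ->
  measurable_fun setT g -> forall i : R,
  (\int[mu]_x (g x ^+ 2)%:E <= i%:E)%E ->
  (forall b, expR (- V b) * (F b - F 0) ^+ 2 <= C * i) /\
  (\int[mu]_x ((F x - F 0) ^+ 2)%:E <= (C * i)%:E)%E.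
Proof.
have [Cr Cr0 Hr] := @halfline_poincare _ V W M c B mV
  (fun x Mx => let: And4 h _ _ _ := tailr Mx in h) c0
  (fun x Mx => let: And4 _ _ h _ := tailr Mx in h) M0 HBr.
have [Cl Cl0 Hl] := @halfline_poincare _ (fun x : R => V (- x)) Wl M c B mVl
  (fun x Mx => let: And4 h _ _ _ := taill Mx in h) c0
  (fun x Mx => let: And4 _ _ h _ := taill Mx in h) M0 HBl.
exists (Cr + Cl); first exact: addr_gt0.
move=> F g lF g0 Fg mg i Hi.
have mF : measurable_fun setT F.
  by apply: continuous_measurable_fun; exact: locally_lipschitz_continuous.
have mg2 : measurable_fun setT (fun x => g x ^+ 2) by exact: measurable_funX.
have [Ir Il] : (\int[leb]_(x in `[0%R, +oo[) (g x ^+ 2 * expR (- V x))%:E <= i%:E)%E /\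
   (\int[leb]_(x in `[0%R, +oo[) (g (- x) ^+ 2 * expR (- V (- x)))%:E <= i%:E)%E.
  move: Hi; rewrite integral_density_reflect//; last by move=> x; pos.
  move=> H; split; apply: le_trans H.
    by rewrite leeDl//; apply: integral_ge0 => x _; rewrite lee_fin; pos.
  by rewrite leeDr//; apply: integral_ge0 => x _; rewrite lee_fin; pos.
have [Hr1 Hr2] := Hr F g lF g0 Fg mg i Ir.
have [] := Hl (fun x : R => F (- x)) (fun x : R => g (- x)) (locally_lipschitz_opp lF)
  (fun x => g0 (- x)) (upper_slope_opp Fg) _ i Il.
  exact: measurableT_comp.
rewrite oppr0 => Hl1 Hl2.
have i0 : 0 <= i.
  by rewrite -lee_fin; apply: le_trans Hi; apply: integral_ge0 => x _; rewrite lee_fin; pos.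
have Cri : 0 <= Cr * i by pos.
have Cli : 0 <= Cl * i by pos.
split=> [b|].
  rewrite mulrDl; have [b0|/ltW b0] := leP 0 b.
    by have := Hr1 b b0; lra.
  by have := Hl1 (- b); rewrite opprK oppr_ge0 => /(_ b0); lra.
rewrite integral_density_reflect; last 2 first.
- by apply: measurable_funX; exact: measurable_funB.
- by move=> x; pos.
by rewrite mulrDl EFinD; exact: leeD.
Qed.

Variables (n : nat) (C0 : R).
Hypothesis q2 : 2 <= q.
Hypothesis qn : q <= n.+2%:R.
Hypothesis C00 : 0 <= C0.
Hypothesis HVWr : forall x, M <= x -> V x <= C0 * W x `^ q.
Hypothesis HVWl : forall x, M <= x -> V (- x) <= C0 * Wl x `^ q.

Lemma potential_energy : exists2 C : R, 0 < C & forall F g,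
  locally_lipschitz F -> (forall x, 0 <= g x) -> upper_slope F g ->
  measurable_fun setT g -> forall a b : R,
  (\int[mu]_x ((F x - 1) ^+ 2)%:E <= a%:E)%E ->
  (\int[mu]_x (`|g x / F x| `^ q * F x ^+ 2)%:E <= b%:E)%E ->
  (\int[mu]_x (trunc n.+2 (F x) * Num.max (V x) 0)%:E
    <= (C * (a + (F M - 1) ^+ 2 + (F (- M) - 1) ^+ 2 + b))%:E)%E.
Proof.
have [Cr Cr0 Hr] := @halfline_energy _ V W dW M c B mV
  (fun x Mx => let: And4 h _ _ _ := tailr Mx in h) c0
  (fun x Mx => let: And4 _ _ h _ := tailr Mx in h) M0 B0 HBr q C0 n q2 qn
  (fun x Mx => let: And4 _ h _ _ := tailr Mx in h)
  (fun x Mx => let: And4 _ _ _ h := tailr Mx in h) C00 HVWr.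
have [Cl Cl0 Hl] := @halfline_energy _ (fun x : R => V (- x)) Wl dWl M c B mVl
  (fun x Mx => let: And4 h _ _ _ := taill Mx in h) c0
  (fun x Mx => let: And4 _ _ h _ := taill Mx in h) M0 B0 HBl q C0 n q2 qn
  (fun x Mx => let: And4 _ h _ _ := taill Mx in h)
  (fun x Mx => let: And4 _ _ _ h := taill Mx in h) C00 HVWl.
exists (Cr + Cl); first exact: addr_gt0.
move=> F g lF g0 Fg mg a b Ha Hb.
have mF : measurable_fun setT F.
  by apply: continuous_measurable_fun; exact: locally_lipschitz_continuous.
have mF1 : measurable_fun setT (fun x => (F x - 1) ^+ 2).
  by apply: measurable_funX; exact: measurable_funB.
have mFq : measurable_fun setT (fun x => `|g x / F x| `^ q * F x ^+ 2).
  apply: measurable_funM; last exact: measurable_funX.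
  apply: (measurableT_comp (@measurable_powR R q)).
  by apply: measurableT_comp => //; apply: measurable_funM => //;
    exact: (measurableT_comp (@measurable_invr R)).
have mT : measurable_fun setT (fun x => trunc n.+2 (F x)).
  apply: continuous_measurable_fun.
  exact/locally_lipschitz_continuous/locally_lipschitz_trunc.
have split_le (G : R -> R) z : measurable_fun setT G -> (forall x, 0 <= G x) ->
   (\int[mu]_x (G x)%:E <= z%:E)%E ->
   (\int[leb]_(x in `[0%R, +oo[) (G x * expR (- V x))%:E <= z%:E)%E /\
   (\int[leb]_(x in `[0%R, +oo[) (G (- x) * expR (- V (- x)))%:E <= z%:E)%E.
  move=> mG G0; rewrite integral_density_reflect// => H; split; apply: le_trans H.
    by rewrite leeDl//; apply: integral_ge0 => x _; rewrite lee_fin; pos.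
  by rewrite leeDr//; apply: integral_ge0 => x _; rewrite lee_fin; pos.
have [Ar Al] := split_le _ _ mF1 (fun x => sqr_ge0 _) Ha.
have [Br Bl] := split_le _ _ mFq (fun x => mulr_ge0 (powR_ge0 _ _) (sqr_ge0 _)) Hb.
have Hr1 := Hr F g lF g0 Fg mg a b Ar Br.
have Hl1 := Hl (fun x : R => F (- x)) (fun x : R => g (- x)) (locally_lipschitz_opp lF)
  (fun x => g0 (- x)) (upper_slope_opp Fg) (measurableT_comp mg (@oppr_measurable R setT))
  a b Al Bl.
have a0 : 0 <= a.
  rewrite -lee_fin; apply: le_trans Ha; apply: integral_ge0 => x _.
  by rewrite lee_fin; pos.
have b0 : 0 <= b.
  rewrite -lee_fin; apply: le_trans Hb; apply: integral_ge0 => x _.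
  by rewrite lee_fin; pos.
have Vx x : 0 <= Num.max (V x) 0 by rewrite le_max lexx orbT.
rewrite integral_density_reflect; last 2 first.
- by apply: measurable_funM => //; exact: measurable_maxr.
- by move=> x; have Vxx := Vx x; pos.
apply: le_trans (leeD Hr1 Hl1) _; rewrite -EFinD lee_fin.
set y := (F M - 1) ^+ 2; set z := (F (- M) - 1) ^+ 2.
have y0 : 0 <= y by exact: sqr_ge0.
have z0 : 0 <= z by exact: sqr_ge0.
have : 0 <= Cr * z by pos.
have : 0 <= Cl * y by pos.
lra.
Qed.

End global.

(** * The inequality under the growth condition *)

Ltac meas := repeat first
  [ assumption | exact: measurable_cst | apply: measurable_funX
  | apply: measurable_funB | apply: measurable_funD | apply: measurable_funM ].

Ltac side := first [ done | by meas | by move=> ? _; pos ].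

Section truncation_below.
Context (R : realType) (F g : R -> R) (eps : R).
Hypothesis lF : locally_lipschitz F.
Hypothesis Fg : upper_slope F g.

Let Fe x := Num.max (F x) eps.
Let A := [set x | eps <= F x].

Lemma dist_max_le (s t e : R) : `|Num.max s e - Num.max t e| <= `|s - t|.
Proof.
by case: (leP s e) => se; case: (leP t e) => te; rewrite ?subrr ?normr0//;
   rewrite !ler_norml; have := ler_norm (s - t); have := ler_norm (t - s);
   rewrite [`|t - s|]distrC => h1 h2; apply/andP; split; lra.
Qed.

Lemma locally_lipschitz_max : locally_lipschitz Fe.
Proof.
move/locally_lipschitzP : lF => lf; apply/locally_lipschitzP => x.
have [r [L [r0 L0 H]]] := lf x; exists r, L; split=> // y z yr zr.
exact: le_trans (dist_max_le _ _ _) (H _ _ yr zr).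
Qed.

(** Off [A] the strict inequality [F x < eps] persists nearby, so [Fe] is locally constant. Points
    with [F x = eps] belong to [A] and keep the slope [g], because taking the maximum with a
    constant does not increase distances. *)
Lemma upper_slope_max : upper_slope Fe (fun x => g x * \1_A x).
Proof.
move=> x e e0; rewrite indicE.
have [Ax|Ax] := boolP (x \in A).
  rewrite mulr1; apply: filterS (Fg x e0) => y; apply: le_trans.
  exact: dist_max_le.
rewrite mulr0 add0r.
have Fx : F x < eps by move: Ax; rewrite notin_setE /A /= => /negP; rewrite -ltNge.
have cF := locally_lipschitz_continuous lF.
near=> y.
have Fy : F y <= eps by near: y; exact: (@cvgr_le _ _ (nbhs x) _ F (F x) (cF x) eps Fx).
by rewrite /Fe !max_r ?(ltW Fx)// subrr normr0 mulr_ge0// ltW.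
Unshelve. all: by end_near. Qed.

Lemma measurable_slope_max : measurable_fun setT g ->
  measurable_fun setT (fun x => g x * \1_A x).
Proof.
move=> mg; apply: measurable_funM => //; apply: measurable_indic.
have mF : measurable_fun setT F.
  by apply: continuous_measurable_fun; exact: locally_lipschitz_continuous.
rewrite /A -[X in measurable X]setTI.
have -> : [set x | eps <= F x] = F @^-1` `[eps, +oo[.
  by apply/seteqP; split=> x /=; rewrite in_itv/= andbT.
exact: mF.
Qed.

End truncation_below.

Lemma Hq_ge_sqr (R : realType) (q x : R) : x ^+ 2 <= Hq q x.
Proof. by rewrite /Hq le_max lexx. Qed.

Lemma Hq_ge_pow (R : realType) (q x : R) : `|x| `^ q <= Hq q x.
Proof. by rewrite /Hq le_max lexx orbT. Qed.

Lemma Hq_ge0 (R : realType) (q x : R) : 0 <= Hq q x.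
Proof. by apply: le_trans (Hq_ge_sqr q x); exact: sqr_ge0. Qed.

Lemma measurable_Hq (R : realType) (q : R) (F g : R -> R) :
  measurable_fun setT F -> measurable_fun setT g ->
  measurable_fun setT (fun x => Hq q (g x / F x) * F x ^+ 2).
Proof.
move=> mF mg.
have mgF : measurable_fun setT (fun x => g x / F x).
  by apply: measurable_funM => //; exact: (measurableT_comp (@measurable_invr R)).
apply: measurable_funM; last exact: measurable_funX.
apply: measurable_maxr; first exact: measurable_funX.
by apply: (measurableT_comp (@measurable_powR R q)); exact: measurableT_comp.
Qed.

Lemma integral_probability_cst d (T : measurableType d) (R : realType)
  (P : probability T R) (a : R) : (\int[P]_x a%:E = a%:E)%E.
Proof. by rewrite integral_cst//= probability_setT mule1. Qed.

Lemma ln_le_sub1 (R : realType) (x : R) : 0 < x -> ln x <= x - 1.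
Proof.
move=> x0; have E : x = 1 + (x - 1) by ring.
by rewrite {1}E; apply: le_ln1Dx; lra.
Qed.

(** For [y] of mean 1 this expression integrates to the entropy; its sign allows the estimates to be
    made with integrals of nonnegative functions. *)
Lemma xlnx_ge (R : realType) (y : R) : 0 <= y -> 0 <= y * ln y - y + 1.
Proof.
rewrite le_eqVlt => /predU1P[<-|y0]; first by rewrite mul0r subr0 add0r.
have := ln_le_sub1 (x := y^-1); rewrite invr_gt0 lnV ?posrE// => /(_ y0) h.
have := ler_wpM2l (ltW y0) h; rewrite mulrBr divff ?gt_eqF//; lra.
Qed.

(** Here [8 * CP] bounds the integral of [(F - 1) ^+ 2] per unit of energy. The factors [5] and
    [2 ^+ n.+2] come from [entropy_integrand_le], the [CE] term from the potential with its two
    boundary terms, and the last product from [rho] times the integral of the truncation. *)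
Definition entropy_const (R : realType) (CP CE B : R) (n : nat) : R :=
  5 * (8 * CP) + 2 ^+ n.+2 * (CE * (8 * CP + 8 * CP * (expR B + 1) + 1) +
    (4 * CP + 4 * expR B * (1 + 2 * CP) + 4 * expR B) * (8 * CP + 1)).

(** * Entropy of a function with unit second moment *)

Section entropy_bound.
Context (R : realType) (V : R -> R) (mu : probability (measurableTypeR R) R).
Variables (q CP CE M B : R) (n : nat).
Hypothesis CP0 : 0 < CP.
Hypothesis CE0 : 0 < CE.
Hypothesis M0 : 0 <= M.
Hypothesis mV : measurable_fun setT V.
Hypothesis VB : forall x, - B <= V x.
Hypothesis VM : forall x, `|x| <= M -> `|V x| <= B.

Hypothesis poin : forall F g,
  locally_lipschitz F -> (forall x, 0 <= g x) -> upper_slope F g ->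
  measurable_fun setT g -> forall i : R,
  (\int[mu]_x (g x ^+ 2)%:E <= i%:E)%E ->
  (forall b, expR (- V b) * (F b - F 0) ^+ 2 <= CP * i) /\
  (\int[mu]_x ((F x - F 0) ^+ 2)%:E <= (CP * i)%:E)%E.

Hypothesis ener : forall F g,
  locally_lipschitz F -> (forall x, 0 <= g x) -> upper_slope F g ->
  measurable_fun setT g -> forall a b : R,
  (\int[mu]_x ((F x - 1) ^+ 2)%:E <= a%:E)%E ->
  (\int[mu]_x (`|g x / F x| `^ q * F x ^+ 2)%:E <= b%:E)%E ->
  (\int[mu]_x (trunc n.+2 (F x) * Num.max (V x) 0)%:E
    <= (CE * (a + (F M - 1) ^+ 2 + (F (- M) - 1) ^+ 2 + b))%:E)%E.

Variables (F g : R -> R) (e : R).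
Hypothesis lF : locally_lipschitz F.
Hypothesis F0 : forall x, 0 <= F x.
Hypothesis g0 : forall x, 0 <= g x.
Hypothesis Fg : upper_slope F g.
Hypothesis mg : measurable_fun setT g.
Hypothesis He : (\int[mu]_x (Hq q (g x / F x) * F x ^+ 2)%:E <= e%:E)%E.

Let mF : measurable_fun setT F.
Proof.
by apply: continuous_measurable_fun; exact: locally_lipschitz_continuous.
Qed.

(* The slope may not vanish where [F] does, while the energy ignores that set:
   apply the inequality to [max F eps], whose slope does vanish there. *)
Lemma poincare_Hq :
  (forall b, expR (- V b) * (F b - F 0) ^+ 2 <= 2 * CP * e) /\
  (\int[mu]_x ((F x - F 0) ^+ 2)%:E <= (2 * CP * e)%:E)%E.
Proof.
have key eps : 0 < eps ->
   (forall b, expR (- V b) * (Num.max (F b) eps - Num.max (F 0) eps) ^+ 2 <= CP * e) /\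
   (\int[mu]_x ((Num.max (F x) eps - Num.max (F 0) eps) ^+ 2)%:E <= (CP * e)%:E)%E.
  move=> eps0.
  apply: (poin (locally_lipschitz_max eps lF) _ (upper_slope_max eps lF Fg)
    (measurable_slope_max eps lF mg)).
    by move=> x; rewrite mulr_ge0.
  apply: le_trans He; apply: ge0_le_integral_EFin => //.
  - by apply: measurable_funX; exact: (measurable_slope_max eps lF mg).
  - exact: measurable_Hq.
  - by move=> x _; exact: sqr_ge0.
  - move=> x _; rewrite indicE.
    have [Ax|Ax] := boolP (x \in _); last first.
      by rewrite mulr0 expr0n/= mulr_ge0 ?Hq_ge0 ?sqr_ge0.
    have Fx : F x != 0.
      by rewrite gt_eqF// (lt_le_trans eps0)//; move: Ax; rewrite inE.
    rewrite mulr1; apply: (@le_trans _ _ ((g x / F x) ^+ 2 * F x ^+ 2)).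
      by rewrite exprMn exprVn divfK// expf_neq0.
    by rewrite ler_wpM2r ?sqr_ge0 ?Hq_ge_sqr.
(* Each maximum moves its argument up by at most [eps], so the differences [a - b] and [u - v] are
   within [eps] of each other. The factor 2 here is the one in [2 * CP * e], and the remainder
   vanishes with [eps]. *)
have dist (a b eps : R) : 0 <= a -> 0 <= b -> 0 < eps ->
    (a - b) ^+ 2 <= 2 * (Num.max a eps - Num.max b eps) ^+ 2 + 2 * eps ^+ 2.
  move=> a0 b0 e0.
  set u := Num.max a eps; set v := Num.max b eps.
  have [u1 u2] : a <= u /\ u <= a + eps.
    by rewrite /u; case: (leP a eps) => ?; split; lra.
  have [v1 v2] : b <= v /\ v <= b + eps.
    by rewrite /v; case: (leP b eps) => ?; split; lra.
  have h : (a - b - (u - v)) ^+ 2 <= eps ^+ 2.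
    rewrite -real_normK ?num_real// lerXn2r ?nnegrE ?(ltW e0)//.
    by rewrite ler_norml; apply/andP; split; lra.
  have := sqr_ge0 (2 * (u - v) - (a - b)).
  by move: h; nra.
have small (d : R) : 0 < d -> exists2 eps : R, 0 < eps & 2 * eps ^+ 2 <= d.
  move=> d0; exists (Num.min 1 (d / 2)); first by rewrite lt_min ltr01 divr_gt0.
  set x := Num.min _ _.
  have x0 : 0 < x by rewrite /x lt_min ltr01 divr_gt0.
  have x1 : x <= 1 by rewrite /x ge_min lexx.
  have x2 : x <= d / 2 by rewrite /x ge_min lexx orbT.
  by nra.
split=> [b|].
  have E0 := expR_gt0 (- V b).
  apply/ler_addgt0Pr => d d0.
  have [eps eps0 epsd] := small (d / expR (- V b)) (divr_gt0 d0 E0).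
  have [H _] := key eps eps0.
  have := ler_wpM2l (ltW E0) (dist (F b) (F 0) eps (F0 b) (F0 0) eps0).
  have := H b.
  have : expR (- V b) * (2 * eps ^+ 2) <= d by rewrite mulrC -ler_pdivlMr.
  lra.
apply/lee_addgt0Pr => d d0.
have [eps eps0 epsd] := small d d0.
have [_ H] := key eps eps0.
have mH : measurable_fun setT (fun x => (Num.max (F x) eps - Num.max (F 0) eps) ^+ 2).
  apply: measurable_funX; apply: measurable_funB => //.
  exact: measurable_maxr.
apply: (@le_trans _ _ (\int[mu]_x (2 * (Num.max (F x) eps - Num.max (F 0) eps) ^+ 2 +
   2 * eps ^+ 2)%:E)%E).
  apply: ge0_le_integral_EFin => //.
  - by apply: measurable_funX; exact: measurable_funB.
  - by apply: measurable_funD => //; exact: measurable_funM.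
  - by move=> x _; exact: sqr_ge0.
  - by move=> x _; exact: dist.
rewrite ge0_integralD_EFin//; last 3 first.
- exact: measurable_funM.
- by move=> x _; pos.
- by move=> x _; pos.
rewrite integral_probability_cst.
apply: leeD; last by rewrite lee_fin.
rewrite ge0_integralZl_real//; last by move=> x _; pos.
by rewrite -mulrA EFinM; apply: lee_wpmul2l => //; rewrite lee_fin.
Qed.

Lemma trunc_le_self (s : R) : 0 <= s -> trunc n.+2 s <= s ^+ 2.
Proof.
move=> s0; have [s1|/ltW s1] := leP s 1; first by rewrite trunc_eq0 ?sqr_ge0.
by apply: le_trans (trunc_le _ s1) _; rewrite lerXn2r ?nnegrE ?subr_ge0//; lra.
Qed.

(** For [0 < s <= 2], [ln s <= s - 1] bounds the left side by [(2 * s + 1) * (s - 1) ^+ 2], hence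
    the constant 5. For [s >= 2], [ln (s ^+ 2) = v + ln (expR (- v) * s ^+ 2) <= Num.max v 0 + r],
    and [s ^+ 2] is comparable to the truncation. *)
Lemma entropy_integrand_le (s v r : R) : 0 <= s -> expR (- v) * s ^+ 2 <= r -> 0 <= r ->
  s ^+ 2 * ln (s ^+ 2) - s ^+ 2 + 1 <=
  5 * (s - 1) ^+ 2 + 2 ^+ n.+2 * (trunc n.+2 s * (Num.max v 0 + r)).
Proof.
move=> s0 hr r0.
have T0 := trunc_ge0 n.+2 s.
have m0 : 0 <= Num.max v 0 by rewrite le_max lexx orbT.
have R0 : 0 <= 2 ^+ n.+2 * (trunc n.+2 s * (Num.max v 0 + r)) by pos.
have [s2|/ltW s2] := leP s 2.
  suff : s ^+ 2 * ln (s ^+ 2) - s ^+ 2 + 1 <= 5 * (s - 1) ^+ 2 by lra.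
  move: s0; rewrite le_eqVlt => /predU1P[<-|s0].
    by rewrite expr0n/= mul0r; lra.
  have -> : ln (s ^+ 2) = 2 * ln s by rewrite lnXn// mulr2n mulrDl mul1r.
  have h := ln_le_sub1 s0.
  have h2 : s ^+ 2 * ln s <= s ^+ 2 * (s - 1) by rewrite ler_wpM2l ?sqr_ge0.
  have : 0 <= (2 - s) * (s - 1) ^+ 2 by rewrite mulr_ge0 ?sqr_ge0// subr_ge0.
  nra.
have s1 : 1 <= s by apply: le_trans s2; rewrite ler1n.
have ss0 : 0 < s ^+ 2 by rewrite exprn_gt0//; lra.
have hl : ln (s ^+ 2) <= Num.max v 0 + r.
  have -> : s ^+ 2 = expR v * (expR (- v) * s ^+ 2).
    by rewrite mulrA -expRD subrr expR0 mul1r.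
  have p0 : 0 < expR (- v) * s ^+ 2 by rewrite mulr_gt0 ?expR_gt0.
  rewrite lnM ?posrE ?expR_gt0// expRK; apply: lerD; first by rewrite le_max lexx.
  apply: le_trans hr.
  by have := ln_le_sub1 p0; lra.
have h1 : s ^+ 2 * ln (s ^+ 2) <= s ^+ 2 * (Num.max v 0 + r).
  by rewrite ler_wpM2l// ltW.
have h2 : s ^+ 2 * (Num.max v 0 + r) <= 2 ^+ n.+2 * trunc n.+2 s * (Num.max v 0 + r).
  by rewrite ler_wpM2r ?addr_ge0// trunc_lower.
have h3 : 1 <= s ^+ 2 by rewrite exprn_ege1.
have := sqr_ge0 (s - 1).
lra.
Qed.

Hypothesis F2 : (\int[mu]_x (F x ^+ 2)%:E = 1)%E.

Lemma entropy_integral_le :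
  (\int[mu]_x (F x ^+ 2 * ln (F x ^+ 2) - F x ^+ 2 + 1)%:E <=
   (entropy_const CP CE B n * e)%:E)%E.
Proof.
rewrite /entropy_const; set K1 := 8 * CP; set D := _ + 4 * expR B.
have [P1 P2] := poincare_Hq.
have e0 : 0 <= e.
  rewrite -lee_fin; apply: le_trans He; apply: integral_ge0 => x _.
  by rewrite lee_fin mulr_ge0 ?Hq_ge0 ?sqr_ge0.
have CPe : 0 <= CP * e by pos.
have mF2 : measurable_fun setT (fun x => F x ^+ 2) by exact: measurable_funX.
have mFa (a : R) : measurable_fun setT (fun x => (F x - a) ^+ 2).
  by apply: measurable_funX; exact: measurable_funB.
have cst := integral_probability_cst mu.
(* Integrate [(F x - F 0) ^+ 2] after bounding the cross term by
   [2 * F x * F 0 <= F 0 * (F x ^+ 2 + 1)]. As [F x ^+ 2] has mean 1, this leaves exactly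
   [(F 0 - 1) ^+ 2]. *)
have F01 : (F 0 - 1) ^+ 2 <= 2 * CP * e.
  have : (\int[mu]_x (F x ^+ 2 + F 0 ^+ 2)%:E <=
     \int[mu]_x ((F x - F 0) ^+ 2 + (F 0 * F x ^+ 2 + F 0))%:E)%E.
    apply: ge0_le_integral_EFin; [side..|].
    by move=> x _; have : 0 <= F 0 * (F x - 1) ^+ 2; [pos|lra].
  rewrite ge0_integralD_EFin; [|side..].
  rewrite F2 cst.
  rewrite ge0_integralD_EFin; [|side..].
  rewrite ge0_integralD_EFin; [|side..].
  rewrite ge0_integralZl_real; [|side..].
  rewrite F2 cst mule1 => H.
  have := le_trans H (leeD P2 (lexx _)).
  by rewrite -!EFinD lee_fin; lra.
have X : (\int[mu]_x ((F x - 1) ^+ 2)%:E <= (K1 * e)%:E)%E.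
  apply: (@le_trans _ _ (\int[mu]_x (2 * (F x - F 0) ^+ 2 + 2 * (F 0 - 1) ^+ 2)%:E)%E).
    apply: ge0_le_integral_EFin; [side..|].
    by move=> x _; have := sqr_ge0 (F x - F 0 - (F 0 - 1)); lra.
  rewrite ge0_integralD_EFin; [|side..].
  rewrite cst.
  rewrite ge0_integralZl_real; [|side..].
  apply: (@le_trans _ _ (2%:E * (2 * CP * e)%:E + (2 * (2 * CP * e))%:E)%E).
    apply: leeD; first by apply: lee_wpmul2l => //; rewrite lee_fin.
    by rewrite lee_fin ler_wpM2l.
  by rewrite -EFinM -EFinD lee_fin /K1; lra.
have Mb (x : R) : `|x| <= M -> (F x - 1) ^+ 2 <= 4 * CP * (expR B + 1) * e.
  move=> xM; have := P1 x.
  rewrite expRN ler_pdivrMl ?expR_gt0// => h.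
  have : expR (V x) * (2 * CP * e) <= expR B * (2 * CP * e).
    rewrite ler_wpM2r//; first by pos.
    by rewrite ler_expR (le_trans (ler_norm _))// VM.
  by have := sqr_ge0 (F x - F 0 - (F 0 - 1)); move: h F01; lra.
have Z : (\int[mu]_x (`|g x / F x| `^ q * F x ^+ 2)%:E <= e%:E)%E.
  apply: le_trans He; apply: ge0_le_integral_EFin => //.
  - apply: measurable_funM => //.
    apply: (measurableT_comp (@measurable_powR R q)); apply: measurableT_comp => //.
    by apply: measurable_funM => //; exact: (measurableT_comp (@measurable_invr R)).
  - exact: measurable_Hq.
  - by move=> x _; pos.
  - by move=> x _; rewrite ler_wpM2r ?sqr_ge0 ?Hq_ge_pow.
have TV := ener lF g0 Fg mg X Z.
have VE x : expR (- V x) <= expR B by rewrite ler_expR lerNl; have := VB x; lra.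
(* From [F x ^+ 2 <= 2 * (F x - F 0) ^+ 2 + 2 * F 0 ^+ 2], the pointwise bound [P1], and
   [F 0 ^+ 2 <= 2 * (1 + 2 * CP * e)]. *)
pose rho := 4 * CP * e + 4 * expR B * (1 + 2 * CP * e).
have EB := expR_gt0 B.
have rho0 : 0 <= rho by rewrite /rho; pos.
have rhoP x : expR (- V x) * F x ^+ 2 <= rho.
  have := P1 x; have := VE x; have := expR_gt0 (- V x); set E := expR (- V x) => E0 EB1 h.
  have : E * F 0 ^+ 2 <= expR B * (2 * (1 + 2 * CP * e)).
    apply: ler_pM => //; [exact: ltW|exact: sqr_ge0|].
    by have := sqr_ge0 (F 0 - 2); move: F01; lra.
  have : E * F x ^+ 2 <= 2 * (E * (F x - F 0) ^+ 2) + 2 * (E * F 0 ^+ 2).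
    have := mulr_ge0 (ltW E0) (sqr_ge0 (F x - 2 * F 0)); lra.
  by rewrite /rho; lra.
have mT : measurable_fun setT (fun x => trunc n.+2 (F x)).
  apply: continuous_measurable_fun.
  exact/locally_lipschitz_continuous/locally_lipschitz_trunc.
have mV0 : measurable_fun setT (fun x => Num.max (V x) 0) by exact: measurable_maxr.
have Vx x : 0 <= Num.max (V x) 0 by rewrite le_max lexx orbT.
have T0 x : 0 <= trunc n.+2 (F x) by exact: trunc_ge0.
have IT1 : (\int[mu]_x (trunc n.+2 (F x))%:E <= 1)%E.
  rewrite -F2; apply: ge0_le_integral_EFin; [side..|].
  by move=> x _; apply: trunc_le_self.
have IT2 : (\int[mu]_x (trunc n.+2 (F x))%:E <= (K1 * e)%:E)%E.
  apply: le_trans X; apply: ge0_le_integral_EFin; [side..|].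
  by move=> x _; apply: trunc_le_sqr.
have [t tE] : exists t, (\int[mu]_x (trunc n.+2 (F x))%:E = t%:E)%E.
  exists (fine (\int[mu]_x (trunc n.+2 (F x))%:E)%E); rewrite fineK//.
  rewrite ge0_fin_numE; first by apply: le_lt_trans IT1 _; rewrite ltry.
  by apply: integral_ge0 => x _; rewrite lee_fin.
move: IT1 IT2; rewrite tE !lee_fin => t1 t2.
have t0 : 0 <= t.
  by rewrite -lee_fin -tE; apply: integral_ge0 => x _; rewrite lee_fin.
apply: (@le_trans _ _ (\int[mu]_x (5 * (F x - 1) ^+ 2 + 2 ^+ n.+2 *
    (trunc n.+2 (F x) * Num.max (V x) 0 + rho * trunc n.+2 (F x)))%:E)%E).
  have mln : measurable_fun setT (fun x => ln (F x ^+ 2)).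
    exact: (measurableT_comp (@measurable_ln R)).
  apply: ge0_le_integral_EFin; [side|side|side| |].
    by move=> x _; apply: xlnx_ge; exact: sqr_ge0.
  move=> x _; have := entropy_integrand_le (F0 x) (rhoP x) rho0; lra.
rewrite ge0_integralD_EFin; [|side..].
rewrite ge0_integralZl_real; [|side..].
rewrite ge0_integralZl_real; [|side..].
rewrite ge0_integralD_EFin; [|side..].
rewrite (@ge0_integralZl_real _ _ _ mu setT measurableT _ rho); [|side..].
rewrite tE.
set y := (F M - 1) ^+ 2 in TV; set z := (F (- M) - 1) ^+ 2 in TV.
have yM : y <= 4 * CP * (expR B + 1) * e by apply: Mb; rewrite ger0_norm.
have zM : z <= 4 * CP * (expR B + 1) * e by apply: Mb; rewrite normrN ger0_norm.
apply: (@le_trans _ _ (5%:E * (K1 * e)%:E + (2 ^+ n.+2)%:E *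
    ((CE * (K1 * e + y + z + e))%:E + rho%:E * t%:E))%E).
  apply: leeD; first by apply: lee_wpmul2l => //; rewrite lee_fin.
  apply: lee_wpmul2l; first by rewrite lee_fin; pos.
  exact: leeD.
rewrite -!EFinM -!EFinD lee_fin.
have A1 : CE * (K1 * e + y + z + e) <= CE * ((K1 + K1 * (expR B + 1) + 1) * e).
  by rewrite ler_wpM2l ?(ltW CE0)// /K1; lra.
(* A product of two quantities affine in [e] is kept linear by using [t <= 1] against the part of
   [rho] proportional to [e] and [t <= K1 * e] against its constant part. *)
have A2 : rho * t <= D * (K1 + 1) * e.
  have a1 : (4 * CP + 8 * expR B * CP) * e * t <= (4 * CP + 8 * expR B * CP) * e * 1.
    by apply: ler_wpM2l => //; pos.
  have a2 : 4 * expR B * t <= 4 * expR B * (K1 * e).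
    by apply: ler_wpM2l => //; pos.
  have a3 : 0 <= (4 * CP + 8 * expR B * CP) * (K1 * e) by rewrite /K1; pos.
  have a4 : 0 <= 4 * expR B * (K1 * e) by rewrite /K1; pos.
  have a5 : 0 <= expR B * e by pos.
  by move: a1 a2 a3 a4 a5; rewrite /rho /D; lra.
have N0 : (0 : R) <= 2 ^+ n.+2 by pos.
have := ler_wpM2l N0 (lerD A1 A2).
move: (2 ^+ n.+2) D K1 {A1 A2 X yM zM t2 TV N0} => N D K1; lra.
Qed.

End entropy_bound.

Section integral_affine.
Context d (T : measurableType d) (R : realType) (P : probability T R).

Lemma ge0_integrable_EFin (X : T -> R) (x : R) : measurable_fun setT X ->
  (forall t, 0 <= X t) -> (\int[P]_t (X t)%:E <= x%:E)%E ->
  P.-integrable setT (EFin \o X).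
Proof.
move=> mX X0 Xx; apply/integrableP; split; first exact/measurable_EFinP.
apply: le_lt_trans (ltry x); apply: le_trans Xx.
by under eq_integral do rewrite /= ger0_norm//.
Qed.

Lemma integral_affine (X Y : T -> R) (x y a b c : R) :
  measurable_fun setT X -> measurable_fun setT Y ->
  (forall t, 0 <= X t) -> (forall t, 0 <= Y t) ->
  (\int[P]_t (X t)%:E = x%:E)%E -> (\int[P]_t (Y t)%:E = y%:E)%E ->
  (\int[P]_t (a * X t + b * Y t + c)%:E = (a * x + b * y + c)%:E)%E.
Proof.
move=> mX mY X0 Y0 Xx Yy.
have iX : P.-integrable setT (EFin \o X).
  by apply: (@ge0_integrable_EFin _ x) => //; rewrite Xx.
have iY : P.-integrable setT (EFin \o Y).
  by apply: (@ge0_integrable_EFin _ y) => //; rewrite Yy.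
have iaX := integrableZl measurableT a iX.
have ibY := integrableZl measurableT b iY.
have ic : P.-integrable setT (EFin \o cst c) by exact: finite_measure_integrable_cst.
have iXY := integrableD measurableT iaX ibY.
transitivity (\int[P]_t ((a%:E * (X t)%:E + b%:E * (Y t)%:E) + c%:E))%E.
  by apply: eq_integral => t _; rewrite -!EFinM -!EFinD.
rewrite (@integralD _ _ _ P setT measurableT _ (EFin \o cst c) iXY ic).
rewrite (@integralD _ _ _ P setT measurableT _ _ iaX ibY).
rewrite (@integralZl _ _ _ P setT measurableT _ iX).
rewrite (@integralZl _ _ _ P setT measurableT _ iY).
rewrite integral_probability_cst [X in (_ * X + _)%E](_ : _ = x%:E)//.
by rewrite [X in (_ + _ * X + _)%E](_ : _ = y%:E)//.
Qed.

End integral_affine.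

Section scaled_abs.
Context (R : realType) (f : R -> R) (t : R).
Hypothesis t0 : 0 <= t.
Hypothesis lf : locally_lipschitz f.

Let abs_two_point (r s : R) : exists2 xi, `|xi - r| <= `|s - r| &
  `|t * `|s| - t * `|r| | <= t * `|s - r|.
Proof.
exists r; first by rewrite subrr normr0.
by rewrite -mulrBr normrM (ger0_norm t0) ler_wpM2l// ler_dist_dist.
Qed.

Lemma locally_lipschitz_abs : locally_lipschitz (fun x => t * `|f x|).
Proof.
apply: (@locally_lipschitz_comp _ f (fun s => t * `|s|) (fun=> t)) => //.
by move=> x; exact: cvg_cst.
Qed.

Lemma upper_slope_abs : upper_slope (fun x => t * `|f x|) (fun x => t * local_slope f x).
Proof.
apply: (@upper_slope_comp _ f _ (fun s => t * `|s|) (fun=> t)) => //.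
- by move=> x; exact: cvg_cst.
- by move=> x; exact: local_slope_ge0.
- exact: upper_slope_local_slope.
Qed.

(** Scaling and taking absolute values leave the modulus of the quotient of slope by function
    unchanged, so the energy scales like the second moment. Where [f] vanishes both sides are 0. *)
Lemma Hq_scaled (q x : R) : 0 < t ->
  Hq q (t * local_slope f x / (t * `|f x|)) * (t * `|f x|) ^+ 2 =
  t ^+ 2 * (Hq q (local_slope f x / f x) * f x ^+ 2).
Proof.
move=> tp; have -> : Hq q (t * local_slope f x / (t * `|f x|)) = Hq q (local_slope f x / f x).
  have E : `|t * local_slope f x / (t * `|f x|)| = `|local_slope f x / f x|.
    rewrite -mulf_div divff ?gt_eqF// mul1r !normrM normfV normr_id.
    by rewrite -normfV.
  by rewrite /Hq -[in LHS]real_normK ?num_real// E real_normK ?num_real.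
by rewrite exprMn real_normK ?num_real//; ring.
Qed.

End scaled_abs.

(** * Reduction to unit second moment *)

Section sufficiency.
Context (R : realType) (V : R -> R) (mu : probability (measurableTypeR R) R).
Variables (q CP CE M B : R) (n : nat).
Hypothesis CP0 : 0 < CP.
Hypothesis CE0 : 0 < CE.
Hypothesis M0 : 0 <= M.
Hypothesis mV : measurable_fun setT V.
Hypothesis VB : forall x, - B <= V x.
Hypothesis VM : forall x, `|x| <= M -> `|V x| <= B.

Hypothesis poin : forall F g,
  locally_lipschitz F -> (forall x, 0 <= g x) -> upper_slope F g ->
  measurable_fun setT g -> forall i : R,
  (\int[mu]_x (g x ^+ 2)%:E <= i%:E)%E ->
  (forall b, expR (- V b) * (F b - F 0) ^+ 2 <= CP * i) /\
  (\int[mu]_x ((F x - F 0) ^+ 2)%:E <= (CP * i)%:E)%E.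

Hypothesis ener : forall F g,
  locally_lipschitz F -> (forall x, 0 <= g x) -> upper_slope F g ->
  measurable_fun setT g -> forall a b : R,
  (\int[mu]_x ((F x - 1) ^+ 2)%:E <= a%:E)%E ->
  (\int[mu]_x (`|g x / F x| `^ q * F x ^+ 2)%:E <= b%:E)%E ->
  (\int[mu]_x (trunc n.+2 (F x) * Num.max (V x) 0)%:E
    <= (CE * (a + (F M - 1) ^+ 2 + (F (- M) - 1) ^+ 2 + b))%:E)%E.

(** Both sides scale by [t ^+ 2] when [f] is replaced by [t * |f|], so [t] is chosen to make the
    second moment 1. Infinite energy and a null second moment are settled separately. *)
Lemma entropy_le (f : R -> R) : locally_lipschitz f ->
  (entropy mu (fun x => (f x ^+ 2)%R) <=
   (entropy_const CP CE B n)%:E * Hq_energy mu q f)%E.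
Proof.
move=> lf.
have mf : measurable_fun setT f.
  by apply: continuous_measurable_fun; exact: locally_lipschitz_continuous.
have mg := measurable_local_slope lf.
have K0 : 0 < entropy_const CP CE B n.
  rewrite /entropy_const; have EB := expR_gt0 B.
  by apply: ltr_pwDl; [rewrite !mulr_gt0|pos].
have Hm := @measurable_Hq _ q _ _ mf mg.
have H0 x : 0 <= Hq q (local_slope f x / f x) * f x ^+ 2.
  by rewrite mulr_ge0 ?Hq_ge0 ?sqr_ge0.
have E0 : (0 <= Hq_energy mu q f)%E.
  by apply: integral_ge0 => x _; rewrite lee_fin.
have [Ey|Efin] := eqVneq (Hq_energy mu q f) +oo%E.
  by rewrite Ey gt0_muley ?leey// lte_fin.
have {}Efin : Hq_energy mu q f \is a fin_num by rewrite ge0_fin_numE// ltey.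
set e := fine (Hq_energy mu q f).
have eE : (\int[mu]_x (Hq q (local_slope f x / f x) * f x ^+ 2)%:E = e%:E)%E.
  by rewrite /e fineK.
have scaled t : 0 < t ->
  (\int[mu]_x (Hq q (t * local_slope f x / (t * `|f x|)) * (t * `|f x|) ^+ 2)%:E
   <= (t ^+ 2 * e)%:E)%E.
  move=> t0; under eq_integral do rewrite (Hq_scaled f q _ t0).
  by rewrite ge0_integralZl_real ?sqr_ge0// eE -EFinM.
have gt0 t x : 0 <= t -> 0 <= t * local_slope f x.
  by move=> t0; rewrite mulr_ge0// local_slope_ge0.
have mgt t : measurable_fun setT (fun x => t * local_slope f x) by exact: measurable_funM.
have mf2 : measurable_fun setT (fun x => f x ^+ 2) by exact: measurable_funX.
have Fge0 t x : 0 <= t -> 0 <= t * `|f x| by move=> t0; rewrite mulr_ge0.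
have m0 : (0 <= \int[mu]_x (f x ^+ 2)%:E)%E.
  by apply: integral_ge0 => x _; rewrite lee_fin sqr_ge0.
(* Finite energy forces a finite second moment, by the Poincare inequality for [|f|]; this excludes
   the branch where the entropy is [+oo]. *)
have mfin : (\int[mu]_x (f x ^+ 2)%:E < +oo)%E.
  have [_ P2] := poincare_Hq poin (locally_lipschitz_abs ler01 lf)
    (fun x => Fge0 1 x ler01) (fun x => gt0 1 x ler01) (upper_slope_abs ler01 lf) (mgt 1)
    (scaled 1 ltr01).
  apply: (@le_lt_trans _ _ (\int[mu]_x (2 * (1 * `|f x| - 1 * `|f 0|) ^+ 2 + 2 * f 0 ^+ 2)%:E)%E).
    apply: ge0_le_integral_EFin; [by []| | | | ].
    - exact: mf2.
    - apply: measurable_funD => //; apply: measurable_funM => //.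
      apply: measurable_funX; apply: measurable_funB => //; apply: measurable_funM => //.
      exact: measurableT_comp.
    - by move=> x _; exact: sqr_ge0.
    - move=> x _; rewrite !mul1r -[leLHS]real_normK ?num_real//.
      rewrite -[f 0 ^+ 2]real_normK ?num_real//.
      by have := sqr_ge0 (`|f x| - 2 * `|f 0|); lra.
  rewrite ge0_integralD_EFin; [|by []| | | |]; last 4 first.
  - apply: measurable_funM => //.
    apply: measurable_funX; apply: measurable_funB => //; apply: measurable_funM => //.
    exact: measurableT_comp.
  - by [].
  - by move=> x _; pos.
  - by move=> x _; pos.
  rewrite integral_probability_cst ge0_integralZl_real; [|by []| | |by []]; last 2 first.
  - apply: measurable_funX; apply: measurable_funB => //; apply: measurable_funM => //.
    exact: measurableT_comp.
  - by move=> x _; pos.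
  apply: le_lt_trans (ltry (2 * (2 * CP * (1 ^+ 2 * e)) + 2 * f 0 ^+ 2)).
  rewrite [leRHS]EFinD; apply: leeD => //.
  by rewrite [(2 * _)%:E]EFinM; apply: lee_wpmul2l => //; rewrite lee_fin.
rewrite /entropy -[X in X == +oo%E]/(\int[mu]_x (f x ^+ 2)%:E)%E ifF; last first.
  by apply/negbTE; rewrite lt_eqF.
set m := fine _.
have mE : (\int[mu]_x (f x ^+ 2)%:E = m%:E)%E by rewrite /m fineK// ge0_fin_numE.
have mln : measurable_fun setT (fun x => f x ^+ 2 * ln (f x ^+ 2)).
  by apply: measurable_funM => //; exact: (measurableT_comp (@measurable_ln R)).
have : 0 <= m by rewrite -lee_fin -mE.
rewrite le_eqVlt => /predU1P[mz|mp].
  (* With [m = 0], [f] vanishes almost everywhere and the entropy is 0. *)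
  have -> : (\int[mu]_x (f x ^+ 2 * ln (f x ^+ 2))%:E = 0)%E.
    have ae0 : ae_eq mu setT (fun x => (f x ^+ 2)%:E) (cst 0%E).
      apply/ae_eq_integral_abs => //; first exact/measurable_EFinP.
      under eq_integral do rewrite /= ger0_norm ?sqr_ge0//.
      by rewrite mE -mz.
    rewrite (@ae_eq_integral _ _ _ mu setT (cst 0%E)) ?integral0//.
      exact/measurable_EFinP.
    apply: filterS ae0 => x fx0 _ /=; have := fx0 I.
    by case=> ->; rewrite mul0r.
  by rewrite -mz mul0r sube0 mule_ge0// lee_fin ltW.
pose t := Num.sqrt m^-1.
have tt : t ^+ 2 = m^-1 by rewrite sqr_sqrtr// invr_ge0 ltW.
have t0 : 0 < t by rewrite sqrtr_gt0 invr_gt0.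
have F2E x : (t * `|f x|) ^+ 2 = m^-1 * f x ^+ 2.
  by rewrite exprMn tt real_normK ?num_real.
have F2 : (\int[mu]_x ((t * `|f x|) ^+ 2)%:E = 1)%E.
  under eq_integral do rewrite F2E.
  rewrite ge0_integralZl_real//; last 2 first.
  - by move=> x _; exact: sqr_ge0.
  - by rewrite invr_ge0 ltW.
  by rewrite mE -EFinM mulVf// gt_eqF.
have Phi := @entropy_integral_le _ V mu q CP CE M B n CP0 CE0 M0 mV VB VM poin ener
  (fun x => t * `|f x|) (fun x => t * local_slope f x) (t ^+ 2 * e)
  (locally_lipschitz_abs (ltW t0) lf)
  (fun x => Fge0 t x (ltW t0)) (fun x => gt0 t x (ltW t0)) (upper_slope_abs (ltW t0) lf) (mgt t)
  (scaled t t0) F2.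
pose G x := m^-1 * f x ^+ 2 * ln (m^-1 * f x ^+ 2) - m^-1 * f x ^+ 2 + 1.
have GK : (\int[mu]_x (G x)%:E <= (entropy_const CP CE B n * (t ^+ 2 * e))%:E)%E.
  by apply: le_trans Phi; under [leRHS]eq_integral do rewrite F2E.
have G0 x : 0 <= G x.
  by apply: xlnx_ge; rewrite mulr_ge0 ?sqr_ge0// invr_ge0 ltW.
have mG : measurable_fun setT G.
  have mf2m : measurable_fun setT (fun x => m^-1 * f x ^+ 2) by exact: measurable_funM.
  apply: measurable_funD => //; apply: measurable_funB => //.
  by apply: measurable_funM => //; exact: (measurableT_comp (@measurable_ln R)).
have Gfin : (\int[mu]_x (G x)%:E)%E \is a fin_num.
  rewrite ge0_fin_numE; first by apply: le_lt_trans GK _; rewrite ltry.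
  by apply: integral_ge0 => x _; rewrite lee_fin.
have [gam GE] : exists gam, (\int[mu]_x (G x)%:E = gam%:E)%E.
  by exists (fine (\int[mu]_x (G x)%:E)%E); rewrite fineK.
move: GK; rewrite GE lee_fin => GK.
(* Pointwise, [f ^+ 2 * ln (f ^+ 2) = m * G + (1 + ln m) * f ^+ 2 - m]; where [f] vanishes [G] is 1
   and both sides are 0. After subtracting [m * ln m], the entropy is [m * gam]. *)
have -> : (\int[mu]_x (f x ^+ 2 * ln (f x ^+ 2))%:E =
    (m * gam + (1 + ln m) * m + - m)%:E)%E.
  rewrite -(@integral_affine _ _ R mu G (fun x => f x ^+ 2) gam m m (1 + ln m) (- m))//; last first.
    by move=> x; exact: sqr_ge0.
  apply: eq_integral => x _; congr EFin; rewrite /G.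
  have [->|fx0] := eqVneq (f x) 0.
    by rewrite expr0n/= !mulr0 !mul0r subr0 !add0r addr0 mulr1 subrr.
  have f2 : 0 < f x ^+ 2 by rewrite exprn_even_gt0.
  rewrite (@lnM _ m^-1) ?posrE ?invr_gt0// lnV ?posrE//.
  have m1 : m != 0 by rewrite gt_eqF.
  by field.
rewrite -EFinB -(fineK Efin) -/e -EFinM lee_fin.
have : m * gam <= m * (entropy_const CP CE B n * (t ^+ 2 * e)) by rewrite ler_wpM2l// ltW.
have -> : m * (entropy_const CP CE B n * (t ^+ 2 * e)) = entropy_const CP CE B n * e.
  by rewrite tt; field; rewrite gt_eqF.
lra.
Qed.

End sufficiency.

(** * Necessity of the growth condition *)

Lemma local_slope_le_upper (R : realType) (f G : R -> R) (x : R) :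
  locally_lipschitz f -> upper_slope f G -> local_slope f x <= G x.
Proof.
move=> lf fG; apply/ler_addgt0Pr => e e0.
by apply: local_slope_le => //; exact: fG.
Qed.

(** * Powers of ramps as test functions *)

Section ramp.
Context (R : realType) (w y : R) (n : nat).
Hypothesis w0 : 0 < w.

Definition ramp (z : R) := Num.max 0 (Num.min 1 (w * (z - y))).

Lemma ramp_ge0 z : 0 <= ramp z. Proof. by rewrite le_max lexx. Qed.

Lemma ramp_le1 z : ramp z <= 1.
Proof. by rewrite ge_max ler01 ge_min lexx. Qed.

Lemma ramp_eq0 z : z <= y -> ramp z = 0.
Proof.
move=> zy; rewrite /ramp max_l// ge_min; apply/orP; right.
by rewrite mulr_ge0_le0 ?subr_le0// ltW.
Qed.

Lemma ramp_eq1 z : y + w^-1 <= z -> ramp z = 1.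
Proof.
move=> zy; have h : 1 <= w * (z - y).
  rewrite -(@divff _ w) ?gt_eqF// ler_wpM2l ?(ltW w0)//; lra.
by rewrite /ramp min_l// max_r.
Qed.

Lemma ramp_dist z z' : z <= z' -> 0 <= ramp z' - ramp z <= w * (z' - z).
Proof.
move=> zz; have h : w * (z - y) <= w * (z' - y) by rewrite ler_wpM2l ?(ltW w0)//; lra.
rewrite /ramp; set a := w * (z - y); set b := w * (z' - y).
have -> : w * (z' - z) = b - a by rewrite /a /b; ring.
by case: (leP 1 a) => ?; case: (leP 1 b) => ?; case: (leP 0 a) => ?;
  case: (leP 0 b) => ?; rewrite ?(max_r ler01); apply/andP; split; move: h; rewrite -/a -/b; lra.
Qed.

Lemma ramp_two_point (z z' : R) : exists2 xi, `|xi - z| <= `|z' - z| &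
  `|ramp z' ^+ n.+2 - ramp z ^+ n.+2| <= n.+2%:R * w * ramp xi ^+ n.+1 * `|z' - z|.
Proof.
have main u v : u <= v -> 0 <= ramp v ^+ n.+2 - ramp u ^+ n.+2 <=
    n.+2%:R * w * ramp v ^+ n.+1 * (v - u).
  move=> uv; have /andP[h1 h2] := ramp_dist uv.
  have ruv : ramp u <= ramp v by lra.
  rewrite subr_ge0 lerXn2r ?nnegrE ?ramp_ge0//=.
  apply: le_trans (subrX_le n.+1 (ramp_ge0 u) ruv) _.
  have : n.+2%:R * ramp v ^+ n.+1 * (ramp v - ramp u) <=
     n.+2%:R * ramp v ^+ n.+1 * (w * (v - u)).
    by rewrite ler_wpM2l// mulr_ge0// exprn_ge0// ramp_ge0.
  by move=> h; apply: (le_trans h); rewrite le_eqVlt; apply/orP; left; apply/eqP; ring.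
have [zz|/ltW zz] := leP z z'.
  exists z' => //; have /andP[e1 e2] := main _ _ zz.
  by rewrite (ger0_norm e1) ger0_norm ?subr_ge0.
exists z; first by rewrite subrr normr0.
have /andP[e1 e2] := main _ _ zz.
by rewrite distrC [`|z' - z|]distrC (ger0_norm e1) ger0_norm ?subr_ge0.
Qed.

Lemma continuous_ramp : continuous ramp.
Proof.
rewrite -[ramp]/(fun z => Num.max 0 (Num.min 1 (w * (z - y)))) => z.
apply: (@continuous_max _ _ (cst 0) (fun z => Num.min 1 (w * (z - y)))); first exact: cvg_cst.
apply: (@continuous_min _ _ (cst 1) (fun z => w * (z - y))); first exact: cvg_cst.
apply: cvgM; first exact: cvg_cst.
by apply: cvgB; [exact: cvg_id|exact: cvg_cst].
Qed.

Lemma continuous_ramp_slope :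
  continuous (fun z => n.+2%:R * w * ramp z ^+ n.+1).
Proof.
move=> z; apply: cvgM; first exact: cvg_cst.
exact: continuous_comp (@continuous_ramp z) (@exprn_continuous _ _ _).
Qed.

Lemma ramp_slope_ge0 z : 0 <= n.+2%:R * w * ramp z ^+ n.+1.
Proof. by rewrite !mulr_ge0 ?(ltW w0)// exprn_ge0// ramp_ge0. Qed.

Variable s : R -> R.
Hypothesis s_iso : forall x x', `|s x - s x'| = `|x - x'|.

Let ls : locally_lipschitz s.
Proof.
apply/locally_lipschitzP => x; exists 1, 1; split=> // u v _ _.
by rewrite mul1r s_iso.
Qed.

Let us : upper_slope s (fun=> 1).
Proof.
move=> x e e0; near=> u; rewrite s_iso ler_peMl//; lra.
Unshelve. all: by end_near. Qed.

Let f x := ramp (s x) ^+ n.+2.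

(** The isometry [s] is the identity for the right end and the opposite for the left one, so a
    single computation serves both. *)
Lemma locally_lipschitz_ramp : locally_lipschitz f.
Proof.
exact: (locally_lipschitz_comp ls ramp_two_point continuous_ramp_slope ramp_slope_ge0).
Qed.

Lemma local_slope_ramp x : local_slope f x <= n.+2%:R * w * ramp (s x) ^+ n.+1.
Proof.
have := upper_slope_comp ls ramp_two_point continuous_ramp_slope ramp_slope_ge0
  (fun=> ler01) us.
move=> /(local_slope_le_upper x locally_lipschitz_ramp).
by rewrite mulr1.
Qed.

(** The bound of [local_slope_ramp] does not vanish on the plateau, where [f] is locally constant;
    without this the energy would see the whole tail. *)
Lemma local_slope_ramp0 x : y + w^-1 < s x -> local_slope f x = 0.
Proof.
move=> sx; apply/eqP; rewrite eq_le local_slope_ge0 ?andbT; last first.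
  exact: locally_lipschitz_ramp.
apply: local_slope_le; first exact: locally_lipschitz_ramp.
have d0 : 0 < s x - (y + w^-1) by rewrite subr_gt0.
near=> u; rewrite mul0r /f (ramp_eq1 (ltW sx)) ramp_eq1 ?subrr ?normr0//.
have : `|u - x| < s x - (y + w^-1).
  near: u; exact: (@cvgr_distC_lt _ _ _ (nbhs x) _ id x cvg_id _ d0).
by rewrite -s_iso ltr_norml => /andP[]; lra.
Unshelve. all: by end_near. Qed.

(** With [r] the value of the ramp, the quotient of slope by [f] is at most [N * w / r], singular as
    [r] tends to 0. The factor [f x ^+ 2] compensates for both branches of [Hq]: it is at most
    [r ^+ 2] and at most the power [q] of [r], the latter because [q <= n.+2]. *)
Lemma Hq_ramp (q : R) x : 2 <= q -> q <= n.+2%:R ->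
  Hq q (local_slope f x / f x) * f x ^+ 2 <=
  ((n.+2%:R * w) ^+ 2 + (n.+2%:R * w) `^ q) * \1_`[y, y + w^-1] (s x).
Proof.
move=> q2 qn; set N := n.+2%:R; have N0 : 0 <= N by [].
have Nw : 0 <= N * w by rewrite mulr_ge0// ltW.
have q0 : 0 < q by exact: lt_le_trans q2.
have fz : f x = 0 -> Hq q (local_slope f x / f x) * f x ^+ 2 = 0.
  by move=> ->; rewrite expr0n mulr0.
have sl0 : local_slope f x = 0 -> Hq q (local_slope f x / f x) * f x ^+ 2 = 0.
  move=> ->; rewrite mul0r /Hq expr0n/= normr0 powR0 ?gt_eqF//.
  by rewrite maxxx mul0r.
rewrite indicE; have [|] := boolP (s x \in _); rewrite ?inE ?notin_setE/= in_itv/=; last first.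
  move=> /negP; rewrite negb_and -!ltNge mulr0 => /orP[sy|sy].
    by rewrite fz// /f ramp_eq0 ?expr0n// ltW.
  by rewrite sl0// local_slope_ramp0.
move=> _; rewrite mulr1.
have r0 := ramp_ge0 (s x); have r1 := ramp_le1 (s x).
move: r0; rewrite le_eqVlt => /predU1P[rz|r0].
  by rewrite fz ?addr_ge0 ?powR_ge0 ?sqr_ge0// /f -rz expr0n.
set r := ramp (s x) in r0 r1 *.
have f0 : 0 < f x by rewrite exprn_gt0.
have g0 := local_slope_ge0 locally_lipschitz_ramp x.
have gle : local_slope f x / f x <= N * w / r.
  rewrite ler_pdivrMr// /f -/r exprS mulrA divfK ?gt_eqF//.
  exact: local_slope_ramp.
have gf0 : 0 <= local_slope f x / f x by rewrite divr_ge0// ltW.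
have Nr0 : 0 <= N * w / r by rewrite divr_ge0// ltW.
have fr : f x ^+ 2 = r ^+ 2 * r ^+ (n.+1 + n.+1).
  by rewrite /f -/r -exprM muln2 -addnn -exprD; congr (_ ^+ _); rewrite !addSn !addnS.
have rn1 : r ^+ (n.+1 + n.+1) <= 1 by rewrite exprn_ile1// ltW.
rewrite /Hq maxr_pMl ?sqr_ge0// ge_max; apply/andP; split.
  apply: (@le_trans _ _ ((N * w) ^+ 2)); last by rewrite lerDl powR_ge0.
  apply: (@le_trans _ _ ((N * w / r) ^+ 2 * f x ^+ 2)).
    by rewrite ler_wpM2r ?sqr_ge0// lerXn2r ?nnegrE.
  rewrite fr mulrA -exprMn divfK ?gt_eqF// ler_piMr ?sqr_ge0//.
apply: (@le_trans _ _ ((N * w) `^ q)); last by rewrite lerDr sqr_ge0.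
rewrite (ger0_norm gf0).
apply: (@le_trans _ _ ((N * w / r) `^ q * f x ^+ 2)).
  by rewrite ler_wpM2r ?sqr_ge0//; apply: ge0_ler_powR; rewrite ?nnegrE// ltW.
have E : f x ^+ 2 <= r `^ q.
  rewrite /f -/r -exprM -powR_mulrn; last exact: ltW.
  have r01 : 0 < r <= 1 by rewrite r0.
  apply: (ger_powR r01); apply: le_trans qn _.
  by rewrite ler_nat leq_pmulr.
apply: (@le_trans _ _ ((N * w / r) `^ q * r `^ q)).
  by rewrite ler_wpM2l ?powR_ge0.
by rewrite -powRM ?(ltW r0)// divfK// gt_eqF.
Qed.

End ramp.

(* By convexity of [x ln x], [f^2 ln f^2 >= f^2 ln a + f^2 - a] for all [a > 0];
   take [a = m / m']. *)
Lemma entropy_ge d (T : measurableType d) (R : realType) (P : probability T R)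
    (f : T -> R) (A : set T) (m m' : R) :
  measurable_fun setT f -> measurable A -> (forall x, 0 <= f x <= 1) ->
  (forall x, ~ A x -> f x = 0) ->
  (\int[P]_x (f x ^+ 2)%:E = m%:E)%E -> 0 < m -> 0 < m' ->
  (\int[P]_x (\1_A x)%:E <= m'%:E)%E ->
  ((- (m * ln m'))%:E <= entropy P (fun x => (f x ^+ 2)%R))%E.
Proof.
move=> mf mA f01 fA mE m0 m'0 Am'.
have f0 x : 0 <= f x by have /andP[] := f01 x.
have mf2 : measurable_fun setT (fun x => f x ^+ 2) by exact: measurable_funX.
have mln : measurable_fun setT (fun x => f x ^+ 2 * ln (f x ^+ 2)).
  by apply: measurable_funM => //; exact: (measurableT_comp (@measurable_ln R)).
(* Nonnegative because [f <= 1]. The affine upper bound [YX] makes its integral finite as well as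
   estimating it. *)
pose Y x := - (f x ^+ 2 * ln (f x ^+ 2)).
have mY : measurable_fun setT Y by exact: measurable_funN.
have Y0 x : 0 <= Y x.
  rewrite oppr_ge0 mulr_ge0_le0 ?sqr_ge0// ln_le0//.
  by have /andP[? ?] := f01 x; rewrite exprn_ile1.
have mind : measurable_fun setT (\1_A : T -> R) by exact: measurable_indic.
have ind0 x : 0 <= (\1_A x : R) by [].
have [a aE] : exists a, (\int[P]_x (\1_A x)%:E = a%:E)%E.
  exists (fine (\int[P]_x (\1_A x)%:E)%E); rewrite fineK// ge0_fin_numE.
    by apply: le_lt_trans Am' _; rewrite ltry.
  by apply: integral_ge0 => x _; rewrite lee_fin.
move: Am'; rewrite aE lee_fin => am'.
pose al := m / m'; have al0 : 0 < al by rewrite divr_gt0.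
have YX x : Y x <= al * \1_A x + - (1 + ln al) * f x ^+ 2 + 0.
  rewrite addr0 indicE; have [xA|xA] := boolP (x \in A); last first.
    have fx : f x = 0 by apply: fA => Ax; move: xA; rewrite mem_set.
    by rewrite /Y fx expr0n/= !mul0r !mulr0 oppr0 addr0.
  rewrite mulr1 /Y; have := f0 x; rewrite le_eqVlt => /predU1P[<-|fx].
    by rewrite expr0n/= mul0r mulr0 oppr0 addr0 ltW.
  have f2 : 0 < f x ^+ 2 by rewrite exprn_gt0.
  have := ln_le_sub1 (divr_gt0 al0 f2).
  rewrite ln_div ?posrE// => h.
  have := ler_wpM2l (ltW f2) h.
  have -> : f x ^+ 2 * (al / f x ^+ 2 - 1) = al - f x ^+ 2 by field; rewrite gt_eqF.
  lra.
have IX := @integral_affine _ _ _ P (\1_A) (fun x => f x ^+ 2) a m al (- (1 + ln al)) 0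
  mind mf2 ind0 (fun x => sqr_ge0 (f x)) aE mE.
have [eta etaE] : exists eta, (\int[P]_x (Y x)%:E = eta%:E)%E.
  exists (fine (\int[P]_x (Y x)%:E)%E); rewrite fineK// ge0_fin_numE.
    apply: (@le_lt_trans _ _ (al * a + - (1 + ln al) * m + 0)%:E); last exact: ltry.
    rewrite -IX; apply: ge0_le_integral_EFin; [by []|exact: mY| |by []|by []].
    by meas.
  by apply: integral_ge0 => x _; rewrite lee_fin.
have eta_le : eta <= al * a + - (1 + ln al) * m + 0.
  rewrite -lee_fin -etaE -IX; apply: ge0_le_integral_EFin; [by []|exact: mY| |by []|by []].
  by meas.
rewrite /entropy -[X in X == +oo%E]/(\int[P]_x (f x ^+ 2)%:E)%E mE /=.
have -> : (\int[P]_x (f x ^+ 2 * ln (f x ^+ 2))%:E = (- eta)%:E)%E.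
  have := @integral_affine _ _ _ P Y (fun x => f x ^+ 2) eta m (-1) 0 0
    mY mf2 Y0 (fun x => sqr_ge0 (f x)) etaE mE.
  rewrite mulN1r mul0r !addr0 => <-.
  by apply: eq_integral => x _; rewrite mul0r !addr0 mulN1r opprK.
rewrite -EFinB lee_fin.
have : al * a <= m.
  by rewrite /al mulrAC ler_pdivrMr// ler_wpM2l// ltW.
have lal : ln al = ln m - ln m' by rewrite /al ln_div ?posrE.
move: eta_le; rewrite lal; lra.
Qed.

Lemma is_derive_dist_le (R : realType) (f df : R -> R) (K x0 r : R) :
  (forall z, `|z - x0| <= r -> is_derive z 1 f (df z) /\ `|df z| <= K) ->
  forall z, `|z - x0| <= r -> `|f z - f x0| <= K * `|z - x0|.
Proof.
move=> H z zr.
have main (a b : R) : a <= b -> `|a - x0| <= r -> `|b - x0| <= r ->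
    `|f b - f a| <= K * `|b - a|.
  move=> ab aR bR.
  have [/andP[a1 a2] /andP[b1 b2]] : (- r <= a - x0 <= r) /\ (- r <= b - x0 <= r).
    by rewrite -!ler_norml.
  have inab t : a <= t <= b -> `|t - x0| <= r.
    by move=> /andP[t1 t2]; rewrite ler_norml; apply/andP; split; lra.
  have [|t tab ->] := @MVT_is_derive _ f df a b ab; first by move=> t /inab /H[].
  by rewrite normrM ler_wpM2r//; have [] := H t (inab t tab).
have r0 : `|x0 - x0| <= r by rewrite subrr normr0 (le_trans _ zr).
have [zx|/ltW xz] := leP z x0; last exact: main.
by rewrite distrC [`|z - x0|]distrC; exact: main.
Qed.

Section segment_integral.
Context (R : realType).
Local Notation leb := (@lebesgue_measure R).

Lemma integral_indic_subset (B D : set R) (h : R -> R) : B `<=` D ->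
  (\int[leb]_(x in D) (\1_B x * h x)%:E = \int[leb]_(x in B) (h x)%:E)%E.
Proof.
move=> BD; rewrite integral_mkcond [RHS]integral_mkcond.
apply: eq_integral => x _; rewrite !patchE indicE.
have [xB|xB] := boolP (x \in B); last by rewrite mul0r; case: ifP.
by rewrite mul1r ifT//; move: xB; rewrite !inE; exact: BD.
Qed.

Lemma integral_segment_cst (a b K : R) : a <= b ->
  (\int[leb]_(x in `[a, b]) K%:E = (K * (b - a))%:E)%E.
Proof.
rewrite integral_cst//= lebesgue_measure_itv/= lte_fin.
rewrite le_eqVlt => /predU1P[->|->]; first by rewrite ltxx subrr mulr0 mule0.
by rewrite -EFinB -EFinM.
Qed.

End segment_integral.

(** * The inequality tested at a far point *)

Section necessity.
Context (R : realType) (mu : probability (measurableTypeR R) R) (q kappa : R) (n : nat).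
Local Notation leb := (@lebesgue_measure R).
Hypothesis q2 : 2 <= q.
Hypothesis qn : q <= n.+2%:R.
Hypothesis kappa0 : 0 <= kappa.
Hypothesis ineq : forall f, locally_lipschitz f ->
  (entropy mu (fun x : R => (f x ^+ 2)%R) <= kappa%:E * Hq_energy mu q f)%E.

Variables (U W dW s : R -> R) (M c : R).
Hypothesis mU : measurable_fun setT U.
Hypothesis c0 : 0 < c.
Hypothesis M0 : 0 <= M.
Hypothesis tail : regular_tail q U W dW M c.
Hypothesis ms : measurable_fun setT s.
Hypothesis s_iso : forall x x', `|s x - s x'| = `|x - x'|.
Hypothesis s_int : forall G : R -> R, measurable_fun setT G -> (forall x, 0 <= G x) ->
  (forall x, x <= 0 -> G x = 0) ->
  (\int[mu]_x (G (s x))%:E = \int[leb]_(x in `[0%R, +oo[) (G x * expR (- U x))%:E)%E.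

(** The derivative of [1 / W] is at most [1 / 2] in absolute value, so over a distance [1 / W x0]
    the function [1 / W] loses at most half of its value at [x0]. Thus [W <= 2 * W x0] there, and
    [U] varies by at most 2. As [W x0 >= c], the margin [c^-1] keeps the whole interval beyond
    [M]. *)
Lemma slow_variation x0 x : M + c^-1 <= x0 -> `|x - x0| <= (W x0)^-1 ->
  `|U x - U x0| <= 2.
Proof.
move=> Mx0 xx0.
have ci0 : 0 < c^-1 by rewrite invr_gt0.
have Mx : M <= x0 by lra.
have [_ _ cw _] := tail Mx.
have w0 : 0 < W x0 by exact: lt_le_trans cw.
have wc : (W x0)^-1 <= c^-1 by rewrite lef_pV2 ?posrE.
have inM z : `|z - x0| <= (W x0)^-1 -> M <= z.
  by rewrite ler_norml => /andP[]; lra.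
have Wpos z : M <= z -> 0 < W z.
  by move=> /tail[_ _ cz _]; exact: lt_le_trans cz.
have Wle z : `|z - x0| <= (W x0)^-1 -> W z <= 2 * W x0.
  move=> zx0.
  have := @is_derive_dist_le _ (fun t => (W t)^-1) (fun t => - (W t) ^- 2 * dW t)
    (1 / 2) x0 (W x0)^-1 _ z zx0.
  have hyp t : `|t - x0| <= (W x0)^-1 ->
    is_derive t 1 (fun t => (W t)^-1) (- (W t) ^- 2 * dW t) /\
    `|- (W t) ^- 2 * dW t| <= 1 / 2.
    move=> /inM Mt; have [_ [dw dwE] _ bdW] := tail Mt.
    have Wt0 := Wpos t Mt.
    have Wtn0 : W t != 0 by rewrite gt_eqF.
    split.
      apply: DeriveDef; first exact: derivableV.
      by rewrite deriveV// dwE.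
    have W2 : 0 < W t ^+ 2 by rewrite exprn_gt0.
    rewrite normrM normrN (gtr0_norm (_ : 0 < W t ^- 2)) ?invr_gt0//.
    rewrite ler_pdivrMl//.
    have : `|dW t| <= (q - 1) * `|dW t| by rewrite ler_peMl// lerBrDr.
    lra.
  move=> /(_ hyp) h.
  have Mz := inM z zx0; have Wz := Wpos z Mz.
  have : (2 * W x0)^-1 <= (W z)^-1.
    rewrite invfM; move: h; rewrite ler_norml => /andP[h _]; lra.
  by rewrite lef_pV2 ?posrE// mulr_gt0.
have := @is_derive_dist_le _ U W (2 * W x0) x0 (W x0)^-1 _ x xx0.
have hyp t : `|t - x0| <= (W x0)^-1 -> is_derive t 1 U (W t) /\ `|W t| <= 2 * W x0.
  move=> tx0; have Mt := inM t tx0; have [dU _ _ _] := tail Mt; split=> //.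
  by rewrite gtr0_norm ?Wpos// Wle.
move=> /(_ hyp) h; apply: (le_trans h).
by rewrite -mulrA ler_piMr// -ler_pdivlMl// mulr1.
Qed.

(** Integration by parts with [k = 1], whose slope is 0. *)
Lemma tail_integral_le y : M <= y ->
  (\int[leb]_(x in `[y, +oo[) (expR (- U x))%:E <= (expR (- U y) / c)%:E)%E.
Proof.
move=> My.
have mE D : measurable_fun D (fun x => expR (- U x)) by exact: measurable_expRN.
have : (\int[leb]_(x in `[y, +oo[) (c * expR (- U x))%:E <=
    (expR (- U y) * 1)%:E + \int[leb]_(x in `[y, +oo[) 0%:E)%E.
  refine (proj2 (@lyapunov_halfline _ U W y (fun=> 1) (fun=> 0)
    (fun x => c * expR (- U x)) (fun=> 0) _ _ _ _ _ _ _ _ _ _)).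
  - by move=> x yx; have [] := tail (le_trans My yx).
  - by move=> x yx; have [_ _ cx _] := tail (le_trans My yx); rewrite (le_trans _ cx)// ltW.
  - by apply/locally_lipschitzP => x; exists 1, 0; split=> // *; rewrite subrr normr0 mul0r.
  - by [].
  - by move=> x e e0; near=> z; rewrite subrr normr0 mulr_ge0// add0r ltW.
  - by apply: measurable_funM.
  - exact: measurable_cst.
  - by move=> x _; rewrite mulr_ge0 ?expR_ge0// ltW.
  - by [].
  - move=> x yx; have [_ _ cx _] := tail (le_trans My yx).
    by have := ler_wpM2l (expR_ge0 (- U x)) cx; lra.
rewrite integral0 adde0 mulr1.
rewrite ge0_integralZl_real; [|by []|exact: mE|by move=> ? _; exact: expR_ge0|exact: ltW].
move=> h; rewrite -(@lee_pmul2l _ c%:E) ?lte_fin// -EFinM mulrCA divff ?mulr1//.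
by rewrite gt_eqF.
Unshelve. all: by end_near. Qed.

Lemma potential_bound : exists2 C, 0 <= C &
  forall x, M + c^-1 + 1 <= x -> U x <= C * W x `^ q.
Proof.
pose N : R := n.+2%:R.
(* [K0 - U x0] is the logarithm of the bound [m'] on the mass of the support. In [C], [expR 4] is
   the ratio of the bounds [expR 2 * E] and [expR (- 2) * E] on the density near [x0], and the
   powers of [c] convert constants and [w ^+ 2] into multiples of the power [q] of [w], using
   [w >= c]. *)
pose K0 := 2 - ln c.
pose C := `|K0| / c `^ q + kappa * expR 4 * (N ^+ 2 / c `^ (q - 2) + N `^ q).
exists C; first by rewrite /C; pos.
move=> x0 Mx0; set w := W x0.
have ci0 : 0 < c^-1 by rewrite invr_gt0.
have Mx0' : M + c^-1 <= x0 by lra.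
have MM : M <= x0 by lra.
have [_ _ cw _] := tail MM; rewrite -/w in cw.
have w0 : 0 < w by exact: lt_le_trans cw.
have wc : w^-1 <= c^-1 by rewrite lef_pV2 ?posrE.
have wi0 : 0 < w^-1 by rewrite invr_gt0.
(* The extra 1 in the condition on [x0] makes [y] positive, so that the test function and the
   indicators below vanish for [s x <= 0] and only one half-line contributes. *)
pose y := x0 - w^-1.
have yw : y + w^-1 = x0 by rewrite subrK.
have M0' := M0; have q2' := q2.
have y0 : 0 < y by rewrite /y; lra.
have My : M <= y by rewrite /y; lra.
have Uy z : y <= z -> z <= x0 + w^-1 -> `|U z - U x0| <= 2.
  move=> yz zx; apply: slow_variation => //; rewrite -/w ler_norml.
  by move: yz; rewrite /y => yz; apply/andP; split; lra.
have mE D : measurable_fun D (fun x => expR (- U x)) by exact: measurable_expRN.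
set E := expR (- U x0); have E0 : 0 < E by exact: expR_gt0.
pose f x := ramp w y (s x) ^+ n.+2.
have lf : locally_lipschitz f by exact: locally_lipschitz_ramp.
have f01 x : 0 <= f x <= 1.
  by rewrite exprn_ge0 ?ramp_ge0// exprn_ile1// ?ramp_ge0 ?ramp_le1.
have mf : measurable_fun setT f.
  by apply: continuous_measurable_fun; exact: locally_lipschitz_continuous.
pose G z := (ramp w y z ^+ n.+2) ^+ 2.
have G0 z : 0 <= G z by exact: sqr_ge0.
have mG : measurable_fun setT G.
  apply: measurable_funX; apply: measurable_funX.
  by apply: continuous_measurable_fun; exact: continuous_ramp.
have mGE D : measurable_fun D (fun x => G x * expR (- U x)).
  by apply: measurable_funTS; exact: (measurable_funM mG (mE _)).
have f2E : (\int[mu]_x (f x ^+ 2)%:E = \int[leb]_(x in `[0%R, +oo[) (G x * expR (- U x))%:E)%E.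
  apply: (s_int mG G0) => z z0; rewrite /G ramp_eq0//; last exact: (le_trans z0 (ltW y0)).
  by rewrite !expr0n.
have [m mdef] : exists m, (\int[mu]_x (f x ^+ 2)%:E = m%:E)%E.
  exists (fine (\int[mu]_x (f x ^+ 2)%:E)%E); rewrite fineK// ge0_fin_numE.
    apply: (@le_lt_trans _ _ (\int[mu]_x 1%:E)%E); last first.
      by rewrite integral_probability_cst ltry.
    apply: ge0_le_integral_EFin => //; first exact: measurable_funX.
    - by move=> x _; exact: sqr_ge0.
    - by move=> x _; have /andP[? ?] := f01 x; rewrite exprn_ile1.
  by apply: integral_ge0 => x _; rewrite lee_fin sqr_ge0.
(* Only the plateau over [[x0, x0 + w^-1]] is counted, where the ramp is 1 and the density is at
   least [expR (- 2) * E]. *)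
have mlow : expR (- 2) * E / w <= m.
  rewrite -lee_fin -mdef f2E.
  have -> : expR (- 2) * E / w = expR (- 2) * E * (x0 + w^-1 - x0) by rewrite addrAC subrr add0r.
  rewrite -integral_segment_cst; last by rewrite lerDl ltW.
  apply: (@le_trans _ _ (\int[leb]_(x in `[x0, (x0 + w^-1)%R]) (G x * expR (- U x))%:E)%E).
    apply: ge0_le_integral_EFin => //.
    - exact: mGE.
    - by move=> x _; rewrite mulr_ge0 ?expR_ge0// ltW.
    - move=> z; rewrite /= in_itv/= => /andP[z1 z2].
      rewrite /G ramp_eq1 ?yw// !expr1n mul1r -expRD ler_expR.
      have yz : y <= z by rewrite /y; lra.
      by have := Uy z yz z2; rewrite ler_norml => /andP[]; lra.
  apply: subset_integral_EFin => //.
  - by move=> z; rewrite mulr_ge0 ?expR_ge0.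
  - move=> z; rewrite /= !in_itv/= andbT => /andP[z1 _]; lra.
have m0 : 0 < m by apply: lt_le_trans mlow; rewrite !mulr_gt0 ?expR_gt0.
pose A := s @^-1` `[y, +oo[%classic.
have mA : measurable A by rewrite -[A]setTI; exact: ms.
have indA x : \1_A x = \1_`[y, +oo[ (s x) :> R by rewrite !indicE.
have mind (B : set R) : measurable B -> measurable_fun setT (\1_B : R -> R).
  by move=> ?; exact: measurable_indic.
pose m' := expR 2 * E / c.
have m'0 : 0 < m' by rewrite !mulr_gt0 ?expR_gt0.
have mup : (\int[mu]_x (\1_A x)%:E <= m'%:E)%E.
  under eq_integral do rewrite indA.
  rewrite (s_int (mind _ _)) => //; last first.
    move=> x x0'; rewrite indicE memNset//= in_itv/= andbT; apply/negP.
    by rewrite -ltNge (le_lt_trans x0').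
  rewrite integral_indic_subset; last first.
    by move=> z; rewrite /= !in_itv/= !andbT; exact/le_trans/ltW.
  apply: (le_trans (tail_integral_le My)); rewrite lee_fin /m'.
  apply: ler_wpM2r; first exact: ltW.
  rewrite -expRD ler_expR.
  have yy : y <= x0 + w^-1 by rewrite /y; lra.
  by have := Uy y (lexx _) yy; rewrite ler_norml => /andP[]; lra.
have Ent := @entropy_ge _ _ R mu f A m m' mf mA f01 _ mdef m0 m'0 mup.
have {}Ent : ((- (m * ln m'))%:E <= entropy mu (fun x => (f x ^+ 2)%R))%E.
  apply: Ent => x nA; rewrite /f ramp_eq0 ?expr0n//.
  by apply: contra_notT nA; rewrite -ltNge /A /= in_itv/= andbT => /ltW.
pose K := (N * w) ^+ 2 + (N * w) `^ q.
have K1 : 0 <= K by rewrite addr_ge0 ?sqr_ge0 ?powR_ge0.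
have Ener : (Hq_energy mu q f <= (K * (expR 2 * E / w))%:E)%E.
  apply: (@le_trans _ _ (\int[mu]_x (K * \1_`[y, (y + w^-1)%R] (s x))%:E)%E).
    apply: ge0_le_integral_EFin => //.
    - exact: measurable_Hq (measurable_local_slope lf).
    - by apply: measurable_funM => //; exact: (measurableT_comp (mind _ _)).
    - by move=> x _; rewrite mulr_ge0 ?Hq_ge0 ?sqr_ge0.
    - by move=> x _; exact: Hq_ramp.
  rewrite ge0_integralZl_real//; last exact: (measurableT_comp (mind _ _)).
  rewrite EFinM; apply: lee_wpmul2l; first by rewrite lee_fin.
  rewrite yw (s_int (mind _ _)) => //; last first.
    move=> x x0'; rewrite indicE memNset//= in_itv/=; apply/negP.
    by rewrite negb_and -ltNge (le_lt_trans x0').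
  rewrite integral_indic_subset; last first.
    by move=> z; rewrite /= !in_itv/= !andbT => /andP[yz _]; apply: le_trans yz; exact: ltW.
  have -> : expR 2 * E / w = expR 2 * E * (x0 - y) by rewrite /y opprB addrC subrK.
  rewrite -integral_segment_cst; last by rewrite /y; lra.
  apply: ge0_le_integral_EFin;
    [by []|exact: mE|exact: measurable_cst|by move=> x _; exact: expR_ge0|].
  move=> z; rewrite /= in_itv/= => /andP[z1 z2]; rewrite -expRD ler_expR.
  have zz : z <= x0 + w^-1 by lra.
  by have := Uy z z1 zz; rewrite ler_norml => /andP[]; lra.
have main : - (m * ln m') <= kappa * (K * (expR 2 * E / w)).
  rewrite -lee_fin; apply: (le_trans Ent); apply: (le_trans (ineq lf)).
  by rewrite EFinM; apply: lee_wpmul2l; rewrite ?lee_fin.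
have lnm' : ln m' = K0 - U x0.
  rewrite /m' /E -expRD lnM ?posrE ?expR_gt0 ?invr_gt0// expRK lnV ?posrE//.
  by rewrite /K0; ring.
have wq : w `^ q = w ^+ 2 * w `^ (q - 2).
  rewrite -powR_mulrn ?(ltW w0)// -powRD; last by rewrite (gt_eqF w0) implybT.
  by congr (_ `^ _); ring.
have cq2 : 0 < c `^ (q - 2) by rewrite powR_gt0.
have cq : 0 < c `^ q by rewrite powR_gt0.
have e1 : `|K0| <= `|K0| / c `^ q * w `^ q.
  rewrite mulrAC ler_pdivlMr// ler_wpM2l//.
  by apply: ge0_ler_powR; rewrite ?nnegrE ?(ltW c0) ?(ltW w0)//; lra.
have e2 : w ^+ 2 <= w `^ q / c `^ (q - 2).
  rewrite ler_pdivlMr// wq ler_wpM2l ?sqr_ge0//.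
  by apply: ge0_ler_powR; rewrite ?nnegrE ?(ltW c0) ?(ltW w0) ?subr_ge0.
have e3 : K <= (N ^+ 2 / c `^ (q - 2) + N `^ q) * w `^ q.
  rewrite /K exprMn powRM ?(ltW w0)// mulrDl lerD2r.
  by rewrite -mulrA ler_wpM2l ?sqr_ge0// mulrC.
have CE : C * w `^ q = `|K0| / c `^ q * w `^ q +
   kappa * expR 4 * ((N ^+ 2 / c `^ (q - 2) + N `^ q) * w `^ q) by rewrite /C; ring.
have e4 : kappa * expR 4 * K <= kappa * expR 4 * ((N ^+ 2 / c `^ (q - 2) + N `^ q) * w `^ q).
  by rewrite ler_wpM2l// mulr_ge0// expR_ge0.
have KK0 : 0 <= kappa * expR 4 * K by pos.
have absK := ler_norm K0.
(* The lower bound on [m] may be inserted in [main] only when [U x0 - K0] is nonnegative; otherwise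
   the first term of [C] is enough. *)
have [UK|UK] := leP (U x0) K0; first by rewrite CE; lra.
have UK0 : 0 <= U x0 - K0 by lra.
have h1 : expR (- 2) * E / w * (U x0 - K0) <= kappa * (K * (expR 2 * E / w)).
  apply: le_trans main; rewrite lnm'.
  by have := ler_wpM2r UK0 mlow; lra.
have h2 : U x0 - K0 <= kappa * expR 4 * K.
  have D0 : 0 < expR (- 2) * E / w by rewrite !mulr_gt0 ?expR_gt0.
  rewrite -(ler_pM2l D0); apply: (le_trans h1).
  have -> : expR 2 = expR (- 2) * expR 4 :> R.
    by rewrite -expRD; congr expR; ring.
  by rewrite le_eqVlt; apply/orP; left; apply/eqP; ring.
rewrite CE; lra.
Qed.

End necessity.

Lemma limf_esup_absinfty_ltP (R : realType) (h : R -> R) :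
  (limf_esup (fun x => (h x)%:E) (absinfty_nbhs R) < +oo)%E <->
  exists C M : R, forall x, M < `|x| -> h x <= C.
Proof.
rewrite limf_esupE; split=> [/ereal_inf_lt[_ [U [M UM] <-]]|[C [M H]]].
  set m := ereal_sup _ => moo.
  have lem (x : R) : M < `|x| -> ((h x)%:E <= m)%E.
    by move=> xM; apply: ereal_sup_ubound; exists x => //; exact: UM.
  exists (fine m), M => x /lem; move: moo.
  by case: m {lem} => [m _|//|]; rewrite ?lee_fin// leeNy_eq.
apply: (@le_lt_trans _ _ C%:E); last exact: ltry.
apply: (@le_trans _ _ (ereal_sup [set (h x)%:E | x in [set x | M < `|x|]])).
  by apply: ereal_inf_lbound; exists [set x | M < `|x|] => //; exists M.
by apply: ge_ereal_sup => _ [x /H hx <-]; rewrite lee_fin.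
Qed.

Theorem theorem12 (R : realType) (q : R) (V : R -> R)
    (mu : probability (measurableTypeR R) R) :
  2 <= q ->
  measurable_fun setT V ->
  (forall A : set (measurableTypeR R), measurable A ->
    mu A = (\int[lebesgue_measure]_(x in A) (expR (- V x))%:E)%E) ->
  (forall x : R, bounded_near V (nbhs x)) ->
  (\forall x \near absinfty_nbhs R,
    [/\ derivable V x 1, derivable (derive1 V) x 1 & {for x, continuous (derive1n 2 V)}]) ->
  (0 < limf_einf (fun x : R => (Num.sg x * derive1 V x)%:E) (absinfty_nbhs R))%E ->
  derive1n 2 V x / derive1 V x ^+ 2 @[x --> absinfty_nbhs R] --> (0 : R) ->
  ((exists kappa : R, forall f : R -> R, locally_lipschitz f ->
      (entropy mu (fun x : R => (f x ^+ 2)%R) <= kappa%:E * Hq_energy mu q f)%E)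
   <->
   (limf_esup (fun x : R => (V x / `|derive1 V x| `^ q)%:E) (absinfty_nbhs R) < +oo)%E).
Proof.
move=> q2 mV muE Vloc VC2 liminfV' limV''.
have [c [M0 [c0 M00 tails]]] := regular_tails q2 VC2 liminfV' limV''.
(* One integer serves both directions: the order of the truncation and the power of the ramp are
   [n.+2], and each must be at least [q]. *)
pose n := Num.bound q.
have qn : q <= n.+2%:R.
  have := archi_boundP (le_trans (ler0n R 2) q2); rewrite -/n => /ltW/le_trans; apply.
  by rewrite ler_nat -addn2 leq_addr.
rewrite limf_esup_absinfty_ltP; split=> [[kappa kappaP]|[C1 [M1 H1]]].
  have [tr tl] := tails M0 (lexx _).
  (* The energy is nonnegative, so [kappa] can be replaced by its positive part. *)
  have ineq f : locally_lipschitz f ->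
      (entropy mu (fun x : R => (f x ^+ 2)%R) <= (Num.max kappa 0)%:E * Hq_energy mu q f)%E.
    move=> lf; apply: (le_trans (kappaP f lf)); apply: lee_wpmul2r.
      by apply: integral_ge0 => x _; rewrite lee_fin mulr_ge0 ?Hq_ge0 ?sqr_ge0.
    by rewrite lee_fin le_max lexx.
  have kappa0 : 0 <= Num.max kappa 0 by rewrite le_max lexx orbT.
  have [Cr Cr0 Hr] : exists2 C, 0 <= C &
      forall x : R, M0 + c^-1 + 1 <= x -> V x <= C * derive1 V x `^ q.
    apply: (potential_bound q2 qn kappa0 ineq mV c0 M00 tr (s := id)) => //.
    move=> G mG G0 Gneg; rewrite (integral_density_reflect mV muE)//.
    rewrite [X in (_ + X)%E]integral0_eq ?adde0// => x; rewrite /= in_itv/= andbT => x0.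
    by rewrite Gneg ?mul0r// oppr_le0.
  have [Cl Cl0 Hl] : exists2 C, 0 <= C &
      forall x : R, M0 + c^-1 + 1 <= x -> V (- x) <= C * (- derive1 V (- x)) `^ q.
    apply: (potential_bound q2 qn kappa0 ineq _ c0 M00 tl (s := -%R)).
    - exact: measurableT_comp.
    - exact: oppr_measurable.
    - by move=> x x'; rewrite opprK addrC distrC addrC.
    move=> G mG G0 Gneg; rewrite (integral_density_reflect mV muE)//; last exact: measurableT_comp.
    rewrite [X in (X + _)%E]integral0_eq ?add0e.
      by apply: eq_integral => x _; rewrite opprK.
    move=> x; rewrite /= in_itv/= andbT => x0.
    by rewrite Gneg ?mul0r// oppr_le0.
  have ci0 : 0 < c^-1 by rewrite invr_gt0.
  exists (Num.max Cr Cl), (M0 + c^-1 + 1) => x.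
  have [x0|x0] := leP 0 x.
    rewrite ger0_norm// => xM.
    have M0x : M0 <= x by lra.
    have [_ _ cW _] := tr x M0x.
    have W0 : 0 < derive1 V x by exact: lt_le_trans cW.
    rewrite gtr0_norm// ler_pdivrMr ?powR_gt0//.
    apply: (le_trans (Hr x (ltW xM))).
    by rewrite ler_wpM2r ?powR_ge0// le_max lexx.
  rewrite ltr0_norm// => xM.
  have M0x : M0 <= - x by lra.
  have [_ _ + _] := tl (- x) M0x; rewrite opprK => cW.
  have W0 : 0 < - derive1 V x by exact: lt_le_trans cW.
  have := Hl (- x) (ltW xM); rewrite !opprK => h.
  rewrite -normrN gtr0_norm// ler_pdivrMr ?powR_gt0//; apply: (le_trans h).
  by rewrite ler_wpM2r ?powR_ge0// le_max lexx orbT.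
(* Beyond this [M] both tails are regular and the growth bound holds; the strict inequality [M1 < M]
   lets it apply at [M] itself. *)
pose M := Num.max M0 (`|M1| + 1).
have M0M : M0 <= M by rewrite le_max lexx.
have M1M : M1 < M.
  by rewrite (@lt_le_trans _ _ (`|M1| + 1)) ?le_max ?lexx ?orbT//
    (le_lt_trans (ler_norm _))// ltrDl.
have MM : 0 <= M by exact: le_trans M0M.
have [tr tl] := tails M M0M.
pose C0 := Num.max C1 0.
have C00 : 0 <= C0 by rewrite le_max lexx orbT.
have C1C0 : C1 <= C0 by rewrite le_max lexx.
have bound x : M <= `|x| -> 0 < `|derive1 V x| -> V x <= C0 * `|derive1 V x| `^ q.
  move=> xM W0; rewrite -ler_pdivrMr ?powR_gt0//.
  by rewrite (le_trans (H1 x _))// (lt_le_trans M1M).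
have HVWr x : M <= x -> V x <= C0 * derive1 V x `^ q.
  move=> xM; have [_ _ cW _] := tr x xM.
  have W0 : 0 < derive1 V x by exact: lt_le_trans cW.
  by have := bound x; rewrite (ger0_norm (le_trans MM xM)) (gtr0_norm W0); apply.
have HVWl x : M <= x -> V (- x) <= C0 * (- derive1 V (- x)) `^ q.
  move=> xM; have [_ _ cW _] := tl x xM.
  have W0 : 0 < - derive1 V (- x) by exact: lt_le_trans cW.
  have := bound (- x); rewrite normrN -[`|derive1 V _|]normrN (gtr0_norm W0).
  by rewrite (ger0_norm (le_trans MM xM)); apply.
have [B B0 HB] := bounded_near_segment M Vloc.
have [CP CP0 poin] := poincare mV muE c0 MM HB tr tl.
have [CE CE0 ener] := potential_energy mV muE c0 MM B0 HB tr tl q2 qn C00 HVWr HVWl.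
exists (entropy_const CP CE B n) => f lf.
exact: (entropy_le CP0 CE0 MM mV (potential_ge c0 MM HB tr tl) HB poin ener lf).
Qed.
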